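(* Let $d\in\{2,3,\dots\}\cup\{\infty\}$, $\lambda=\frac{d-2}{2}$, let $\mu$ be a finite measure on $[0,\infty)$, and let $K$ be the stationary isotropic kernel on $\mathbb{R}^d$ given by $$K(x,y)=\begin{cases}\displaystyle\int_{[0,\infty)}\exp\bigl(-s^2\tfrac{\|x-y\|^2}{2}\bigr)\,d\mu(s), & d=\infty,\\[2ex]\displaystyle\int_{[0,\infty)}\Omega_d(s\|x-y\|)\,d\mu(s), & d<\infty.\end{cases}$$ Then the unique kernels $\alpha_n^d$, $n\in\mathbb{N}_0$, associated with $K$ (as a continuous isotropic positive definite kernel, see the context) are given by $$\alpha_n^d(\|x\|,\|y\|)=\int_{[0,\infty)}\phi_n^d(s\|x\|)\,\phi_n^d(s\|y\|)\,d\mu(s),$$ with $$\phi_n^d(t):=\begin{cases}\displaystyle\exp\bigl(-\tfrac{t^2}{2}\bigr)\frac{t^n}{\sqrt{n!}}, & d=\infty,\\[2ex]\displaystyle 2^\lambda\,\Gamma\bigl(\tfrac d2\bigr)\sqrt{N_n^d}\;\frac{J_{n+\lambda}(t)}{t^\lambda}, & d<\infty.\end{cases}$$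
   Context: For $d=\infty$, $\mathbb{R}^\infty:=\ell^2$ is the real Hilbert space of square summable real sequences. $O(d)$ is the group of (bijective) linear isometries of $\mathbb{R}^d$. A positive definite kernel on a set $X$ is a function $K\colon X\times X\to\mathbb{C}$ such that $\sum_{i,j=1}^m c_i\overline{c_j}K(x_i,x_j)\ge 0$ for all $m\in\mathbb{N}$, $x_1,\dots,x_m\in X$, $c\in\mathbb{C}^m$; it is isotropic (for $X=\mathbb{R}^d$) if $K(Ux,Uy)=K(x,y)$ for all $U\in O(d)$, $x,y$. $\Omega_d(t)=\mathbb{E}[e^{it\langle v,U\rangle}]$, where $U$ is uniformly distributed on the unit sphere $\mathbb{S}^{d-1}$ and $v$ is any fixed vector with $\|v\|=1$. By a theorem of Schoenberg, the kernels $K$ displayed in the claim are exactly the continuous positive definite kernels on $\mathbb{R}^d$ invariant under all Euclidean isometries. $J_\alpha$ is the Bessel function of the first kind. $N_n^d$ is the dimension of the space of spherical harmonics of degree $n$ on $\mathbb{S}^{d-1}$: $N_n^d=\frac{n+\lambda}{\lambda}\binom{n+2\lambda-1}{n}$ for $d\ge3$, and $N_0^2=1$, $N_n^2=2$ for $n\ge1$. At $t=0$, $J_{n+\lambda}(t)/t^\lambda$ is understood by continuous extension, and $0^0=1$. Normalized Gegenbauer polynomials: for $0<\lambda<\infty$, $\hat C_n^\lambda(t)=C_n^\lambda(t)/C_n^\lambda(1)$ where $\sum_{n\ge0}z^nC_n^\lambda(t)=(1-2tz+z^2)^{-\lambda}$ ($|z|<1$, $t\in[-1,1]$); for $\lambda=0$,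 $\hat C_n^0=T_n$ with $T_n(\cos\theta)=\cos(n\theta)$; for $\lambda=\infty$, $\hat C_n^\infty(t)=t^n$ (with $0^0=1$). Associated kernels $\alpha_n^d$: every continuous isotropic positive definite kernel $K$ on $\mathbb{R}^d$ can be written as $K(x,y)=\sum_{n=0}^\infty\alpha_n^d(\|x\|,\|y\|)\,\hat C_n^\lambda(\langle\frac{x}{\|x\|},\frac{y}{\|y\|}\rangle)$ for $x,y\neq0$, and $K(x,y)=\alpha_0^d(\|x\|,\|y\|)$ if $x=0$ or $y=0$, where $\alpha_n^d\colon[0,\infty)^2\to\mathbb{C}$ are the unique continuous positive definite kernels on $[0,\infty)$ satisfying this together with: (a) for every $r\ge0$ there is a neighborhood $U_r\subset[0,\infty)$ of $r$ with $\sup_{s\in U_r}\sum_{n\ge N}\alpha_n^d(s,s)\to0$ as $N\to\infty$; (b) $\alpha_n^d(r,0)=\alpha_n^d(0,r)=0$ for all $n\ge1$, $r\ge0$. *)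

(* Defs.v *)
From HB Require Import structures.
From mathcomp Require Import all_boot all_order all_algebra.
From mathcomp Require Import all_classical all_reals all_analysis.
From mathcomp Require Import complex ring.

Set Implicit Arguments.
Unset Strict Implicit.
Unset Printing Implicit Defensive.

Import Order.TTheory GRing.Theory Num.Theory.
Import numFieldNormedType.Exports.

Local Open Scope classical_set_scope.
Local Open Scope complex_scope.
Local Open Scope ring_scope.

Section SquareSummable.
Variable R : realType.

Definition square_summable : {pred (nat -> R)} :=
  [pred u : nat -> R | `[< cvgn (series (fun i => u i ^+ 2)) >]].

Lemma square_summable_submod_closed : submod_closed square_summable.
Proof.
split.
  apply/asboolP.
  rewrite (_ : series _ = cst 0) /=; first exact: is_cvg_cst.
  by apply/funext => n; rewrite /series /= big1 // => i _; rewrite expr2 mul0r.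
move=> a u v /asboolP cu /asboolP cv; apply/asboolP => /=.
have cw := is_cvg_seriesD (is_cvg_seriesZ (k := 2 * a ^+ 2) cu)
                          (is_cvg_seriesZ (k := 2) cv).
apply: (series_le_cvg _ _ _ cw) => i; first exact: sqr_ge0.
  by apply: addr_ge0; apply: mulr_ge0 => //; [apply: mulr_ge0 => //|..];
     exact: sqr_ge0.
rewrite -[leRHS]/(2 * a ^+ 2 * u i ^+ 2 + 2 * v i ^+ 2).
rewrite -[(a *: u + v) i]/(a * u i + v i) -subr_ge0.
rewrite (_ : _ - _ = (a * u i - v i) ^+ 2) ?sqr_ge0 //; ring.
Qed.

HB.instance Definition _ := GRing.isSubmodClosed.Build R (nat -> R)
  square_summable square_summable_submod_closed.

Record ell2 := Ell2 {
  ell2_seq :> nat -> R;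
  _ : ell2_seq \in square_summable }.

HB.instance Definition _ := [isSub for ell2_seq].
HB.instance Definition _ := [Choice of ell2 by <:].
HB.instance Definition _ := [SubChoice_isSubLmodule of ell2 by <:].

End SquareSummable.

Inductive dimension := Fin of nat | Infty.

Definition dim_ge2 (d : dimension) : Prop :=
  match d with Fin n => (2 <= n)%N | Infty => True end.

Section EuclideanSpaces.
Variable R : realType.

Definition euclid (d : dimension) : lmodType R :=
  match d with Fin n => 'rV[R]_n | Infty => ell2 R end.

Definition dot (d : dimension) : euclid d -> euclid d -> R :=
  match d with
  | Fin n => fun x y : 'rV[R]_n => \sum_(i < n) x ord0 i * y ord0 i
  | Infty => fun x y : ell2 R => limn (series (fun i => x i * y i))
  end.

(* The library's norm on ['rV[R]_n] is the sup norm, hence this one. *)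
Definition enorm (d : dimension) (x : euclid d) : R := Num.sqrt (dot x x).

Definition orthogonal_group (d : dimension) : set (euclid d -> euclid d) :=
  [set f | [/\ linear f, bijective f & forall x, enorm (f x) = enorm x]].

Definition posdef_on (X : Type) (D : set X) (K : X -> X -> R[i]) : Prop :=
  forall (m : nat) (x : 'I_m -> X) (c : 'I_m -> R[i]),
    (forall i, D (x i)) ->
    0 <= \sum_(i < m) \sum_(j < m) c i * (c j)^* * K (x i) (x j).

Definition isotropic (d : dimension) (K : euclid d -> euclid d -> R[i]) :=
  forall f, orthogonal_group f -> forall x y, K (f x) (f y) = K x y.

Definition continuous_kernel (d : dimension)
    (K : euclid d -> euclid d -> R[i]) : Prop :=
  forall (x0 y0 : euclid d) (eps : R), 0 < eps -> exists2 delta : R,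
    0 < delta & forall x y, enorm (x - x0) < delta -> enorm (y - y0) < delta ->
      `|K x y - K x0 y0| < eps%:C.

End EuclideanSpaces.

Section SpecialFunctions.
Variable R : realType.

Definition Gamma (z : R) : R :=
  \int[lebesgue_measure]_(t in `]0, +oo[) (t `^ (z - 1) * expR (- t)).

(* First-kind Bessel function of order [al >= 0] at [t >= 0]. *)
Definition besselJ (al t : R) : R :=
  limn (series (fun m : nat =>
    (- 1) ^+ m / (m`!%:R * Gamma (m%:R + al + 1))
    * (t / 2) `^ ((2 * m)%:R + al))).

(* [besselJ al t / t ^ lam], extended by continuity to [t = 0]. *)
Definition bessel_quotient (al lam t : R) : R :=
  let q u := besselJ al u / u `^ lam in
  if t == 0 then lim (q u @[u --> 0^'+]) else q t.

(* Coefficient of [z ^ n] in the Taylor series at [z = 0] of the generating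
   function [(1 - 2 t z + z ^ 2) ^ (- lam)]. *)
Definition gegenbauer (lam : R) (n : nat) (t : R) : R :=
  derive1n n (fun z : R => (1 - 2 * t * z + z ^+ 2) `^ (- lam)) 0 / n`!%:R.

(* Only used for [0 <= lam <= +oo] and [-1 <= t <= 1]. *)
Definition gegenbauer_hat (lam : \bar R) (n : nat) (t : R) : R :=
  match lam with
  | l%:E => if l == 0 then cos (n%:R * acos t)
            else gegenbauer l n t / gegenbauer l n 1
  | +oo%E => t ^+ n
  | -oo%E => 0
  end.

Definition lambda_fin (d : nat) : R := (d%:R - 2) / 2.

Definition lambda (d : dimension) : \bar R :=
  match d with Fin n => (lambda_fin n)%:E | Infty => +oo%E end.

(* Dimension of the spherical harmonics of degree [n] on the unit sphere of
   R^d; note that [n + 2 * lambda - 1 = n + d - 3]. *)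
Definition dim_harmonics (d n : nat) : R :=
  if d == 2%N then (if n == 0%N then 1 else 2)
  else (n%:R + lambda_fin d) / lambda_fin d * 'C(n + d - 3, n)%:R.

Definition phi (d : dimension) (n : nat) (t : R) : R :=
  match d with
  | Fin k => 2 `^ lambda_fin k * Gamma (k%:R / 2)
             * Num.sqrt (dim_harmonics k n)
             * bessel_quotient (n%:R + lambda_fin k) (lambda_fin k) t
  | Infty => expR (- (t ^+ 2 / 2)) * (t ^+ n / Num.sqrt n`!%:R)
  end.

End SpecialFunctions.

Section Kernels.
Variable R : realType.

(* [U] is uniform on the sphere of R^n: it lies on it almost surely and its
   law is rotation invariant. *)
Definition uniform_on_sphere (n : nat) (dT : measure_display)
    (T : measurableType dT) (P : probability T R)
    (U : {RV P >-> g_sigma_algebraType (@open 'rV[R]_n)}) : Prop :=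
  (\forall w \ae P, enorm (U w : euclid R (Fin n)) = 1) /\
  forall f, @orthogonal_group R (Fin n) f ->
    forall A : set 'rV[R]_n, <<s @open 'rV[R]_n >> A ->
      P (U @^-1` (f @^-1` A)) = P (U @^-1` A).

Definition is_Omega (n : nat) (Om : R -> R[i]) : Prop :=
  exists (dT : measure_display) (T : measurableType dT) (P : probability T R)
    (U : {RV P >-> g_sigma_algebraType (@open 'rV[R]_n)})
    (v : euclid R (Fin n)),
    [/\ uniform_on_sphere U, enorm v = 1 &
        forall t, Om t = fine ('E_P[fun w => cos (t * dot v (U w))])
                         +i* fine ('E_P[fun w => sin (t * dot v (U w))])].

Definition stationary_kernel (mu : {finite_measure set R -> \bar R})
    (d : dimension) : (euclid R d -> euclid R d -> R[i]) -> Prop :=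
  match d with
  | Fin n => fun K => exists2 Om, is_Omega n Om &
      forall x y : euclid R (Fin n),
      K x y = (\int[mu]_(s in `[0%R, +oo[) complex.Re (Om (s * enorm (x - y))))
              +i* (\int[mu]_(s in `[0%R, +oo[) complex.Im (Om (s * enorm (x - y))))
  | Infty => fun K => forall x y : euclid R Infty,
      K x y = (\int[mu]_(s in `[0%R, +oo[)
                expR (- (s ^+ 2 * (enorm (x - y) ^+ 2 / 2))))%:C
  end.

Record associated (d : dimension) (K : euclid R d -> euclid R d -> R[i])
    (a : nat -> R -> R -> R[i]) : Prop := Associated {
  assoc_kernel_cont : continuous_kernel K;
  assoc_kernel_isotropic : isotropic K;
  assoc_kernel_posdef : posdef_on setT K;
  assoc_cont : forall n,
    {within [set p : R * R | 0 <= p.1 /\ 0 <= p.2],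
      continuous (fun p => a n p.1 p.2 : R[i]^o)};
  assoc_posdef : forall n, posdef_on [set r : R | 0 <= r] (a n);
  assoc_expansion : forall x y : euclid R d, x != 0 -> y != 0 ->
    series (fun n => a n (enorm x) (enorm y) *
      (gegenbauer_hat (lambda R d) n
        (dot ((enorm x)^-1 *: x) ((enorm y)^-1 *: y)))%:C : R[i]^o) @ \oo
      --> (K x y : R[i]^o);
  assoc_expansion0 : forall x y : euclid R d, x = 0 \/ y = 0 ->
    K x y = a 0%N (enorm x) (enorm y);
  (* [a n s s] is a nonnegative real by [assoc_posdef]. *)
  assoc_tail : forall r : R, 0 <= r -> exists V : set R,
    [/\ within `[0, +oo[ (nbhs r) V, V `<=` `[0, +oo[ &
        (fun N : nat => ereal_sup
          [set (\sum_(N <= n <oo) (complex.Re (a n s s))%:E)%E | s in V]) @ \oo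
        --> 0%E];
  assoc_axes : forall (n : nat) (r : R), (1 <= n)%N -> 0 <= r -> a n r 0 = 0 /\ a n 0 r = 0
}.

Definition alpha (d : dimension) (mu : {finite_measure set R -> \bar R})
    (n : nat) (r s : R) : R[i] :=
  (\int[mu]_(u in `[0%R, +oo[) (phi d n (u * r) * phi d n (u * s)))%:C.

End Kernels.

(* Main.v *)
(* Write [lam = (d - 2) / 2].  For finite [d] everything rests on the addition
   theorem
     Omega_d (sqrt (r^2 + s^2 - 2 r s t)) = sum_n phi_n (r) phi_n (s) C_n (t),
   for the normalized Gegenbauer polynomials [C_n].  Its partial sums, along
   [y = s e] with [e] and [x - y] fixed, have a telescoping derivative in [s]
   whose single remaining term tends to 0; at [s = 0] the sum has one term.
   That [Omega_d] is the entire Bessel function follows from the moments of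
   <v, U>, which rotation invariance determines.  For [d = oo] the addition
   theorem is the exponential series.  Taking [r = s] and [t = 1] gives
   [sum_n phi_n ^ 2 = 1], so the partial sums are bounded by 1 and may be
   integrated against [mu].

   For uniqueness, the coefficients at fixed radii are absolutely summable by
   positive definiteness, and the angle [t] takes every value in [-1, 1].  The
   [C_n] are orthogonal with respect to the law of [<v, U>], by the Stein
   identity E ((1 - X^2) f'(X)) = (2 lam + 1) E (X f(X)) for X = <v, U>; for
   [d = oo] one compares power series. *)
From HB Require Import structures.
Require Import Defs.
From mathcomp Require Import all_boot all_order all_algebra.
From mathcomp Require Import all_classical all_reals all_analysis.
From mathcomp Require Import measurable_realfun complex ring lra.

Set Implicit Arguments.
Unset Strict Implicit.
Unset Printing Implicit Defensive.

Import Order.TTheory GRing.Theory Num.Theory.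
Import numFieldNormedType.Exports.

Local Open Scope classical_set_scope.
Local Open Scope ring_scope.

(** [uniform_on_sphere] gives no density and no surface measure, only invariance under orthogonal
    maps. The law of <v, U> therefore enters through its moments: their two-step recursion gives
    both the power series of Omega_d and the Stein identity, which replaces integration by parts
    against (1 - x^2)^(lam - 1/2).

    The Gegenbauer recursion is normalized by C_n(1) = 1 from the start, which keeps its formulas
    meaningful at lam = 0, that is d = 2. Likewise J_(n+lam)(t) / t^lam becomes a constant times t^n
    times an entire function of t^2, so that t = 0 raises no question of one-sided limits.

    The telescoping has this cause: g_n(s) in s, and g_n(|x|) C_n(cos angle) as x moves parallel to
    the axis, obey the same ladder relation with weights N_n^d. As x - y is fixed, the full sum has
    to be constant in s.

    Since sum_n phi_n^2 = 1, the tails of sum_n alpha_n(s, s) are the mass of [mu] minus increasing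
    partial sums of continuous functions; Dini's theorem then gives the local uniformity in
    condition (a). *)

(** * Solid zonal harmonics and their bound by 1 *)

Section SolidZonal.
Variables (R : realType) (lam : R).
Hypothesis lam0 : 0 <= lam.

(* [zonal n t 1] is the normalized Gegenbauer polynomial of degree [n], and
   [zonal n p s] its homogenization: [p] has weight 1 and [s] weight 2. *)
Fixpoint zonal_rec (n : nat) (p s : R) : R :=
  match n with
  | 0 => 1
  | m.+1 => if m is k.+1 then
      (2 * (k%:R + 1 + lam) * p * zonal_rec m p s - (k%:R + 1) * s * zonal_rec k p s)
        / (k%:R + 1 + 2 * lam)
    else p
  end.

(* Locked, lest product lemmas unfold [zonal n.+2]. *)
Definition zonal := locked zonal_rec.

Lemma zonal0 p s : zonal 0 p s = 1. Proof. by rewrite /zonal -lock. Qed.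

Lemma zonal1 p s : zonal 1 p s = p. Proof. by rewrite /zonal -lock. Qed.

Lemma zonal_den_gt0 (n : nat) : 0 < n%:R + 1 + 2 * lam.
Proof. by have H := ler0n R n; move: lam0 => l0; lra. Qed.

Lemma zonalSS n p s : (n%:R + 1 + 2 * lam) * zonal n.+2 p s =
  2 * (n%:R + 1 + lam) * p * zonal n.+1 p s - (n%:R + 1) * s * zonal n p s.
Proof. by rewrite /zonal -lock /= mulrC divfK // gt_eqF // zonal_den_gt0. Qed.

Lemma mul_zonal n p s : 2 * (n%:R + lam) * p * zonal n p s =
  (n%:R + 2 * lam) * zonal n.+1 p s + n%:R * s * zonal n.-1 p s.
Proof.
case: n => [|n]; first by rewrite zonal0 zonal1; ring.
by have H := zonalSS n p s; rewrite -[n.+1%:R]natr1 [n.+1.-1]/=; lra.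
Qed.

(** For lam = (d - 2) / 2, [p] = <x, e> and [s] = |x|^2 this is the zonal solid harmonic about e,
    and keeping [c] = [s] - [p]^2 fixed moves x parallel to e. The derivative along e is again
    harmonic and zonal, of degree n - 1, with value n at e. *)
Lemma is_derive_zonal n (c p : R) :
  is_derive p 1 (fun x => zonal n x (x ^+ 2 + c))
    (n%:R * zonal n.-1 p (p ^+ 2 + c)).
Proof.
(* The recursion reaches back two degrees, so two consecutive degrees are carried through the
   induction; the same device recurs below. *)
suff H : is_derive p 1 (fun x => zonal n x (x ^+ 2 + c))
    (n%:R * zonal n.-1 p (p ^+ 2 + c)) /\
  is_derive p 1 (fun x => zonal n.+1 x (x ^+ 2 + c))
    (n.+1%:R * zonal n p (p ^+ 2 + c)) by case: H.
elim: n => [|n [IHn IHS]].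
  split.
    rewrite mul0r (_ : (fun x => _) = cst 1); first exact: is_derive_cst.
    by apply/funext => x; rewrite zonal0.
  rewrite mul1r zonal0 (_ : (fun x => _) = id); first exact: is_derive_id.
  by apply/funext => x; rewrite zonal1.
split=> //.
have d2 : is_derive p 1 (fun x : R => x ^+ 2 + c) (2 * p).
  apply: is_derive_eq; rewrite /GRing.scale /= ?mulr1; first [ring | congr (_ * _); ring].
have dH (u v : R -> R) (u' v' a b : R) : is_derive p 1 u u' ->
    is_derive p 1 v v' ->
    is_derive p 1 (fun x => (n%:R + 1 + 2 * lam)^-1 *
      (a * (x * v x) - b * ((x ^+ 2 + c) * u x)))
    ((n%:R + 1 + 2 * lam)^-1 *
      (a * (v p + p * v') - b * (2 * p * u p + (p ^+ 2 + c) * u'))).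
  move=> du dv; apply: is_derive_eq; rewrite /GRing.scale /= mulr1; congr (_ * _); ring.
have {dH} dH := dH _ _ _ _ (2 * (n%:R + 1 + lam)) (n%:R + 1) IHn IHS.
rewrite (_ : (fun x => _) = fun x => (n%:R + 1 + 2 * lam)^-1 *
  (2 * (n%:R + 1 + lam) * (x * zonal n.+1 x (x ^+ 2 + c)) -
   (n%:R + 1) * ((x ^+ 2 + c) * zonal n x (x ^+ 2 + c)))); last first.
  apply/funext => x; apply: (mulfI (lt0r_neq0 (zonal_den_gt0 n))).
  rewrite zonalSS mulVKf ?lt0r_neq0 ?zonal_den_gt0 //.
  by move: (zonal n.+1 _ _) (zonal n _ _) => v w; ring.
apply: is_derive_eq; apply: (mulfI (lt0r_neq0 (zonal_den_gt0 n))).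
rewrite mulVKf ?lt0r_neq0 ?zonal_den_gt0 // -!natr1.
have := mul_zonal n p (p ^+ 2 + c).
move: (zonal n.+1 _ _) (zonal n _ _) (zonal n.-1 _ _) => x y z E.
transitivity (2 * (n%:R + 1 + lam) * x + (n%:R + 1) *
   (2 * (n%:R + lam) * p * y - n%:R * (p ^+ 2 + c) * z)); first by ring.
by rewrite E; ring.
Qed.

Lemma zonal_homo n r p s : zonal n (r * p) (r ^+ 2 * s) = r ^+ n * zonal n p s.
Proof.
suff H : zonal n (r * p) (r ^+ 2 * s) = r ^+ n * zonal n p s /\
   zonal n.+1 (r * p) (r ^+ 2 * s) = r ^+ n.+1 * zonal n.+1 p s by case: H.
elim: n => [|n [IHn IHS]]; first by rewrite !zonal0 !zonal1 expr0 expr1 mul1r.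
split=> //; apply: (mulfI (lt0r_neq0 (zonal_den_gt0 n))).
by rewrite [RHS]mulrCA !zonalSS IHn IHS !exprS; ring.
Qed.

Lemma zonal_pm1 n e : e ^+ 2 = 1 -> zonal n e 1 = e ^+ n.
Proof.
move=> e2; suff H : zonal n e 1 = e ^+ n /\ zonal n.+1 e 1 = e ^+ n.+1 by case: H.
elim: n => [|n [IHn IHS]]; first by rewrite zonal0 zonal1 expr0 expr1.
split=> //; apply: (mulfI (lt0r_neq0 (zonal_den_gt0 n))).
rewrite zonalSS IHn IHS -[n.+2]addn2 exprD e2 exprS.
have -> : 2 * (n%:R + 1 + lam) * e * (e * e ^+ n) =
  2 * (n%:R + 1 + lam) * e ^+ 2 * e ^+ n by ring.
by rewrite e2; ring.
Qed.

Lemma zonal11 n : zonal n 1 1 = 1.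
Proof. by rewrite zonal_pm1 ?expr1n. Qed.

(* [(u_n - t u_(n+1))^2 + (1 - t^2) u_(n+1)^2] is nonincreasing in [n] and
   starts at [1 - t^2]. *)
Lemma zonal_energy n t : t ^+ 2 <= 1 ->
  (zonal n t 1 - t * zonal n.+1 t 1) ^+ 2 + (1 - t ^+ 2) * zonal n.+1 t 1 ^+ 2
    <= 1 - t ^+ 2.
Proof.
move=> t1; elim: n => [|n IHn]; first by rewrite zonal0 zonal1 le_eqVlt; apply/orP; left; apply/eqP; ring.
apply: le_trans IHn.
(* One step of the recursion multiplies the first square by [th ^ 2], which is at most 1, and leaves
   the other summand as it is. *)
set th := (n%:R + 1) / (n%:R + 1 + 2 * lam).
have E : zonal n.+2 t 1 = (1 + th) * t * zonal n.+1 t 1 - th * zonal n t 1.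
  apply: (mulfI (lt0r_neq0 (zonal_den_gt0 n))); rewrite zonalSS /th.
  by field; rewrite gt_eqF // zonal_den_gt0.
have th0 : 0 <= th by rewrite divr_ge0 ?ltW ?zonal_den_gt0 // addr_ge0.
have th1 : th <= 1 by rewrite ler_pdivrMr ?zonal_den_gt0 // mul1r; move: lam0; lra.
rewrite E; move: (zonal n t 1) (zonal n.+1 t 1) => x y.
have -> : (y - t * ((1 + th) * t * y - th * x)) ^+ 2 +
  (1 - t ^+ 2) * ((1 + th) * t * y - th * x) ^+ 2 =
  th ^+ 2 * (x - t * y) ^+ 2 + (1 - t ^+ 2) * y ^+ 2 by ring.
by rewrite lerD2r ler_piMl ?sqr_ge0 // expr_le1.
Qed.

Lemma zonal_le1 n t : `|t| <= 1 -> `|zonal n t 1| <= 1.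
Proof.
move=> t1; have t2 : t ^+ 2 <= 1 by rewrite -real_normK ?num_real ?expr_le1.
case: n => [|n]; first by rewrite zonal0 normr1.
(* At t = 1 and t = -1 the energy bound says nothing about the polynomial, but its value there is
   t^n. *)
have [t2e|t2e] := eqVneq (t ^+ 2) 1.
  by rewrite zonal_pm1 // normrX expr_le1.
have lt2 : 0 < 1 - t ^+ 2 by rewrite subr_gt0 lt_neqAle t2e.
rewrite -(@expr_le1 _ 2) // real_normK ?num_real //.
rewrite -(ler_pM2l lt2) mulr1.
by apply: le_trans (zonal_energy n t2); rewrite lerDr sqr_ge0.
Qed.

Lemma zonal_norm_le n p s : p ^+ 2 <= s -> `|zonal n p s| <= Num.sqrt s ^+ n.
Proof.
move=> ps; have s0 : 0 <= s by apply: le_trans ps; rewrite sqr_ge0.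
have [se|sn] := eqVneq s 0.
  have p0 : p = 0 by apply/eqP; rewrite -sqrf_eq0 eq_le sqr_ge0 -{1}se ps.
  rewrite se p0 sqrtr0.
  have := zonal_homo n 0 0 0; rewrite expr2 !mul0r => ->.
  by rewrite expr0n; case: n => [|n] /=; rewrite ?zonal0 ?mul1r ?normr1 // mul0r normr0.
have r0 : 0 < Num.sqrt s by rewrite sqrtr_gt0 lt_neqAle eq_sym sn.
have := zonal_homo n (Num.sqrt s) (p / Num.sqrt s) 1.
rewrite mulrCA divff ?gt_eqF // mulr1 sqr_sqrtr // mulr1 => ->.
rewrite normrM (ger0_norm (exprn_ge0 n (ltW r0))).
rewrite ler_piMr ?(exprn_ge0 n (ltW r0)) // zonal_le1 // normf_div (ger0_norm (ltW r0)).
by rewrite ler_pdivrMr // mul1r -sqrtr_sqr ler_wsqrtr.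
Qed.

End SolidZonal.

(** * Normalized Gegenbauer polynomials as formal polynomials *)

Section ZonalPoly.
Variables (R : realType) (lam : R).
Hypothesis lam0 : 0 <= lam.

(** A second encoding, in [{poly R}]: the functional below acts on polynomials, and the Stein
    identity needs the formal derivative. *)
Fixpoint zonal_poly_rec (n : nat) : {poly R} :=
  match n with
  | 0 => 1
  | m.+1 => if m is k.+1 then
      ((k%:R + 1 + 2 * lam)^-1)%:P *
      ((2 * (k%:R + 1 + lam))%:P * ('X * zonal_poly_rec m)
         - (k%:R + 1)%:P * zonal_poly_rec k)
    else 'X
  end.

Definition zonal_poly := locked zonal_poly_rec.

Lemma zonal_poly0 : zonal_poly 0 = 1. Proof. by rewrite /zonal_poly -lock. Qed.

Lemma zonal_poly1 : zonal_poly 1 = 'X. Proof. by rewrite /zonal_poly -lock. Qed.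

Let zonal_poly_step n : zonal_poly n.+2 = ((n%:R + 1 + 2 * lam)^-1)%:P *
      ((2 * (n%:R + 1 + lam))%:P * ('X * zonal_poly n.+1)
         - (n%:R + 1)%:P * zonal_poly n).
Proof. by rewrite /zonal_poly -lock. Qed.

Lemma horner_zonal_poly n t : (zonal_poly n).[t] = zonal lam n t 1.
Proof.
suff H : (zonal_poly n).[t] = zonal lam n t 1 /\
  (zonal_poly n.+1).[t] = zonal lam n.+1 t 1 by case: H.
elim: n => [|n [IHn IHS]]; first by rewrite zonal_poly0 zonal_poly1 zonal0 zonal1 hornerC hornerX.
split=> //.
rewrite zonal_poly_step hornerM hornerD hornerN !hornerM !hornerC hornerX IHn IHS.
apply: (mulfI (lt0r_neq0 (zonal_den_gt0 lam0 n))).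
rewrite zonalSS // mulVKf ?lt0r_neq0 ?zonal_den_gt0 //.
by move: (zonal _ n.+1 _ _) (zonal _ n _ _) => v w; ring.
Qed.

Let den n : {poly R} := (n%:R + 1 + 2 * lam)%:P.

Let den_neq0 n : den n != 0.
Proof. by rewrite polyC_eq0 lt0r_neq0 // zonal_den_gt0. Qed.

Lemma zonal_polySS n : den n * zonal_poly n.+2 =
  (2 * (n%:R + 1 + lam))%:P * ('X * zonal_poly n.+1)
    - (n%:R + 1)%:P * zonal_poly n.
Proof.
by rewrite zonal_poly_step /den [LHS]mulrA -polyCM divff ?mul1r // lt0r_neq0 // zonal_den_gt0.
Qed.

Lemma mul_zonal_poly n : (2 * (n%:R + lam))%:P * ('X * zonal_poly n) =
  (n%:R + 2 * lam)%:P * zonal_poly n.+1 + (n%:R)%:P * zonal_poly n.-1.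
Proof.
case: n => [|n]; first by rewrite /= zonal_poly0 zonal_poly1 polyC0 !add0r !mulr1 addr0.
by have := zonal_polySS n; rewrite /den -[n.+1%:R]natr1 [n.+1.-1]/= => ->; rewrite subrK.
Qed.

(** The left side has the shape (1 - X^2) p' of the Stein identity, which can thus be applied to
    zonal polynomials with no derivative left over. *)
Lemma deriv_zonal_poly n : (1 - 'X ^+ 2) * (zonal_poly n)^`() =
  (n%:R)%:P * (zonal_poly n.-1 - 'X * zonal_poly n).
Proof.
suff H : (1 - 'X ^+ 2) * (zonal_poly n)^`() =
    (n%:R)%:P * (zonal_poly n.-1 - 'X * zonal_poly n) /\
  (1 - 'X ^+ 2) * (zonal_poly n.+1)^`() =
  (n.+1%:R)%:P * (zonal_poly n - 'X * zonal_poly n.+1) by case: H.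
elim: n => [|n [IHn IHS]].
  by rewrite zonal_poly0 zonal_poly1 derivC derivX mulr0 polyC0 polyC1 mul0r mulr1 mul1r expr2.
split=> //; apply: (mulfI (den_neq0 n)).
have E := zonal_polySS n.
have dE : den n * (zonal_poly n.+2)^`() = (2 * (n%:R + 1 + lam))%:P *
    (zonal_poly n.+1 + 'X * (zonal_poly n.+1)^`())
    - (n%:R + 1)%:P * (zonal_poly n)^`().
  have := congr1 (@deriv R) E.
  by rewrite derivB !derivM !derivC derivX !mul0r !add0r mul1r.
have F := mul_zonal_poly n.
move: E dE F IHn IHS; rewrite /den -[n.+2%:R]natr1 -[n.+1%:R]natr1.
move: (deriv (zonal_poly n.+2)) (deriv (zonal_poly n.+1)) (deriv (zonal_poly n)) => x' y' z'.
move: (zonal_poly n.+2) (zonal_poly n.+1) (zonal_poly n) (zonal_poly n.-1) => x y z w E dE F IHn IHS.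
transitivity ((1 - 'X^2) * ((n%:R + 1 + 2 * lam)%:P * x')); first by ring.
rewrite dE.
transitivity ((2 * (n%:R + 1 + lam))%:P * ((1 - 'X^2) * y + 'X * ((1 - 'X^2) * y')) -
  (n%:R + 1)%:P * ((1 - 'X^2) * z')); first by ring.
rewrite IHn IHS.
transitivity ((n%:R + 1 + 1)%:P * ((n%:R + 1 + 2 * lam)%:P * y - 'X * ((n%:R + 1 + 2 * lam)%:P * x))); last by ring.
rewrite E.
have {F}F : (n%:R)%:P * w = (2 * (n%:R + lam))%:P * ('X * z) - (n%:R + 2 * lam)%:P * y.
  by rewrite F addrC addKr.
transitivity ((2 * (n%:R + 1 + lam))%:P * ((1 - 'X^2) * y + 'X * ((n%:R + 1)%:P * (z - 'X * y))) -
  (n%:R + 1)%:P * ((n%:R)%:P * w - (n%:R)%:P * 'X * z)); first by ring.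
by rewrite F; ring.
Qed.

(** * Orthogonality for a functional that satisfies the Stein identity *)

Section SteinFunctional.
Variable L : {poly R} -> R.
Hypothesis L_lin : forall a p q, L (a%:P * p + q) = a * L p + L q.
Hypothesis L_one : L 1 = 1.
Hypothesis L_stein : forall p,
  L ((1 - 'X ^+ 2) * p^`()) = (2 * lam + 1) * L ('X * p).

Let L0 : L 0 = 0.
Proof. by have := L_lin (-1) 0 0; rewrite mulr0 addr0 mulN1r addNr. Qed.

Let LZ a p : L (a%:P * p) = a * L p.
Proof. by rewrite -[_%:P * _]addr0 L_lin L0 addr0. Qed.

Let LD p q : L (p + q) = L p + L q.
Proof. by have := L_lin 1 p q; rewrite polyC1 !mul1r. Qed.

Let LB p q : L (p - q) = L p - L q.
Proof. by rewrite LD -mulN1r -polyC1 -polyCN LZ mulN1r. Qed.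

Let LX : L 'X = 0.
Proof.
have := L_stein 1; rewrite derivC mulr0 mulr1 L0 => /esym/eqP.
rewrite mulf_eq0 => /orP[/eqP H|/eqP //]; move: lam0 => l0; lra.
Qed.

(** Stein's identity at C_(k+1) and the three-term recursion both contain L(X C_(k+1)). Eliminating
    it expresses L(C_(k+2)) as a multiple of k L(C_k), and the factor k cuts the chain off from L(1)
    = 1. *)
Lemma stein_zonal_poly n : L (zonal_poly n.+1) = 0.
Proof.
suff H : L (zonal_poly n.+1) = 0 /\ L (zonal_poly n.+2) = 0 by case: H.
have step k : (k%:R + 1 + 2 * lam) * (k%:R + 1 + 2 * lam + 1) *
    L (zonal_poly k.+2) = k%:R * (k%:R + 1) * L (zonal_poly k).
  have A : (k%:R + 1) * L (zonal_poly k) =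
     (k%:R + 1 + 2 * lam + 1) * L ('X * zonal_poly k.+1).
    have := L_stein (zonal_poly k.+1); rewrite deriv_zonal_poly LZ LB [k.+1.-1]/= -[k.+1%:R]natr1.
    move: (L _) (L _) => x y H; lra.
  have B := congr1 L (mul_zonal_poly k.+1).
  move: B A; rewrite LZ LD !LZ [k.+1.-1]/= -[k.+1%:R]natr1.
  move: (L _) (L (zonal_poly k.+2)) (L _) => x y z B A.
  transitivity ((k%:R + 1 + 2 * lam + 1) * ((k%:R + 1 + 2 * lam) * y)); first by ring.
  rewrite (_ : (_ + 2 * lam) * y = 2 * (k%:R + 1 + lam) * z - (k%:R + 1) * x); last by rewrite B; ring.
  transitivity (2 * (k%:R + 1 + lam) * ((k%:R + 1 + 2 * lam + 1) * z) -
    (k%:R + 1 + 2 * lam + 1) * ((k%:R + 1) * x)); first by ring.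
  by rewrite -A; ring.
have nz k : (k%:R + 1 + 2 * lam) * (k%:R + 1 + 2 * lam + 1) != 0.
  have H := zonal_den_gt0 lam0 k.
  by rewrite mulf_neq0 // lt0r_neq0 //; lra.
elim: n => [|n [IHn IHS]].
  split; first by rewrite zonal_poly1.
  by apply: (mulfI (nz 0)); rewrite step mulr0 !mul0r.
by split=> //; apply: (mulfI (nz n.+1)); rewrite step IHn !mulr0.
Qed.

Let LXMl n p : 2 * (n%:R + lam) * L (p * ('X * zonal_poly n)) =
  (n%:R + 2 * lam) * L (p * zonal_poly n.+1) + n%:R * L (p * zonal_poly n.-1).
Proof.
rewrite -LZ mulrCA mul_zonal_poly mulrDr LD.
by rewrite [p * (_ * _)]mulrCA LZ [p * (_ * _)]mulrCA LZ.
Qed.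

(** Induction on the smaller index: its recursion produces a factor X, and X C_n is a combination of
    C_(n+1) and C_(n-1), whose indices still exceed that of the other factor. Index 0 is the
    previous lemma. *)
Lemma stein_orthogonal m n : (m < n)%N -> L (zonal_poly m * zonal_poly n) = 0.
Proof.
suff H : forall n, ((m < n)%N -> L (zonal_poly m * zonal_poly n) = 0) /\
  ((m.+1 < n)%N -> L (zonal_poly m.+1 * zonal_poly n) = 0) by case: (H n).
elim: m => {n} [n|m IHm n].
  split; first by case: n => // n _; rewrite zonal_poly0 mul1r stein_zonal_poly.
  case: n => [//|[//|n]] _.
  have := LXMl n.+2 1; rewrite !mul1r [n.+2.-1]/=.
  rewrite zonal_poly1.
  rewrite !stein_zonal_poly !mulr0 addr0 => /eqP; rewrite mulf_eq0 => /orP[/eqP H|/eqP //].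
  have := ler0n R n; move: lam0 => l0 n0; move: H; rewrite -?[n.+2%:R]natr1 -[n.+1%:R]natr1; lra.
split; first by case: (IHm n).
move=> mn; apply: (mulfI (lt0r_neq0 (zonal_den_gt0 lam0 m))).
rewrite mulr0 -LZ mulrA zonal_polySS mulrBl LB -!mulrA !LZ.
have -> : L (zonal_poly m * zonal_poly n) = 0.
  by case: (IHm n) => -> //; exact: ltnW (ltnW mn).
have := LXMl n (zonal_poly m.+1).
case: n mn => // n mn; rewrite [n.+1.-1]/=.
have -> : L (zonal_poly m.+1 * zonal_poly n.+2) = 0.
  by case: (IHm n.+2) => _ -> //; exact: ltnW (ltnW mn).
have -> : L (zonal_poly m.+1 * zonal_poly n) = 0 by case: (IHm n) => _ ->.
rewrite !mulr0 addr0 subr0 => /eqP; rewrite mulf_eq0 => /orP[/eqP H|/eqP H].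
  have := ler0n R n; move: lam0 => l0 n0; move: H; rewrite -?[n.+2%:R]natr1 -[n.+1%:R]natr1; lra.
by rewrite mulrCA H mulr0.
Qed.

(** L(X C_n C_(n+1)), computed by expanding either X C_n or X C_(n+1), gives the ratio of
    consecutive square norms. *)
Lemma stein_sqr_gt0 n : 0 < L (zonal_poly n * zonal_poly n).
Proof.
elim: n => [|n IHn]; first by rewrite zonal_poly0 mulr1 L_one.
have A := LXMl n (zonal_poly n.+1).
have B := LXMl n.+1 (zonal_poly n).
have o1 : n%:R * L (zonal_poly n.+1 * zonal_poly n.-1) = 0.
  case: n {IHn A B} => [|n]; first by rewrite mul0r.
  by rewrite [X in L X]mulrC (stein_orthogonal (leqnSn n.+1)) mulr0.
move: A B; rewrite [n.+1.-1]/= -[n.+1%:R]natr1 o1 (stein_orthogonal (leqnSn n.+1)) mulr0 add0r addr0.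
rewrite mulrCA [zonal_poly n * (_ * _)]mulrCA [zonal_poly n * zonal_poly n.+1]mulrC.
(* For n = 0 the factor n + 2 lam may vanish; Stein's identity at X gives (2 lam + 2) L(X^2) = 1
   instead. *)
have [->|n0] := eqVneq n 0%N.
  move=> _ _; have := L_stein 'X; rewrite derivX mulr1 LB L_one expr2 => H.
  rewrite zonal_poly1; move: H; move: (L _) => x H.
  have : (2 * lam + 2) * x = 1 by lra.
  move=> {}H; rewrite ltNge; apply/negP => x0.
  have : (2 * lam + 2) * x <= 0 by rewrite mulr_ge0_le0 //; move: lam0 => l0; lra.
  by rewrite H ler10.
have {}n0 : (0 : R) < n%:R by rewrite ltr0n lt0n.
move: IHn; move: (L (zonal_poly n * zonal_poly n)) => z z0.
move: (L (zonal_poly n.+1 * zonal_poly n.+1)) => y.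
move: (L _) => x A B.
have l0 := lam0.
have C : (n%:R + 1 + lam) * ((n%:R + 2 * lam) * y) = (n%:R + lam) * ((n%:R + 1) * z).
  by rewrite -A -B; ring.
have : 0 < (n%:R + 1 + lam) * ((n%:R + 2 * lam) * y).
  by rewrite C; apply: mulr_gt0; [lra|apply: mulr_gt0 => //; lra].
rewrite pmulr_rgt0; last by lra.
by rewrite pmulr_rgt0 //; lra.
Qed.

End SteinFunctional.
End ZonalPoly.

(** * Bessel functions as entire power series *)

Section EntireBessel.
Variables (R : realType) (lam : R).
Hypothesis lam0 : 0 <= lam.

(** The Pochhammer symbol (lam + 1)_n, equal to Gamma(n + lam + 1) / Gamma(lam + 1). It keeps the
    Gamma integral out of the power series. *)
Definition rising (n : nat) : R := \prod_(i < n) (lam + 1 + i%:R).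

Lemma rising0 : rising 0 = 1. Proof. by rewrite /rising big_ord0. Qed.

Lemma risingS n : rising n.+1 = rising n * (lam + 1 + n%:R).
Proof. by rewrite /rising big_ord_recr. Qed.

Lemma fact_le_rising n : n`!%:R <= rising n.
Proof.
elim: n => [|n IHn]; first by rewrite rising0 fact0.
rewrite risingS factS natrM mulrC ler_pM // -natr1.
by move: lam0 => l0; lra.
Qed.

Lemma rising_gt0 n : 0 < rising n.
Proof. by apply: lt_le_trans (fact_le_rising n); rewrite ltr0n fact_gt0. Qed.

(* [t ^ n * besselG n (t ^ 2)] is [Gamma (lam + 1) * (2 / t) ^ lam * J_(n + lam) t]. *)
Definition bessel_coef (n m : nat) : R :=
  (-1) ^+ m / (4 ^+ m * 2 ^+ n * m`!%:R * rising (m + n)).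

Definition besselG (n : nat) (s : R) : R := limn (pseries (bessel_coef n) s).

Let den_gt0 n m : 0 < 4 ^+ m * 2 ^+ n * m`!%:R * rising (m + n).
Proof. by rewrite !mulr_gt0 ?rising_gt0 ?exprn_gt0 // ltr0n fact_gt0. Qed.

(** Domination by the exponential series gives convergence for all [s]; the n! in the denominator is
    what later beats the growth of the ladder constants. *)
Lemma bessel_coef_le n m s :
  `|bessel_coef n m * s ^+ m| <= (2 ^+ n * n`!%:R)^-1 * exp_coeff `|s| m.
Proof.
rewrite normrM /bessel_coef normf_div normrX normrN1 expr1n div1r.
rewrite (ger0_norm (ltW (den_gt0 n m))) normrX.
have -> : (2 ^+ n * n`!%:R)^-1 * exp_coeff `|s| m =
    (2 ^+ n * m`!%:R * n`!%:R)^-1 * `|s| ^+ m.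
  by rewrite /exp_coeff /= !invfM; ring.
have p : 0 < 2 ^+ n * m`!%:R * n`!%:R :> R.
  by rewrite !mulr_gt0 ?exprn_gt0 // ltr0n fact_gt0.
rewrite ler_wpM2r ?exprn_ge0 // lef_pV2 ?posrE ?den_gt0 ?p //.
apply: ler_pM => //; rewrite ?mulr_ge0 ?exprn_ge0 //.
  by rewrite -[leRHS]mulrA ler_peMl ?mulr_ge0 ?exprn_ge0 // exprn_ege1 // ler1n.
apply: le_trans (fact_le_rising _).
by rewrite ler_nat; apply: leq_fact; rewrite leq_addl.
Qed.

Let dominant_ge0 n m (s : R) : 0 <= (2 ^+ n * n`!%:R)^-1 * exp_coeff `|s| m.
Proof. exact: le_trans (bessel_coef_le n m s). Qed.

Let is_cvg_dominant n (s : R) :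
  cvgn (series (fun m => (2 ^+ n * n`!%:R)^-1 * exp_coeff `|s| m)).
Proof.
exact: (is_cvg_seriesZ (k := (2 ^+ n * n`!%:R)^-1) (is_cvg_series_exp_coeff _)).
Qed.

Let is_cvg_norm n s : cvgn [normed pseries (bessel_coef n) s].
Proof.
apply: (series_le_cvg _ _ _ (@is_cvg_dominant n s)) => m.
- exact: normr_ge0.
- exact: dominant_ge0.
- exact: bessel_coef_le.
Qed.

Lemma is_cvg_besselG n s : cvgn (pseries (bessel_coef n) s).
Proof. exact: normed_cvg. Qed.

Lemma besselG_le n s : `|besselG n s| <= (2 ^+ n * n`!%:R)^-1 * expR `|s|.
Proof.
have cexp := is_cvg_series_exp_coeff `|s|.
have cn := @is_cvg_norm n s.
apply: le_trans (lim_series_norm cn) _.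
rewrite /expR.
have <- : limn (series (fun m => (2 ^+ n * n`!%:R)^-1 * exp_coeff `|s| m)) =
    (2 ^+ n * n`!%:R)^-1 * limn (series (exp_coeff `|s|)).
  exact: (lim_seriesZ _ cexp).
exact: lim_series_le cn (@is_cvg_dominant n s) (fun m => bessel_coef_le n m s).
Qed.

Lemma pseries_diffs_bessel_coef n :
  pseries_diffs (bessel_coef n) = fun m => (- 2^-1) * bessel_coef n.+1 m.
Proof.
apply/funext => m; rewrite /pseries_diffs /bessel_coef addSnnS.
rewrite !exprS factS natrM; field.
by rewrite nat1r !gt_eqF ?rising_gt0 ?exprn_gt0 ?ltr0n ?fact_gt0.
Qed.

Let pseriesZ n k s : pseries (fun m => k * bessel_coef n m) s =
  series (k *: (fun m => bessel_coef n m * s ^+ m)).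
Proof. by congr series; apply/funext => m; exact: esym (mulrA _ _ _). Qed.

Let lim_pseriesZ n k s :
  limn (pseries (fun m => k * bessel_coef n m) s) = k * besselG n s.
Proof. by rewrite pseriesZ; exact: lim_seriesZ (@is_cvg_besselG n s). Qed.

Let is_cvg_pseriesZ n k s : cvgn (pseries (fun m => k * bessel_coef n m) s).
Proof. by rewrite pseriesZ; exact: is_cvg_seriesZ (@is_cvg_besselG n s). Qed.

Lemma is_derive_besselG n (s : R) :
  is_derive s 1 (besselG n) (- (2^-1 * besselG n.+1 s)).
Proof.
have -> : - (2^-1 * besselG n.+1 s) = limn (pseries (pseries_diffs (bessel_coef n)) s).
  by rewrite pseries_diffs_bessel_coef lim_pseriesZ mulNr.
apply: (@pseries_snd_diffs _ _ (`|s| + 1)).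
- exact: is_cvg_besselG.
- by rewrite pseries_diffs_bessel_coef; exact: is_cvg_pseriesZ.
- rewrite pseries_diffs_bessel_coef.
  rewrite (_ : pseries_diffs _ = fun m => 4^-1 * bessel_coef n.+2 m); first exact: is_cvg_pseriesZ.
  have := pseries_diffs_bessel_coef n.+1; rewrite /pseries_diffs => E.
  by apply/funext => m; rewrite mulrCA (congr1 (@^~ m) E); field.
- by apply: lt_le_trans (ler_norm _); rewrite ltrDl.
Qed.

(** The recurrence J_(v-1) + J_(v+1) = (2 v / t) J_v at v = n + 1 + lam, with all powers of t
    cancelled. *)
Lemma besselG_rec n s :
  besselG n s + s * besselG n.+2 s = 2 * (n%:R + 1 + lam) * besselG n.+1 s.
Proof.
have cG k := @is_cvg_besselG k s.
(* The factor [s] shifts the series of [besselG n.+2] by one, so m of its terms go with m + 1 terms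
   of the other two. *)
apply: (@cvg_unique _ _ (series (fun m => bessel_coef n m * s ^+ m) m.+1 + s * series (fun m => bessel_coef n.+2 m * s ^+ m) m @[m --> \oo])) => //.
  apply: cvgD; last by apply: cvgMr; exact: cG.
  by rewrite (cvg_shiftS (pseries (bessel_coef n) s)); exact: cG.
rewrite (_ : (fun m => _) = fun m => 2 * (n%:R + 1 + lam) *
    pseries (bessel_coef n.+1) s m.+1).
  by apply: cvgMr; rewrite (cvg_shiftS (pseries (bessel_coef n.+1) s)); exact: cG.
apply/funext => m; rewrite /pseries /series /=.
rewrite big_nat_recl // [in RHS]big_nat_recl // !mulr_sumr -addrA -big_split /=.
rewrite mulrDr mulr_sumr; congr (_ + _).
  rewrite /bessel_coef !add0n risingS !expr0 exprS; field.
  by rewrite !gt_eqF ?rising_gt0 ?exprn_gt0 //; have := ler0n R n => n0; move: lam0 => l0; lra.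
apply: eq_bigr => k _; rewrite /bessel_coef.
rewrite !addSn !addnS !risingS !exprS factS natrM -[(k + n).+1%:R]natr1 natrD -[k.+1%:R]natr1; field.
rewrite !gt_eqF ?rising_gt0 ?exprn_gt0 ?ltr0n ?fact_gt0 //;
  have := ler0n R n => n0; have := ler0n R k => k0; move: lam0 => l0; lra.
Qed.

Lemma besselG0 n : besselG n 0 = (2 ^+ n * rising n)^-1.
Proof.
apply/cvg_lim => //; rewrite -cvg_shiftS.
rewrite (_ : (fun m => _) = cst (2 ^+ n * rising n)^-1); first exact: cvg_cst.
apply/funext => m; rewrite /pseries /series /= big_nat_recl // big1_seq.
  by rewrite /bessel_coef add0n !expr0 fact0 addr0 !mulr1 !mul1r.
by move=> k _; rewrite expr0n mulr0.
Qed.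

Lemma besselG00 : besselG 0 0 = 1.
Proof. by rewrite besselG0 rising0 mulr1 invr1. Qed.

Definition besselg (n : nat) (r : R) : R := r ^+ n * besselG n (r ^+ 2).

Lemma besselg0 n : besselg n 0 = (n == 0%N)%:R.
Proof. by rewrite /besselg [0 ^+ 2]expr0n /= expr0n; case: n => [|n] /=; rewrite ?mul0r // mul1r besselG00. Qed.

Lemma is_derive_besselg0 (r : R) : is_derive r 1 (besselg 0) (- besselg 1 r).
Proof.
have dG := is_derive_besselG 0 (r ^+ 2).
rewrite (_ : besselg 0 = besselG 0 \o (fun x => x ^+ 2)); last first.
  by apply/funext => x; rewrite /besselg expr0 mul1r.
have d2 : is_derive r 1 (fun x : R => x ^+ 2) (2 * r).
  by apply: is_derive_eq; rewrite /GRing.scale /= mulr1; ring.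
by apply: is_derive_eq; rewrite /besselg /GRing.scale /=; field.
Qed.

Lemma is_derive_besselgS n (r : R) : is_derive r 1 (besselg n.+1)
  (n.+1%:R * (r ^+ n * besselG n.+1 (r ^+ 2)) - besselg n.+2 r).
Proof.
have dG := is_derive_besselG n.+1 (r ^+ 2).
have d2 : is_derive r 1 (fun x : R => x ^+ 2) (2 * r).
  by apply: is_derive_eq; rewrite /GRing.scale /= mulr1; ring.
have dG2 : is_derive r 1 (besselG n.+1 \o (fun x => x ^+ 2)) (- (r * besselG n.+2 (r ^+ 2))).
  by apply: is_derive_eq; rewrite /GRing.scale /=; field.
have dX : is_derive r 1 (fun x : R => x ^+ n.+1) (n.+1%:R * r ^+ n).
  rewrite (_ : (fun x : R => _) = id ^+ n.+1); last by rewrite exprfctE.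
  by apply: is_derive_eq; rewrite /GRing.scale /= mulr1.
rewrite (_ : besselg n.+1 = (fun x => x ^+ n.+1) * (besselG n.+1 \o (fun x => x ^+ 2))) //.
apply: (is_derive_eq (is_deriveM dX dG2)).
by rewrite /besselg /GRing.scale /= !exprS; ring.
Qed.

End EntireBessel.

(** * The addition theorem *)

Section Addition.
Variables (R : realType) (lam : R).
Hypothesis lam0 : 0 <= lam.

Local Notation G := (besselG lam).
Local Notation g := (besselg lam).
Local Notation H := (zonal lam).

(** This is (2 lam + 1)_n / n!, the weight of the lower term when N_(n+1) g_(n+1) is
    differentiated. *)
Definition ladder (n : nat) : R := \prod_(i < n) ((i%:R + 1 + 2 * lam) / (i%:R + 1)).

(* Dimension [N_n^d] of the spherical harmonics, for [lam = (d - 2) / 2]. *)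
Definition harm_dim (n : nat) : R :=
  if n is m.+1 then ladder m * (2 * (m%:R + 1 + lam) / (m%:R + 1)) else 1.

Lemma ladderS n : ladder n.+1 = ladder n * ((n%:R + 1 + 2 * lam) / (n%:R + 1)).
Proof. by rewrite /ladder big_ord_recr. Qed.

Let nat1_neq0 n : n%:R + 1 != 0 :> R.
Proof. by rewrite natr1 pnatr_eq0. Qed.

Lemma ladder_gt0 n : 0 < ladder n.
Proof.
by apply: prodr_gt0 => i _; rewrite divr_gt0 ?zonal_den_gt0 // natr1 ltr0n.
Qed.

Lemma harm_dim_gt0 n : 0 < harm_dim n.
Proof.
case: n => [//|n] /=; have n1 : (0 : R) < n%:R + 1 by rewrite natr1 ltr0n.
rewrite mulr_gt0 ?ladder_gt0 // divr_gt0 // mulr_gt0 //.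
by rewrite -[X in X < _]addr0 ltr_leD.
Qed.

Lemma ladder_le n : ladder n <= (1 + 2 * lam) ^+ n.
Proof.
elim: n => [|n IHn]; first by rewrite /ladder big_ord0 expr0.
rewrite ladderS exprSr ler_pM ?(ltW (ladder_gt0 _)) //.
  by rewrite divr_ge0 ?addr_ge0 // mulr_ge0.
rewrite ler_pdivrMr; last by rewrite natr1 ltr0n.
have n0 := ler0n R n; have : 0 <= n%:R * lam by rewrite mulr_ge0.
by move: lam0 => l0 nl; nra.
Qed.

(** The Bessel recurrence removes the term r^n G_(n+1) left by the product rule. The weights are
    such that the upper coefficient is the next ladder constant, as telescoping requires. *)
Lemma harm_dim_derive_besselg n (r : R) : is_derive r 1 (fun x => harm_dim n.+1 * g n.+1 x)
  (ladder n * g n r - ladder n.+1 * g n.+2 r).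
Proof.
have dg := is_derive_besselgS lam0 n r.
apply: is_derive_eq; rewrite /GRing.scale /=.
have E := besselG_rec lam0 n (r ^+ 2).
transitivity (ladder n / (n%:R + 1) * ((n%:R + 1) * r ^+ n * (2 * (n%:R + 1 + lam) * G n.+1 (r ^+ 2))
   - 2 * (n%:R + 1 + lam) * g n.+2 r)).
  by rewrite -[n.+1%:R]natr1; field.
rewrite -E ladderS /besselg !exprS; field; exact: nat1_neq0.
Qed.

(** At a point z with axis coordinate [x] and squared distance [c] from the axis this is g_n(|z|)
    C_n(<z, e> / |z|), a solution of the Helmholtz equation, written so that z = 0 is no
    exception. *)
Definition zonal_wave (n : nat) (c x : R) : R := G n (x ^+ 2 + c) * H n x (x ^+ 2 + c).

Let is_derive_sqrD (c x : R) : is_derive x 1 (fun x : R => x ^+ 2 + c) (2 * x).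
Proof. by apply: is_derive_eq; rewrite /GRing.scale /= mulr1; ring. Qed.

Let is_derive_G n (c x : R) : is_derive x 1 (fun x => G n (x ^+ 2 + c))
  (- (x * G n.+1 (x ^+ 2 + c))).
Proof.
have dG := is_derive_besselG lam0 n (x ^+ 2 + c).
have d2 := is_derive_sqrD c x.
apply: (is_derive_eq (@is_derive1_comp _ (G n) (fun x => x ^+ 2 + c) _ _ _ dG d2)).
by rewrite /GRing.scale /=; field.
Qed.

Lemma is_derive_zonal_wave0 (c x : R) :
  is_derive x 1 (zonal_wave 0 c) (- zonal_wave 1 c x).
Proof.
rewrite (_ : zonal_wave 0 c = fun x => G 0 (x ^+ 2 + c)); last first.
  by apply/funext => y; rewrite /zonal_wave zonal0 mulr1.
by apply: (is_derive_eq (is_derive_G 0 c x)); rewrite /zonal_wave zonal1; ring.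
Qed.

Lemma harm_dim_derive_zonal_wave n (c x : R) :
  is_derive x 1 (fun x => harm_dim n.+1 * zonal_wave n.+1 c x)
  (ladder n * zonal_wave n c x - ladder n.+1 * zonal_wave n.+2 c x).
Proof.
have dG := is_derive_G n.+1 c x.
have dH := is_derive_zonal lam0 n.+1 c x.
have dZ := is_deriveM dG dH.
have {}dZ : is_derive x 1 (zonal_wave n.+1 c) _ := dZ.
apply: is_derive_eq; rewrite /GRing.scale /= ?mulr1.
rewrite /zonal_wave -[n.+1%:R]natr1.
have E1 := besselG_rec lam0 n (x ^+ 2 + c).
have E2 := zonalSS lam0 n x (x ^+ 2 + c).
move: E1 E2.
move: (x ^+ 2 + c) => s; rewrite ladderS [zonal lam n.+1.-1]/=.
move: (G n.+2 s) (G n.+1 s) (G n s) => g2 g1 g0.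
move: (H n.+2 x s) (H n.+1 x s) (H n x s) => h2 h1 h0 E1 E2.
transitivity (ladder n / (n%:R + 1) * ((2 * (n%:R + 1 + lam) * g1) * (n%:R + 1) * h0 -
   g2 * (2 * (n%:R + 1 + lam) * x * h1))).
  by field.
rewrite -E1.
transitivity (ladder n / (n%:R + 1) * (g0 * (n%:R + 1) * h0 - g2 *
   (2 * (n%:R + 1 + lam) * x * h1 - (n%:R + 1) * s * h0))).
  by congr (_ * _); ring.
by rewrite -E2; field.
Qed.

(** The two points are y = s e and x, whose axis coordinate is [p0 + s]; hence x - y does not depend
    on [s]. *)
Let partial (N : nat) (c p0 s : R) : R :=
  \sum_(0 <= n < N.+1) harm_dim n * g n s * zonal_wave n c (p0 + s).

Let flux (N : nat) (c p0 s : R) : R :=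
  ladder N * (g N s * zonal_wave N.+1 c (p0 + s) + g N.+1 s * zonal_wave N c (p0 + s)).

(* The two ladder relations make the derivative telescope. *)
Lemma is_derive_partial N (c p0 s : R) :
  is_derive s 1 (partial N c p0) (- flux N c p0 s).
Proof.
have dp : is_derive s 1 (fun s : R => p0 + s) 1.
  exact: is_derive_eq (is_deriveD (is_derive_cst p0 s 1) (is_derive_id s 1)) (add0r 1).
elim: N => [|N IHN].
  rewrite (_ : partial 0 c p0 = g 0 * (zonal_wave 0 c \o (fun s => p0 + s))); last first.
    by apply/funext => y; rewrite /partial big_nat1 /= mul1r.
  have d1 := is_derive_besselg0 lam0 s.
  have d2 := is_derive_zonal_wave0 c (p0 + s).
  have d3 := @is_derive1_comp _ _ _ _ _ _ d2 dp.
  apply: (is_derive_eq (is_deriveM d1 d3)).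
  by rewrite /flux /ladder big_ord0 /GRing.scale /=; ring.
have d1 := harm_dim_derive_besselg N s.
have d2 := harm_dim_derive_zonal_wave N c (p0 + s).
have {d2} d3 := @is_derive1_comp _ _ _ _ _ _ d2 dp.
have key : is_derive s 1 (fun s => harm_dim N.+1 * g N.+1 s * zonal_wave N.+1 c (p0 + s))
  (flux N c p0 s - flux N.+1 c p0 s).
  have := lt0r_neq0 (harm_dim_gt0 N.+1).
  move: (harm_dim N.+1) d1 d3 => k d1 d3 k0.
  (* The ladder relations differentiate [g] and [zonal_wave] only when each is multiplied by [k], so
     the product is written with both factors scaled. *)
  rewrite (_ : (fun s => _) = k^-1 \*o ((fun x => k * g N.+1 x) *
     ((fun x => k * zonal_wave N.+1 c x) \o (fun s => p0 + s)))); last first.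
    apply/funext => y /=; rewrite [(_ * _) y](_ : _ = (k * g N.+1 y) * (k * zonal_wave N.+1 c (p0 + y))) //.
    by field.
  have d4 := is_deriveM d1 d3.
  apply: (is_derive_eq (is_deriveZ k^-1 d4)).
  by rewrite /flux /GRing.scale /=; field.
rewrite (_ : partial N.+1 c p0 = partial N c p0 + (fun s => harm_dim N.+1 * g N.+1 s * zonal_wave N.+1 c (p0 + s))); last first.
  by apply/funext => y; rewrite /partial big_nat_recr.
by apply: (is_derive_eq (is_deriveD IHN key)); ring.
Qed.

Let besselG_le_exp n M s : `|s| <= M -> `|G n s| <= expR M / n`!%:R.
Proof.
move=> sM; apply: le_trans (besselG_le lam0 n s) _.
rewrite mulrC ler_pM ?expR_ge0 ?ler_expR // ?invr_ge0 ?mulr_ge0 ?exprn_ge0 //.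
rewrite lef_pV2 ?posrE ?mulr_gt0 ?exprn_gt0 ?ltr0n ?fact_gt0 //.
by rewrite ler_peMl // exprn_ege1 // ler1n.
Qed.

Let besselg_bound n M s : `|s| <= M -> `|g n s| <= M ^+ n * (expR (M ^+ 2) / n`!%:R).
Proof.
move=> sM; have M0 : 0 <= M by apply: le_trans sM.
rewrite normrM normrX ler_pM ?exprn_ge0 ?lerXn2r ?nnegrE //.
by apply: besselG_le_exp; rewrite normrX lerXn2r ?nnegrE.
Qed.

Let zonal_wave_bound n M c x : 0 <= c -> 0 <= M -> x ^+ 2 + c <= M ^+ 2 ->
  `|zonal_wave n c x| <= M ^+ n * (expR (M ^+ 2) / n`!%:R).
Proof.
move=> c0 M0 xM; have s0 : 0 <= x ^+ 2 + c by rewrite addr_ge0 ?sqr_ge0.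
rewrite normrM mulrC ler_pM //; last first.
  by apply: besselG_le_exp; rewrite ger0_norm.
have /le_trans -> // : `|H n x (x ^+ 2 + c)| <= Num.sqrt (x ^+ 2 + c) ^+ n.
  by apply: zonal_norm_le; rewrite // lerDl.
by rewrite lerXn2r ?nnegrE ?sqrtr_ge0 // -(ger0_norm M0) -sqrtr_sqr ler_wsqrtr.
Qed.

(** Each product in the flux carries two factorials. One of them already absorbs the geometric
    growth of [ladder]; the other is dropped, and an exponential coefficient remains. *)
Let flux_bound N M c p0 s : 0 <= c -> `|s| <= M -> (p0 + s) ^+ 2 + c <= M ^+ 2 ->
  `|flux N c p0 s| <=
    2 * M * expR (M ^+ 2) ^+ 2 * exp_coeff ((1 + 2 * lam) * M ^+ 2) N.
Proof.
move=> c0 sM pM; have M0 : 0 <= M by apply: le_trans sM.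
set E := expR (M ^+ 2).
have E0 : 0 <= E by rewrite expR_ge0.
pose b n := M ^+ n * (E / n`!%:R).
have b0 n : 0 <= b n by rewrite /b mulr_ge0 ?exprn_ge0 // divr_ge0.
have : `|flux N c p0 s| <= (1 + 2 * lam) ^+ N * (b N * b N.+1 + b N.+1 * b N).
  rewrite normrM; apply: ler_pM => //; first by rewrite (ger0_norm (ltW (ladder_gt0 N))) ladder_le.
  rewrite (le_trans (ler_normD _ _)) // lerD // normrM ler_pM //;
    by [exact: besselg_bound|exact: zonal_wave_bound].
move=> /le_trans; apply.
have bS : b N.+1 <= M ^+ N.+1 * E.
  by rewrite /b mulrA ler_piMr ?mulr_ge0 ?exprn_ge0 // invf_le1 ?ltr0n ?fact_gt0 // ler1n fact_gt0.
have -> : 2 * M * E ^+ 2 * exp_coeff ((1 + 2 * lam) * M ^+ 2) N =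
  (1 + 2 * lam) ^+ N * (2 * (b N * (M ^+ N.+1 * E))).
  rewrite /exp_coeff /b /= exprMn -exprM mulnC exprM (exprS M).
  by move: ((1 + 2 * lam) ^+ N) (M ^+ N) => u v; ring.
rewrite ler_wpM2l ?exprn_ge0 ?addr_ge0 ?mulr_ge0 //.
rewrite [b N.+1 * b N]mulrC -mulr2n -[leLHS]mulr_natl ler_wpM2l //.
by rewrite ler_wpM2l.
Qed.

Lemma bessel_addition (r rho t : R) : 0 <= r -> 0 <= rho -> `|t| <= 1 ->
  series (fun n => harm_dim n * g n r * g n rho * H n t 1) @ \oo
    --> G 0 (r ^+ 2 + rho ^+ 2 - 2 * r * rho * t).
Proof.
(* At s = rho the point x has norm r and its angle with e has cosine t: [c] is its squared distance
   from the axis, and [p0] the axis coordinate of x - rho e. *)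
move=> r0 rho0 t1; pose c := r ^+ 2 * (1 - t ^+ 2); pose p0 := r * t - rho.
have t2 : t ^+ 2 <= 1 by rewrite -real_normK ?num_real ?expr_le1.
have c0 : 0 <= c by rewrite mulr_ge0 ?sqr_ge0 // subr_ge0.
have h1 N : partial N c p0 rho =
    series (fun n => harm_dim n * g n r * g n rho * H n t 1) N.+1.
  apply: eq_bigr => n _; rewrite /zonal_wave subrK.
  have -> : (r * t) ^+ 2 + c = r ^+ 2 * 1 by rewrite /c; ring.
  rewrite zonal_homo // mulr1 /besselg; ring.
have h0 N : partial N c p0 0 = G 0 (r ^+ 2 + rho ^+ 2 - 2 * r * rho * t).
  rewrite /partial big_nat_recl // big1_seq => [|n _].
    rewrite besselg0 // /zonal_wave zonal0 /= !mul1r !mulr1 !addr0.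
    by congr (G 0 _); rewrite /c /p0; ring.
  by rewrite besselg0 // mulr0 mul0r.
pose M := r + rho.
have M0 : 0 <= M by rewrite addr_ge0.
pose C := 2 * M * expR (M ^+ 2) ^+ 2; pose z := (1 + 2 * lam) * M ^+ 2.
have key N : `|partial N c p0 rho - partial N c p0 0| <= C * exp_coeff z N * rho.
  have [|s sin ->] := @MVT_segment _ (partial N c p0) (fun s => - flux N c p0 s) 0 rho rho0
    (fun s _ => is_derive_partial N c p0 s).
    apply: continuous_subspaceT => s; apply/differentiable_continuous/derivable1_diffP.
    by have [] := is_derive_partial N c p0 s.
  move: sin; rewrite in_itv /= => /andP[s0 srho].
  rewrite subr0 normrM normrN (ger0_norm rho0) ler_wpM2r //.
  apply: flux_bound => //.
    by rewrite ger0_norm // (le_trans srho) // lerDr.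
  rewrite /p0 /c /M -subr_ge0.
  (* The norm of x stays at most r + rho along the path: for 0 <= s <= rho the difference of the
     squares is a sum of nonnegative terms. *)
  have -> : (r + rho) ^+ 2 - ((r * t - rho + s) ^+ 2 + r ^+ 2 * (1 - t ^+ 2)) =
    2 * r * (rho - s) * (1 + t) + 2 * r * s + s * (2 * rho - s) by ring.
  have t1' : 0 <= 1 + t by move: t1; rewrite ler_norml => /andP[t1 _]; lra.
  by rewrite !addr_ge0 ?mulr_ge0 ?subr_ge0 //; lra.
(* [partial N] has N + 1 terms, hence the shift. *)
rewrite -cvg_shiftS /=; apply/subr_cvg0; apply/norm_cvg0P.
apply: (@squeeze_cvgr _ _ _ _ (cst 0) (fun N => C * exp_coeff z N * rho)).
- apply: nearW => N; rewrite normr_ge0 /= -(h0 N) -h1; exact: key.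
- exact: cvg_cst.
- rewrite (_ : 0 = C * 0 * rho); last by rewrite mulr0 mul0r.
  by apply: cvgMl; apply: cvgMr; exact: cvg_exp_coeff.
Qed.

End Addition.

(** * Bounded integrands over a finite measure *)

Section FiniteMeasure.
Context d (T : measurableType d) (R : realType).
Variables (mu : {finite_measure set T -> \bar R}) (D : set T).
Hypothesis mD : measurable D.

Lemma bounded_integrable (f : T -> R) (M : R) : measurable_fun D f ->
  (forall x, D x -> `|f x| <= M) -> mu.-integrable D (EFin \o f).
Proof.
move=> mf fM; apply: measurable_bounded_integrable => //.
  by rewrite ltey_eq fin_num_measure.
exists M; split; first exact: num_real.
by move=> N MN x Dx; apply: le_trans (fM _ Dx) (ltW MN).
Qed.

Lemma Rintegral_dct (f_ : nat -> T -> R) (f : T -> R) (M : R) :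
  (forall n, measurable_fun D (f_ n)) ->
  (forall n x, D x -> `|f_ n x| <= M) ->
  (forall x, D x -> f_ ^~ x @ \oo --> f x) ->
  (fun n => \int[mu]_(x in D) f_ n x) @ \oo --> \int[mu]_(x in D) f x.
Proof.
move=> mf_ fM cf.
have mF n : measurable_fun D (EFin \o f_ n) by exact/measurable_EFinP.
have cF x : D x -> (EFin \o f_ n) x @[n --> \oo] --> (EFin \o f) x.
  by move=> Dx; apply: cvg_EFin; [exact: nearW|exact: cf].
have mf := emeasurable_fun_cvg _ _ mF cF.
have IM : mu.-integrable D (EFin \o cst M).
  by apply: (@bounded_integrable (cst M) `|M|).
have [If _ cI] := dominated_convergence mD mF mf (aeW _ cF) IM
  (aeW _ (fun x n Dx => fM n x Dx)).
apply: fine_cvg; rewrite /Rintegral fineK //; exact: integrable_fin_num.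
Qed.

Lemma integrable_EFinZl (k : R) (f : T -> R) :
  mu.-integrable D (EFin \o f) -> mu.-integrable D (EFin \o (fun x => k * f x)).
Proof. exact: integrableZl. Qed.

Lemma integrable_EFinD (f g : T -> R) :
  mu.-integrable D (EFin \o f) -> mu.-integrable D (EFin \o g) ->
  mu.-integrable D (EFin \o (fun x => f x + g x)).
Proof. exact: integrableD. Qed.

Lemma integrable_finsum (I : Type) (s : seq I) (f : I -> T -> R) :
  (forall i, mu.-integrable D (EFin \o f i)) ->
  mu.-integrable D (EFin \o (fun x => \sum_(i <- s) f i x)).
Proof.
move=> If; elim: s => [|i s IHs].
  rewrite (_ : _ \o _ = cst 0%E); first exact: integrable0.
  by apply/funext => x; rewrite /= big_nil.
rewrite (_ : _ \o _ = ((EFin \o f i) \+ (EFin \o (fun x => (\sum_(i <- s) f i x)%R)))%E).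
  exact: integrableD.
by apply/funext => x; rewrite /= big_cons.
Qed.

Lemma Rintegral_finsum (I : Type) (s : seq I) (f : I -> T -> R) :
  (forall i, mu.-integrable D (EFin \o f i)) ->
  \int[mu]_(x in D) \sum_(i <- s) f i x = \sum_(i <- s) \int[mu]_(x in D) f i x.
Proof.
move=> If; elim: s => [|i s IHs].
  under eq_Rintegral do rewrite big_nil.
  by rewrite Rintegral_cst // mul0r big_nil.
under eq_Rintegral do rewrite big_cons.
by rewrite RintegralD ?IHs ?big_cons //; exact: integrable_finsum.
Qed.

End FiniteMeasure.

(** * Inner products, in finite dimension and in the sequence space alike *)

Section EuclideanGeometry.
Variable R : realType.

(** Domination by x_i^2 + y_i^2. Only with this convergence does the [limn] in [dot] behave as a
    sum. *)
Lemma is_cvg_ell2_dot (x y : ell2 R) : cvgn (series (fun i => x i * y i)).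
Proof.
have cx (z : ell2 R) : cvgn (series (fun i => z i ^+ 2)).
  by case: z => z /= /asboolP.
have cxy := is_cvg_seriesD (cx x) (cx y).
apply: normed_cvg; apply: (series_le_cvg _ _ _ cxy) => i.
- exact: normr_ge0.
- by rewrite addr_ge0 ?sqr_ge0.
- rewrite -[X in _ <= X]/(x i ^+ 2 + y i ^+ 2) /= ler_norml.
  have := sqr_ge0 (x i + y i); have := sqr_ge0 (x i - y i).
  have := sqr_ge0 (x i); have := sqr_ge0 (y i).
  by rewrite sqrrB sqrrD => *; apply/andP; split; lra.
Qed.

Section Dot.
Variable d : dimension.
Implicit Types (x y z : euclid R d) (a : R).

Lemma dotC x y : dot x y = dot y x.
Proof.
case: d x y => [n|] x y /=; first by apply: eq_bigr => i _; rewrite mulrC.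
by congr (limn (series _)); apply/funext => i; rewrite mulrC.
Qed.

Lemma dot_linear a x y z : dot (a *: x + y) z = a * dot x z + dot y z.
Proof.
case: d x y z => [n|] x y z /=.
  rewrite mulr_sumr -big_split /=; apply: eq_bigr => i _.
  by rewrite !mxE mulrDl mulrA.
have cz u := @is_cvg_ell2_dot u z.
transitivity (limn (series (a *: (fun i => x i * z i) + (fun i => y i * z i)))).
  congr (limn (series _)); apply/funext => i.
  change ((a * x i + y i) * z i = a * (x i * z i) + y i * z i).
  by rewrite mulrDl mulrA.
rewrite lim_seriesD; [|exact: is_cvg_seriesZ|exact: cz].
by rewrite lim_seriesZ.
Qed.

Lemma dot_ge0 x : 0 <= dot x x.
Proof.
case: d x => [n|] x /=; first by apply: sumr_ge0 => i _; rewrite -expr2 sqr_ge0.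
apply: limr_ge; first exact: is_cvg_ell2_dot.
by apply: nearW => k; apply: sumr_ge0 => i _; rewrite -expr2 sqr_ge0.
Qed.

Lemma dot_eq0 x : dot x x = 0 -> x = 0.
Proof.
case: d x => [n|] x /=.
  move=> /eqP; rewrite psumr_eq0 => [/allP x0|i _]; last by rewrite -expr2 sqr_ge0.
  apply/rowP => i; rewrite mxE; apply/eqP.
  by have := x0 i (mem_index_enum i); rewrite /= mulf_eq0 orbb ord1.
move=> x0; apply/val_inj/funext => i /=; apply/eqP; rewrite -sqrf_eq0.
rewrite eq_le sqr_ge0 andbT -x0.
have nd : nondecreasing_seq (series (fun i => x i * x i)).
  by apply/nondecreasing_seqP => k; rewrite seriesSr lerDl -expr2 sqr_ge0.
apply: le_trans (nondecreasing_cvgn_le nd (@is_cvg_ell2_dot x x) i.+1).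
rewrite seriesSr -expr2 lerDr; apply: sumr_ge0 => k _.
by rewrite -expr2 sqr_ge0.
Qed.

Lemma dotDl x y z : dot (x + y) z = dot x z + dot y z.
Proof. by have := dot_linear 1 x y z; rewrite scale1r mul1r. Qed.

Lemma dot0l x : dot 0 x = 0.
Proof. by have := dotDl 0 0 x; rewrite addr0 => H; lra. Qed.

Lemma dotZl a x y : dot (a *: x) y = a * dot x y.
Proof. by have := dot_linear a x 0 y; rewrite addr0 dot0l addr0. Qed.

Lemma dotBl x y z : dot (x - y) z = dot x z - dot y z.
Proof. by rewrite dotDl -scaleN1r dotZl mulN1r. Qed.

Lemma dotDr x y z : dot x (y + z) = dot x y + dot x z.
Proof. by rewrite dotC dotDl !(dotC x). Qed.

Lemma dotBr x y z : dot x (y - z) = dot x y - dot x z.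
Proof. by rewrite dotC dotBl !(dotC x). Qed.

Lemma dotZr a x y : dot x (a *: y) = a * dot x y.
Proof. by rewrite dotC dotZl dotC. Qed.

Lemma enorm_ge0 x : 0 <= enorm x.
Proof. exact: sqrtr_ge0. Qed.

Lemma enorm_sqr x : enorm x ^+ 2 = dot x x.
Proof. by rewrite sqr_sqrtr ?dot_ge0. Qed.

Lemma enorm0 : enorm (0 : euclid R d) = 0.
Proof. by rewrite /enorm dot0l sqrtr0. Qed.

Lemma enorm_eq0 x : (enorm x == 0) = (x == 0).
Proof.
apply/eqP/eqP => [x0|->]; last exact: enorm0.
by apply: dot_eq0; rewrite -enorm_sqr x0 expr0n.
Qed.

Lemma enorm_gt0 x : x != 0 -> 0 < enorm x.
Proof. by rewrite -enorm_eq0 lt_neqAle eq_sym enorm_ge0 andbT. Qed.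

Lemma enormZ a x : enorm (a *: x) = `|a| * enorm x.
Proof. by rewrite /enorm dotZl dotZr mulrA sqrtrM ?sqr_ge0 // -expr2 sqrtr_sqr. Qed.

Lemma enormB_sqr x y :
  enorm (x - y) ^+ 2 = enorm x ^+ 2 + enorm y ^+ 2 - 2 * dot x y.
Proof. by rewrite !enorm_sqr dotBl !dotBr (dotC y x); ring. Qed.

Lemma cauchy_schwarz x y : `|dot x y| <= enorm x * enorm y.
Proof.
have [->|y0] := eqVneq y 0; first by rewrite dotC dot0l normr0 enorm0 mulr0.
have ny := enorm_gt0 y0.
rewrite -(@ler_pXn2r _ 2) ?nnegrE ?mulr_ge0 ?enorm_ge0 //.
rewrite real_normK ?num_real // exprMn !enorm_sqr.
have yy : 0 < dot y y by rewrite -enorm_sqr exprn_gt0.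
have := dot_ge0 (x - (dot x y / dot y y) *: y).
have -> : dot (x - (dot x y / dot y y) *: y) (x - (dot x y / dot y y) *: y) =
    dot x x - dot x y ^+ 2 / dot y y.
  rewrite dotBl !dotBr !dotZl !dotZr (dotC y x); field.
  by rewrite gt_eqF.
by rewrite subr_ge0 ler_pdivrMr.
Qed.

Lemma ler_enormD x y : enorm (x + y) <= enorm x + enorm y.
Proof.
rewrite -(@ler_pXn2r _ 2) ?nnegrE ?addr_ge0 ?enorm_ge0 //.
rewrite sqrrD !enorm_sqr dotDl !dotDr (dotC y x).
have := le_trans (ler_norm _) (cauchy_schwarz x y).
by rewrite -[_ *+ 2]mulr_natl => H; lra.
Qed.

Lemma enormN x : enorm (- x) = enorm x.
Proof. by rewrite -scaleN1r enormZ normrN1 mul1r. Qed.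

Lemma ler_enormB_dist x y : `|enorm x - enorm y| <= enorm (x - y).
Proof.
have H (u v : euclid R d) : enorm u - enorm v <= enorm (u - v).
  by rewrite lerBlDr; have := ler_enormD (u - v) v; rewrite subrK.
by rewrite ler_norml H andbT lerNl opprB -(opprB y x) enormN H.
Qed.

Lemma normalized_dot x y :
  dot ((enorm x)^-1 *: x) ((enorm y)^-1 *: y) = dot x y / (enorm x * enorm y).
Proof. by rewrite dotZl dotZr invfM mulrA mulrC. Qed.

Lemma normalized_dot_le1 x y :
  `|dot ((enorm x)^-1 *: x) ((enorm y)^-1 *: y)| <= 1.
Proof.
rewrite normalized_dot; have [->|x0] := eqVneq x 0; first by rewrite dot0l mul0r normr0.
have [->|y0] := eqVneq y 0; first by rewrite dotC dot0l mul0r normr0.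
have p : 0 < enorm x * enorm y by rewrite mulr_gt0 ?enorm_gt0.
by rewrite normf_div (gtr0_norm p) ler_pdivrMr // mul1r cauchy_schwarz.
Qed.

Lemma orthogonal_groupB f : orthogonal_group f ->
  forall x y, enorm (f x - f y) = enorm (x - y).
Proof.
move=> [lf _ nf] x y; rewrite -(nf (x - y)); congr enorm.
by have := lf (-1) y x; rewrite !scaleN1r [x - y]addrC => ->; rewrite addrC.
Qed.

End Dot.

Lemma orthonormal_pair (d : dimension) : dim_ge2 d -> exists e1 e2 : euclid R d,
  [/\ dot e1 e1 = 1, dot e2 e2 = 1 & dot e1 e2 = 0].
Proof.
case: d => [n|] /= n2.
  pose i0 := Ordinal (ltn_trans (ltnSn 0) n2); pose i1 := Ordinal n2.
  have S (i j : 'I_n) : \sum_k (delta_mx 0 i : 'rV[R]_n) ord0 k * (delta_mx 0 j : 'rV[R]_n) ord0 k = (i == j)%:R.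
    rewrite (bigD1 i) //= big1 => [|k ki]; last by rewrite !mxE (negPf ki) mul0r.
    by rewrite !mxE !eqxx mul1r addr0 /= eq_sym.
  exists (delta_mx 0 i0), (delta_mx 0 i1); by rewrite !S !eqxx.
have sq (j : nat) : (fun i : nat => (i == j)%:R : R) \in @square_summable R.
  apply/asboolP/cvg_ex; exists (1 : R); apply: cvg_near_cst.
  exists j.+1 => // k /= jk; rewrite /series /= big_mkord (bigD1 (Ordinal jk)) //= eqxx expr1n.
  rewrite big1 ?addr0 // => i; rewrite -val_eqE /= => /negPf ->.
  by rewrite expr0n.
have S (i j : nat) : limn (series (fun k => (k == i)%:R * (k == j)%:R : R)) = (i == j)%:R :> R.
  apply/cvg_lim => //; apply: cvg_near_cst.
  exists i.+1 => // k /= ik; rewrite /series /= big_mkord (bigD1 (Ordinal ik)) //= eqxx mul1r.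
  rewrite big1 ?addr0 // => m; rewrite -val_eqE /= => /negPf ->.
  by rewrite mul0r.
by exists (Ell2 (sq 0)), (Ell2 (sq 1)); rewrite /= !S.
Qed.

(** Uniqueness compares coefficients at fixed radii, so every [t] in [-1, 1] must occur as the
    cosine of an angle. Two orthonormal vectors suffice for this, and dimension at least 2 provides
    them. *)
Lemma vectors_with_angle (d : dimension) (r s t : R) : dim_ge2 d ->
  0 <= r -> 0 <= s -> `|t| <= 1 ->
  exists x y : euclid R d, [/\ enorm x = r, enorm y = s & dot x y = r * s * t].
Proof.
move=> d2 r0 s0 t1; have [e1 [e2 [e11 e22 e12]]] := orthonormal_pair d2.
have t2 : t ^+ 2 <= 1 by rewrite -real_normK ?num_real ?expr_le1.
pose q := Num.sqrt (1 - t ^+ 2).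
have q2 : q ^+ 2 = 1 - t ^+ 2 by rewrite sqr_sqrtr // subr_ge0.
have u1 : enorm e1 = 1 by rewrite /enorm e11 sqrtr1.
have u2 : enorm (t *: e1 + q *: e2) = 1.
  rewrite /enorm !(dotDl, dotDr, dotZl, dotZr) e11 e22 (dotC e2) e12.
  by rewrite (_ : _ + _ = t ^+ 2 + q ^+ 2); [rewrite q2 addrC subrK sqrtr1|ring].
exists (r *: e1), (s *: (t *: e1 + q *: e2)); split.
- by rewrite enormZ u1 mulr1 ger0_norm.
- by rewrite enormZ u2 mulr1 ger0_norm.
- by rewrite !(dotZl, dotZr, dotDr) e11 e12; ring.
Qed.

End EuclideanGeometry.

(** * The law of a projection of a uniform vector *)

Section SphereLaw.
Context (R : realType) (n : nat) (dT : measure_display) (T : measurableType dT)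
  (P : probability T R) (U : {RV P >-> g_sigma_algebraType (@open 'rV[R]_n)}).
Hypothesis hU : uniform_on_sphere U.

Local Notation E := (euclid R (Fin n)).

Definition proj (v : E) (w : T) : R := dot v (U w : E).

Let measurable_dot (v : E) :
  measurable_fun setT (fun x : g_sigma_algebraType (@open 'rV[R]_n) => dot v (x : E)).
Proof.
apply: (measurability _ (RGenOpens.measurableE R)) => _ [_ [a [b ->] <-]].
rewrite setTI; apply: sub_sigma_algebra.
have : continuous (fun x : 'rV[R]_n => \sum_(i < n) v ord0 i * x ord0 i).
  rewrite (_ : (fun x => _) = \sum_(i < n) (fun x : 'rV[R]_n => v ord0 i * x ord0 i)).
    elim/big_ind : _ => [x|f g cf cg x|i _ x].
    - exact: (@cst_continuous _ _ (0 : R) x).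
    - exact: cvgD (cf x) (cg x).
    - have c : (fun y : 'rV[R]_n => y ord0 i) @ x --> x ord0 i.
        exact: coord_continuous.
      exact: (cvgM (cvg_cst (v ord0 i)) c).
  by apply/funext => x; rewrite fct_sumE.
by move=> /continuousP; apply; exact: interval_open.
Qed.

Lemma measurable_proj v : measurable_fun setT (proj v).
Proof. exact: (measurableT_comp (measurable_dot v)). Qed.

Lemma proj_lin a u v w : proj (a *: u + v) w = a * proj u w + proj v w.
Proof. exact: dot_linear. Qed.

Lemma projN v w : proj (- v) w = - proj v w.
Proof. by rewrite /proj -scaleN1r dotZl mulN1r. Qed.

Definition axis (i : 'I_n) : E := (delta_mx 0 i : 'rV[R]_n).

Lemma dot_axis i (x : E) : dot (axis i) x = (x : 'rV[R]_n) ord0 i.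
Proof.
rewrite /dot /axis (bigD1 i) //= big1 ?addr0 => [|k ki].
  by rewrite !mxE !eqxx mul1r.
by rewrite !mxE (negPf ki) mul0r.
Qed.

Lemma dot_sum_axis (x : E) : dot x x = \sum_(i < n) dot (axis i) x ^+ 2.
Proof. by apply: eq_bigr => i _; rewrite dot_axis expr2. Qed.

(** An event of probability 1 on which |<v, U>| <= |v| holds at every point. Integrating over it
    turns almost sure bounds into pointwise ones. *)
Definition on_sphere : set T := [set w | dot (U w : E) (U w) = 1].

Lemma measurable_on_sphere : measurable on_sphere.
Proof.
have -> : on_sphere = (\sum_(i < n) (fun w => proj (axis i) w ^+ 2)) @^-1` [set 1].
  apply/seteqP; split=> w; rewrite /on_sphere /preimage /mkset => <-;
    by rewrite dot_sum_axis fct_sumE.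
rewrite -[X in measurable X]setTI.
suff : measurable_fun setT (\sum_(i < n) (fun w => proj (axis i) w ^+ 2)).
  by apply; [exact: measurableT|exact: measurable_set1].
elim/big_ind : _ => [|f g mf mg|i _]; [exact: measurable_cst|exact: measurable_funD|].
exact: measurable_funX (measurable_proj _).
Qed.

Let P_outside : P (~` on_sphere) = 0%E.
Proof.
have mC : measurable (~` on_sphere) by exact: measurableC measurable_on_sphere.
apply/(negligibleP P mC).
apply: negligibleS hU.1 => w nw enw; apply: nw.
by rewrite /on_sphere /mkset -enorm_sqr enw expr1n.
Qed.

Lemma P_on_sphere : P on_sphere = 1%E.
Proof.
rewrite -[on_sphere]setCK probability_setC ?P_outside ?sube0 //.
exact: measurableC measurable_on_sphere.
Qed.

Lemma proj_le v w : on_sphere w -> `|proj v w| <= enorm v.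
Proof.
move=> Sw; apply: le_trans (cauchy_schwarz _ _) _.
by rewrite [enorm (U w : E)]/enorm Sw sqrtr1 mulr1.
Qed.

Lemma Rintegral_on_sphere (f : T -> R) M : measurable_fun setT f ->
  (forall w, `|f w| <= M) ->
  \int[P]_w f w = \int[P]_(w in on_sphere) f w.
Proof.
move=> mf fM; rewrite /Rintegral; congr fine.
rewrite (negligible_integral (N := ~` on_sphere)) ?setTD ?setCK //.
- exact: measurableC measurable_on_sphere.
- exact: (@bounded_integrable _ _ _ P setT measurableT f M mf (fun x _ => fM x)).
Qed.

Let reflect (e : E) (x : E) : E := x - (2 * dot x e / dot e e) *: e.

Let dot_reflect e x y : dot (reflect e x) y = dot x (reflect e y).
Proof. by rewrite /reflect dotBl dotBr dotZl dotZr (dotC y e); ring. Qed.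

Let reflectK e : e != 0 -> involutive (reflect e).
Proof.
move=> e0 x; have ee : dot e e != 0.
  by apply: contra_neq e0; exact: dot_eq0.
rewrite /reflect dotBl dotZl -addrA -opprD -scalerDl.
by rewrite (_ : _ / _ + _ / _ = 0) ?scale0r ?subr0 //; field.
Qed.

Let reflect_orthogonal e : e != 0 -> orthogonal_group (reflect e).
Proof.
move=> e0; split.
- move=> a x y; rewrite /reflect dot_linear.
  rewrite mulrDr mulrDl scalerDl opprD addrACA; congr (_ + _).
  rewrite scalerBr scalerA; congr (_ - _ *: _); ring.
- by exists (reflect e); exact: reflectK.
- by move=> x; rewrite /enorm dot_reflect reflectK.
Qed.

(** The reflection in the hyperplane orthogonal to v - v' sends v to v' when the norms agree. Being
    self-adjoint, it can be moved from v onto U, whose law it preserves. *)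
Lemma proj_law (v v' : E) : dot v v = dot v' v' -> forall A, measurable A ->
  P (proj v @^-1` A) = P (proj v' @^-1` A).
Proof.
move=> vv' A mA; have [->//|ne] := eqVneq v v'.
have e0 : v - v' != 0 by rewrite subr_eq0.
have rv : reflect (v - v') v = v'.
  rewrite /reflect (_ : _ / _ = 1) ?scale1r ?subKr //.
  have -> : dot (v - v') (v - v') = 2 * dot v (v - v').
    by rewrite dotBl !dotBr -vv' (dotC v' v); ring.
  rewrite divff //; apply: contra_neq e0 => H; apply: dot_eq0.
  have -> : dot (v - v') (v - v') = 2 * dot v (v - v').
    by rewrite dotBl !dotBr -vv' (dotC v' v); ring.
  exact: H.
have mS : <<s @open 'rV[R]_n >> [set x : 'rV[R]_n | A (dot v (x : E))].
  by have := measurable_dot v measurableT mA; rewrite setTI.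
have /esym := hU.2 _ (reflect_orthogonal e0) _ mS.
have -> // : U @^-1` (reflect (v - v') @^-1` [set x : 'rV[R]_n | A (dot v (x : E))]) = proj v' @^-1` A.
by apply/seteqP; split=> w; rewrite /proj /preimage /mkset -dot_reflect rv.
Qed.

Lemma Rintegral_proj_law (v v' : E) (h : R -> R) M : dot v v = dot v' v' ->
  measurable_fun setT h -> (forall x, `|h x| <= M) ->
  \int[P]_w h (proj v w) = \int[P]_w h (proj v' w).
Proof.
move=> vv' mh hM; rewrite /Rintegral; congr fine.
have I u : P.-integrable (proj u @^-1` setT) ((EFin \o h) \o proj u).
  apply: (@bounded_integrable _ _ _ P setT measurableT (h \o proj u) M) => // [|w _]; last exact: hM.
  exact: measurableT_comp mh (measurable_proj u).
have mE : measurable_fun setT (EFin \o h) by exact/measurable_EFinP.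
have L u := integral_pushforward (measurable_proj u) mE (I u) measurableT.
rewrite -[LHS]L -[RHS]L; apply: eq_measure_integral; [exact: measurable_proj|exact: measurable_proj|].
by move=> mv' mv A mA _; exact: proj_law.
Qed.

(** Meant for functions such as powers, which are bounded only on the range of the projection:
    truncation by [c] makes them bounded everywhere and changes nothing on that range. *)
Lemma Rintegral_sphere_law (v v' : E) (h : R -> R) M : dot v v = dot v' v' ->
  measurable_fun setT h -> (forall x, `|x| <= enorm v -> `|h x| <= M) ->
  \int[P]_(w in on_sphere) h (proj v w) = \int[P]_(w in on_sphere) h (proj v' w).
Proof.
move=> vv' mh hM; set r := enorm v; have r0 : 0 <= r := enorm_ge0 v.
pose c (x : R) := Num.max (- r) (Num.min x r).
have mc : measurable_fun setT c.
  by apply: measurable_maxr; [exact: measurable_cst|apply: measurable_minr].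
have cr x : `|c x| <= r.
  by rewrite /c ler_norml le_max lexx ge_max ge_min lexx orbT andbT /=; lra.
have cid x : `|x| <= r -> c x = x.
  by rewrite ler_norml => /andP[x1 x2]; rewrite /c (min_idPl x2) (max_idPr x1).
have S u : dot u u = dot v v -> \int[P]_(w in on_sphere) h (proj u w) =
    \int[P]_w h (c (proj u w)).
  move=> uv; rewrite (@Rintegral_on_sphere (fun w => h (c (proj u w))) M).
  - apply: eq_Rintegral => w; rewrite inE => Sw; rewrite cid //.
    by apply: le_trans (proj_le u Sw) _; rewrite /r /enorm uv.
  - exact: measurableT_comp mh (measurableT_comp mc (measurable_proj u)).
  - by move=> w; exact: hM.
rewrite !S //; apply: (@Rintegral_proj_law _ _ (h \o c) M) => //.
  exact: measurableT_comp.
by move=> x; exact: hM.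
Qed.

End SphereLaw.

(** * Moments of a projection *)

Section SphereMoments.
Context (R : realType) (n : nat) (dT : measure_display) (T : measurableType dT)
  (P : probability T R) (U : {RV P >-> g_sigma_algebraType (@open 'rV[R]_n)}).
Hypothesis n2 : (2 <= n)%N.
Hypothesis hU : uniform_on_sphere U.

Local Notation E := (euclid R (Fin n)).
Local Notation S := (on_sphere U).
Local Notation X := (proj U).

Let mS : measurable S := measurable_on_sphere U.

Let mX v : measurable_fun S (X v).
Proof. exact: measurable_funTS (measurable_proj U v). Qed.

Let integrable_projM (u v : E) k l :
  P.-integrable S (EFin \o (fun w => X u w ^+ k * X v w ^+ l)).
Proof.
apply: (@bounded_integrable _ _ _ P S mS _ (enorm u ^+ k * enorm v ^+ l)).
  by apply: measurable_funM; apply: measurable_funX.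
move=> w Sw; rewrite normrM !normrX.
by apply: ler_pM; rewrite ?exprn_ge0 // lerXn2r ?nnegrE ?enorm_ge0 // proj_le.
Qed.

Let integrable_projX (v : E) k : P.-integrable S (EFin \o (fun w => X v w ^+ k)).
Proof.
have := integrable_projM v v k 0; congr (_.-integrable _ (_ \o _)).
by apply/funext => w; rewrite expr0 mulr1.
Qed.

Definition moment (v : E) (k : nat) : R := \int[P]_(w in S) X v w ^+ k.

Lemma moment_law v v' k : dot v v = dot v' v' -> moment v k = moment v' k.
Proof.
move=> vv; apply: (@Rintegral_sphere_law _ _ _ _ _ _ hU _ _ (fun x => x ^+ k) (enorm v ^+ k)) => //.
by move=> x xv; rewrite normrX lerXn2r ?nnegrE ?enorm_ge0.
Qed.

Lemma momentZ a v k : moment (a *: v) k = a ^+ k * moment v k.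
Proof.
rewrite /moment -RintegralZl //; apply: eq_Rintegral => w _.
by rewrite /proj dotZl exprMn.
Qed.

Lemma moment0 v : moment v 0 = 1.
Proof.
rewrite /moment; under eq_Rintegral do rewrite expr0.
rewrite Rintegral_cst // mul1r -[RHS]/(fine 1%:E); congr fine.
exact: P_on_sphere.
Qed.

Lemma moment_odd v k : odd k -> moment v k = 0.
Proof.
move=> ok; have : moment v k = moment ((-1) *: v) k.
  by apply: moment_law; rewrite dotZl dotZr; ring.
by rewrite momentZ -signr_odd ok expr1 mulN1r => H; lra.
Qed.

Let poly_horner_inj (p q : {poly R}) : (forall x, p.[x] = q.[x]) -> p = q.
Proof.
move=> pq; apply/eqP; rewrite -subr_eq0; apply/eqP.
pose rs := [seq i%:R : R | i <- iota 0 (size (p - q))].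
apply: (@roots_geq_poly_eq0 _ _ rs); last by rewrite size_map size_iota.
  by apply/allP => x _; rewrite rootE hornerD hornerN pq subrr.
by rewrite map_inj_uniq ?iota_uniq // => i j /eqP; rewrite eqr_nat => /eqP.
Qed.

Let coef2_expr m : ((1 + 'X^2) ^+ m : {poly R})`_2 = m%:R.
Proof.
suff : ((1 + 'X^2) ^+ m : {poly R})`_0 = 1 /\ ((1 + 'X^2) ^+ m : {poly R})`_2 = m%:R by case.
elim: m => [|m [IH0 IH2]]; first by rewrite expr0 !coefC.
rewrite exprS mulrDl mul1r !coefD !coefXnM /= IH0 IH2.
by rewrite addr0 -natr1.
Qed.

(* The moment of [a + s *: b] is [(1 + s ^ 2) ^ (k / 2)] times that of [a];
   compare the coefficients of [s ^ 2]. *)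
Let mixed_moment (a b : E) m : dot a a = 1 -> dot b b = 1 -> dot a b = 0 ->
  (2 * m + 1)%:R * (\int[P]_(w in S) (X a w ^+ (2 * m) * X b w ^+ 2)) =
  moment a (2 * m + 2).
Proof.
move=> aa bb ab; set k := (2 * m + 2)%N; set c := moment a k.
pose q i := \int[P]_(w in S) (X a w ^+ (k - i) * X b w ^+ i) *+ 'C(k, i).
have : \poly_(i < k.+1) q i = c%:P * (1 + 'X^2) ^+ m.+1.
  apply: poly_horner_inj => s; rewrite horner_poly.
  rewrite hornerM hornerC horner_exp hornerD hornerC hornerXn.
  transitivity (moment (s *: b + a) k).
    rewrite /moment.
    transitivity (\int[P]_(w in S) \sum_(i < k.+1)
        (s ^+ i *+ 'C(k, i)) * (X a w ^+ (k - i) * X b w ^+ i)).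
      rewrite Rintegral_finsum //; last first.
        by move=> i; apply: integrable_EFinZl => //; exact: integrable_projM.
      apply: eq_bigr => i _; rewrite RintegralZl // /q.
      by rewrite !mulrnAl mulrC.
    apply: eq_Rintegral => w _; rewrite proj_lin addrC exprDn.
    apply: eq_bigr => i _; rewrite exprMn -mulrnAl; ring.
  have r0 : 0 <= 1 + s ^+ 2 by rewrite addr_ge0 ?sqr_ge0.
  rewrite (@moment_law _ (Num.sqrt (1 + s ^+ 2) *: a)); last first.
    rewrite !(dotDl, dotDr, dotZl, dotZr) aa bb (dotC b) ab !mulr1.
    rewrite -expr2 -[Num.sqrt _ * _]expr2 sqr_sqrtr //; ring.
  rewrite momentZ mulrC; congr (_ * _).
  by rewrite /k (_ : (2 * m + 2 = 2 * m.+1)%N) ?exprM ?sqr_sqrtr // mulnS addnC.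
move=> /(congr1 (fun p : {poly R} => p`_2)).
rewrite coef_poly coefCM coef2_expr ifT; last by rewrite /k addn2.
rewrite /q (_ : (k - 2)%N = (2 * m)%N) ?addnK //.
(* The binomial coefficient of 2m + 2 over 2 is (m + 1)(2m + 1), and (1 + X^2)^(m+1) has coefficient
   m + 1 at X^2; the common factor m + 1 cancels. *)
rewrite -[X in X = _ -> _]mulr_natr; have -> : 'C(k, 2) = (m.+1 * (2 * m + 1))%N.
  rewrite bin2 /k (_ : ((2 * m + 2) * (2 * m + 2).-1 = (m.+1 * (2 * m + 1)).*2)%N).
    by rewrite doubleK.
  have -> : (2 * m + 2).-1 = (2 * m + 1)%N by rewrite addn2 addn1.
  by rewrite -mul2n -[m.+1]addn1; ring.
rewrite natrM mulrCA [_ * (2 * m + 1)%:R]mulrC [c * _]mulrC => /mulfI; apply.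
by rewrite pnatr_eq0.
Qed.

(** Insert 1 = sum_i <e_i, U>^2 into the moment of order 2m along e_0. The term i = 0 is the moment
    of order 2m + 2, and each of the n - 1 others is a mixed moment, equal to it divided by 2m +
    1. *)
Lemma moment_step v m : dot v v = 1 ->
  (2 * m + n)%:R * moment v (2 * m + 2) = (2 * m + 1)%:R * moment v (2 * m).
Proof.
move=> vv; pose i0 := Ordinal (ltn_trans (ltnSn 0) n2).
have dax (i j : 'I_n) : dot (axis R i) (axis R j) = (i == j)%:R.
  by rewrite dot_axis /axis mxE eqxx eq_sym.
rewrite !(@moment_law v (axis R i0)) ?vv ?dax ?eqxx //.
set a := axis R i0; set c := moment a (2 * m + 2).
have -> : moment a (2 * m) = \sum_(i < n) \int[P]_(w in S) (X a w ^+ (2 * m) * X (axis R i) w ^+ 2).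
  rewrite -Rintegral_finsum //; apply: eq_Rintegral => w; rewrite inE => Sw.
  rewrite -mulr_sumr (_ : \sum_(i < n) _ = 1) ?mulr1 //.
  by rewrite -[RHS]Sw dot_sum_axis.
rewrite mulr_sumr (bigD1 i0) //=.
have -> : \int[P]_(w in S) (X (axis R i0) w ^+ (2 * m) * X (axis R i0) w ^+ 2) = c.
  by apply: eq_Rintegral => w _; rewrite exprD.
rewrite (eq_bigr (fun=> c)) => [|i ii]; last first.
  by apply: mixed_moment; rewrite ?dax ?eqxx // eq_sym (negPf ii).
rewrite sumr_const cardC1 card_ord -[c *+ n.-1]mulr_natr.
have -> : n.-1%:R = n%:R - 1 :> R by rewrite -subn1 natrB // ltnW.
by rewrite !natrD; ring.
Qed.

End SphereMoments.

(** * The Stein identity and uniqueness of zonal expansions *)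

Section SphereFunctional.
Context (R : realType) (n : nat) (dT : measure_display) (T : measurableType dT)
  (P : probability T R) (U : {RV P >-> g_sigma_algebraType (@open 'rV[R]_n)}).
Hypothesis n2 : (2 <= n)%N.
Hypothesis hU : uniform_on_sphere U.

Local Notation E := (euclid R (Fin n)).
Local Notation S := (on_sphere U).
Local Notation X := (proj U).
Local Notation lam := (lambda_fin R n).

Let mS : measurable S := measurable_on_sphere U.

Let lam0 : 0 <= lam.
Proof. by rewrite divr_ge0 // subr_ge0 ler_nat. Qed.

Variable v : E.
Hypothesis v1 : dot v v = 1.

Let mX : measurable_fun S (X v).
Proof. exact: measurable_funTS (measurable_proj U v). Qed.

Let X1 w : S w -> `|X v w| <= 1.
Proof. by move=> Sw; apply: le_trans (proj_le v Sw) _; rewrite /enorm v1 sqrtr1. Qed.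

Definition sphere_mean (p : {poly R}) : R := \int[P]_(w in S) p.[X v w].

Local Notation L := sphere_mean.

Let integrableX k : P.-integrable S (EFin \o (fun w => X v w ^+ k)).
Proof.
apply: (@bounded_integrable _ _ _ P S mS _ 1); first exact: measurable_funX.
by move=> w Sw; rewrite normrX exprn_ile1 // X1.
Qed.

Let integrable_horner p : P.-integrable S (EFin \o (fun w => p.[X v w])).
Proof.
rewrite (_ : (fun w => _) = fun w => \sum_(i < size p) p`_i * X v w ^+ i).
  by apply: integrable_finsum => // i; exact: integrable_EFinZl.
by apply/funext => w; rewrite horner_coef.
Qed.

Lemma sphere_mean_lin a p q : L (a%:P * p + q) = a * L p + L q.
Proof.
rewrite /L -RintegralZl // -RintegralD //; last exact: integrable_EFinZl.
by apply: eq_Rintegral => w _; rewrite hornerD hornerM hornerC.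
Qed.

Lemma sphere_mean1 : L 1 = 1.
Proof.
rewrite -[RHS](moment0 hU v); apply: eq_Rintegral => w _.
by rewrite hornerC expr0.
Qed.

Lemma sphere_meanXn k : L 'X^k = moment U v k.
Proof. by apply: eq_Rintegral => w _; rewrite hornerXn. Qed.

Let L0 : L 0 = 0.
Proof. by have := sphere_mean_lin (-1) 0 0; rewrite mulr0 addr0 mulN1r addNr. Qed.

Let LZ a p : L (a%:P * p) = a * L p.
Proof. by rewrite -[_%:P * _]addr0 sphere_mean_lin L0 addr0. Qed.

(** By linearity only monomials matter. Odd moments vanish on both sides, and for X^(2m+1) the
    identity is [moment_step], because 2 lam + 1 = n - 1. *)
Lemma sphere_mean_stein p :
  L ((1 - 'X ^+ 2) * p^`()) = (2 * lam + 1) * L ('X * p).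
Proof.
have E2 : 2 * lam + 1 = n%:R - 1 by rewrite /lambda_fin; field.
have LB q r : L (q - r) = L q - L r.
  by have := sphere_mean_lin (-1) r q; rewrite polyCN polyC1 !mulN1r addrC => ->; rewrite addrC.
rewrite -[p]coefK poly_def.
elim/big_ind : _ => [|q r Hq Hr|i _].
- by rewrite deriv0 !mulr0 L0 mulr0.
- rewrite derivD !mulrDr -[_ * q^`()]mul1r -['X * q]mul1r -polyC1 !sphere_mean_lin.
  by rewrite Hq Hr; ring.
rewrite -mul_polyC derivM derivC mul0r add0r !(mulrCA _ (_%:P)) !LZ mulrCA.
congr (_ * _); rewrite -exprS sphere_meanXn derivXn.
case: (nat_of_ord i) => [|k].
  by rewrite mulr0n mulr0 L0 (moment_odd hU) // mulr0.
rewrite -mulr_natl -polyC_natr mulrCA LZ mulrBl mul1r -exprD LB !sphere_meanXn /=.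
have [ok|ek] := boolP (odd k).
  by rewrite !(moment_odd hU) ?subrr ?mulr0 //= negbK.
have [m ->] : exists m, k = (2 * m)%N by exists k./2; rewrite mul2n even_halfK.
have := moment_step n2 hU m v1; rewrite E2 addn2 addn1 natrD -[(2 * m).+1%:R]natr1.
move: (moment _ _ _) (moment _ _ _) => y x H.
transitivity (((2 * m)%:R + 1) * y - ((2 * m)%:R + 1) * x); first by ring.
by rewrite -H; ring.
Qed.

Lemma sphere_mean_zonal m k :
  \int[P]_(w in S) (zonal lam m (X v w) 1 * zonal lam k (X v w) 1) =
  L (zonal_poly lam m * zonal_poly lam k).
Proof. by apply: eq_Rintegral => w _; rewrite hornerM !horner_zonal_poly. Qed.

Let continuous_zonal k : continuous (fun t : R => zonal lam k t 1).
Proof.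
rewrite (_ : (fun t => _) = horner (zonal_poly lam k)); last first.
  by apply/funext => t; rewrite horner_zonal_poly.
exact: continuous_horner.
Qed.

(** Multiply the vanishing series at t = <v, U> by C_m and integrate. The sum of the |b_k| dominates
    the partial sums, and orthogonality leaves b_m times a positive number. *)
Lemma zonal_expansion_unique (b : nat -> R) :
  cvgn (series (fun k => `|b k|)) ->
  (forall t, `|t| <= 1 -> series (fun k => b k * zonal lam k t 1) @ \oo --> 0) ->
  forall m, b m = 0.
Proof.
move=> cb b0 m.
pose f N w := \sum_(k < N) b k * (zonal lam m (X v w) 1 * zonal lam k (X v w) 1).
have mZ k : measurable_fun S (fun w => zonal lam k (X v w) 1).
  apply: (@measurableT_comp _ _ _ _ _ _ (fun t : R => zonal lam k t 1)) => //.
  exact: continuous_measurable_fun.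
have I k : P.-integrable S (EFin \o (fun w => zonal lam m (X v w) 1 * zonal lam k (X v w) 1)).
  apply: (@bounded_integrable _ _ _ P S mS _ 1); first exact: measurable_funM.
  by move=> w Sw; rewrite normrM mulr_ile1 // zonal_le1 // X1.
have fE N : (m < N)%N ->
    \int[P]_(w in S) f N w = b m * L (zonal_poly lam m * zonal_poly lam m).
  move=> mN; rewrite Rintegral_finsum // => [|k]; last exact: integrable_EFinZl.
  rewrite (bigD1 (Ordinal mN)) //= RintegralZl // sphere_mean_zonal.
  rewrite big1 ?addr0 // => k km; rewrite RintegralZl // sphere_mean_zonal.
  suff -> : L (zonal_poly lam m * zonal_poly lam k) = 0 by rewrite mulr0.
  have orth := stein_orthogonal lam0 sphere_mean_lin sphere_mean_stein.
  move: km; rewrite -val_eqE /= neq_ltn => /orP[]; last exact: orth.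
  by rewrite mulrC; exact: orth.
have fM N w : S w -> `|f N w| <= limn (series (fun k => `|b k|)).
  move=> Sw; have nd : nondecreasing_seq (series (fun k => `|b k|)).
    by apply/nondecreasing_seqP => k; rewrite seriesSr lerDl.
  apply: le_trans (nondecreasing_cvgn_le nd cb N).
  rewrite /series /= big_mkord; apply: le_trans (ler_norm_sum _ _ _) _.
  apply: ler_sum => k _; rewrite normrM ler_piMr // normrM.
  by rewrite mulr_ile1 // zonal_le1 // X1.
have f0 w : S w -> f ^~ w @ \oo --> 0.
  move=> Sw; rewrite -(mulr0 (zonal lam m (X v w) 1)).
  rewrite (_ : f ^~ w = fun N => zonal lam m (X v w) 1 *
     series (fun k => b k * zonal lam k (X v w) 1) N).
    by apply: cvgMr; apply: b0; exact: X1.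
  apply/funext => N; rewrite /f /series /= big_mkord mulr_sumr.
  by apply: eq_bigr => k _; ring.
have mf N : measurable_fun S (f N).
  by apply: measurable_sum => k; apply: measurable_funM => //; exact: measurable_funM.
have c1 : (fun N => \int[P]_(w in S) f N w) @ \oo --> 0.
  have <- : \int[P]_(w in S) 0 = 0 :> R by rewrite Rintegral_cst // mul0r.
  exact: (@Rintegral_dct _ _ _ P S mS f (cst 0) _ mf fM f0).
have c2 : (fun N => \int[P]_(w in S) f N w) @ \oo --> b m * L (zonal_poly lam m * zonal_poly lam m).
  apply: cvg_near_cst; exists m.+1 => // N /= mN; exact: fE.
have E : b m * L (zonal_poly lam m * zonal_poly lam m) = 0.
  exact: (cvg_unique (@Rhausdorff R) c2 c1).
move/eqP: E.
rewrite mulf_eq0 => /orP[/eqP//|/eqP H].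
by have := stein_sqr_gt0 lam0 sphere_mean_lin sphere_mean1 sphere_mean_stein m; rewrite H ltxx.
Qed.

(** Up to the sign (-1)^m these are the coefficients of [besselG lam 0], which is how the cosine
    series turns into a Bessel function. *)
Lemma moment_even m :
  moment U v (2 * m) / (2 * m)`!%:R = (4 ^+ m * m`!%:R * rising lam m)^-1.
Proof.
elim: m => [|m IHm]; first by rewrite muln0 (moment0 hU) expr0 rising0 fact0 !mulr1 divr1 invr1.
have := moment_step n2 hU m v1.
have -> : (2 * m.+1 = 2 * m + 2)%N by rewrite mulnS addnC.
have L2 : n%:R = 2 * lam + 2 by rewrite /lambda_fin; field.
rewrite risingS exprS addn2 addn1 !factS !natrM -[(2 * m).+2%:R]natr1.
rewrite -[(2 * m).+1%:R]natr1 -[m.+1%:R]natr1 natrD natrM L2.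
move: (fact_gt0 (2 * m)) (fact_gt0 m) (rising_gt0 lam0 m).
rewrite -(ltr0n R) -[(0 < m`!)%N](ltr0n R).
move: IHm; move: ((2 * m)`!%:R) (m`!%:R) (rising _ _) => F f r IHm F0 f0 r0.
move: (moment U v (2 * m)) IHm => y IHm; move: (moment U v _) => x H.
have m0 := ler0n R m; have l0 := lam0.
have p0 : 2 * m%:R + (2 * lam + 2) != 0 :> R by rewrite gt_eqF //; lra.
have -> : x = (2 * m%:R + 1) * y / (2 * m%:R + (2 * lam + 2)).
  by rewrite -H mulrC mulKf.
have -> : y = F / (4 ^+ m * f * r) by rewrite -IHm mulrC divfK // gt_eqF.
field; rewrite p0 !gt_eqF ?exprn_gt0 //; lra.
Qed.

End SphereFunctional.

(** * The function Omega_d *)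

Section SphereCosine.
Context (R : realType) (n : nat) (dT : measure_display) (T : measurableType dT)
  (P : probability T R) (U : {RV P >-> g_sigma_algebraType (@open 'rV[R]_n)}).
Hypothesis n2 : (2 <= n)%N.
Hypothesis hU : uniform_on_sphere U.

Local Notation E := (euclid R (Fin n)).
Local Notation S := (on_sphere U).
Local Notation X := (proj U).
Local Notation lam := (lambda_fin R n).
Local Notation G := (besselG lam).

Let mS : measurable S := measurable_on_sphere U.

Let mX v : measurable_fun S (X v).
Proof. exact: measurable_funTS (measurable_proj U v). Qed.

Let mcosX v : measurable_fun S (fun w => cos (X v w)).
Proof.
apply: (@measurableT_comp _ _ _ _ _ _ (@cos R)) => //.
by apply: continuous_measurable_fun; exact: continuous_cos.
Qed.

Let msinX v : measurable_fun S (fun w => sin (X v w)).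
Proof.
apply: (@measurableT_comp _ _ _ _ _ _ (@sin R)) => //.
by apply: continuous_measurable_fun; exact: continuous_sin.
Qed.

Let cos_norm_le1 (x : R) : `|cos x| <= 1.
Proof. by rewrite ler_norml cos_geN1 cos_le1. Qed.

Let sin_norm_le1 (x : R) : `|sin x| <= 1.
Proof. by rewrite ler_norml sin_geN1 sin_le1. Qed.

Lemma sphere_cos_unit (v : E) (t : R) : dot v v = 1 ->
  \int[P]_(w in S) cos (t * X v w) = G 0 (t ^+ 2).
Proof.
move=> v1; pose f N w := \sum_(m < N) cos_coeff' (t * X v w) m.
have X1 w : S w -> `|X v w| <= 1.
  by move=> Sw; apply: le_trans (proj_le v Sw) _; rewrite /enorm v1 sqrtr1.
have cE w m : cos_coeff' (t * X v w) m = ((-1) ^+ m * t ^+ (2 * m) / (2 * m)`!%:R) * X v w ^+ (2 * m).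
  by rewrite /cos_coeff' -mul2n exprMn !mulrA mulrAC.
have iX m : P.-integrable S (EFin \o (fun w => X v w ^+ m)).
  apply: (@bounded_integrable _ _ _ P S mS _ 1); first exact: measurable_funX.
  by move=> w Sw; rewrite normrX exprn_ile1 // X1.
have fE N : \int[P]_(w in S) f N w = pseries (bessel_coef lam 0) (t ^+ 2) N.
  rewrite /f; under eq_Rintegral do under eq_bigr do rewrite cE.
  rewrite Rintegral_finsum // => [|m]; last exact: integrable_EFinZl.
  rewrite /pseries /series /= big_mkord; apply: eq_bigr => m _.
  rewrite RintegralZl // -/(moment U v (2 * m)) mulrAC -mulrA.
  by rewrite (moment_even n2 hU v1) /bessel_coef addn0 expr0 mulr1 -exprM [RHS]mulrAC.
(* The bound exp(t^2) comes from replacing (2m)! by m! in the cosine series. *)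
have fM N w : S w -> `|f N w| <= expR (t ^+ 2).
  move=> Sw; have nd : nondecreasing_seq (series (exp_coeff (t ^+ 2))).
    by apply/nondecreasing_seqP => k; rewrite seriesSr lerDl exp_coeff_ge0 // sqr_ge0.
  apply: le_trans (nondecreasing_cvgn_le nd (is_cvg_series_exp_coeff _) N).
  rewrite /series /= big_mkord; apply: le_trans (ler_norm_sum _ _ _) _.
  apply: ler_sum => m _; rewrite cE /exp_coeff /= normrM normf_div normrM.
  rewrite !normrX normrN1 expr1n mul1r (ger0_norm (ler0n _ _)).
  apply: (@le_trans _ _ (`|t| ^+ (2 * m) / (2 * m)`!%:R)).
    by rewrite ler_piMr ?divr_ge0 ?exprn_ge0 // exprn_ile1 // X1.
  rewrite exprM real_normK ?num_real //.
  apply: ler_wpM2l; first by rewrite exprn_ge0 ?sqr_ge0.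
  rewrite lef_pV2 ?posrE ?ltr0n ?fact_gt0 //.
  by rewrite ler_nat; apply: leq_fact; rewrite leq_pmull.
have fc w : S w -> f ^~ w @ \oo --> cos (t * X v w).
  move=> _; have := @cvg_cos_coeff' R (t * X v w).
  by rewrite /series /=; under eq_fun do rewrite big_mkord.
have mf N : measurable_fun S (f N).
  apply: measurable_sum => m; rewrite (_ : (fun w => _) = fun w =>
    ((-1) ^+ m * t ^+ (2 * m) / (2 * m)`!%:R) * X v w ^+ (2 * m)).
    by apply: measurable_funM => //; exact: measurable_funX.
  by apply/funext => w; exact: cE.
have := @Rintegral_dct _ _ _ P S mS f _ _ mf fM fc.
rewrite (_ : (fun N => _) = pseries (bessel_coef lam 0) (t ^+ 2)); last first.
  by apply/funext => N; exact: fE.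
by move=> /(cvg_lim (@Rhausdorff R)).
Qed.

Lemma sphere_cos (y : E) : \int[P]_(w in S) cos (X y w) = G 0 (enorm y ^+ 2).
Proof.
have [->|y0] := eqVneq y 0.
  rewrite enorm0 expr0n /= besselG00.
  rewrite (@eq_Rintegral _ _ _ _ _ (cst 1)) => [|w _]; last by rewrite /proj dot0l cos0.
  by rewrite Rintegral_cst // mul1r -[RHS]/(fine 1%:E); congr fine; exact: P_on_sphere.
have ny := enorm_gt0 y0.
rewrite -(@sphere_cos_unit ((enorm y)^-1 *: y)); last first.
  by rewrite dotZl dotZr -enorm_sqr; field; rewrite gt_eqF.
apply: eq_Rintegral => w _; congr cos.
by rewrite /proj dotZl mulrA mulfV ?mul1r // gt_eqF.
Qed.

Lemma sphere_sin (y : E) : \int[P]_(w in S) sin (X y w) = 0.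
Proof.
have H : \int[P]_(w in S) sin (X y w) = - \int[P]_(w in S) sin (X y w).
  rewrite {1}(@Rintegral_sphere_law _ _ _ _ _ _ hU y (- y) (@sin R) 1) //.
  - rewrite -mulN1r -RintegralZl //.
      by apply: eq_Rintegral => w _; rewrite projN sinN mulN1r.
    by apply: (@bounded_integrable _ _ _ P S mS _ 1) => // w _.
  - by rewrite -scaleN1r dotZl dotZr; ring.
  - by apply: continuous_measurable_fun; exact: continuous_sin.
move: H; move: (Rintegral _ _ _) => x H; lra.
Qed.

(** Each entry is the mean of cos <x_i - x_j, U>, and cos(a - b) = cos a cos b + sin a sin b makes
    the integrand a sum of two squares. *)
Lemma besselG_posdef (m : nat) (x : 'I_m -> E) (c : 'I_m -> R) :
  0 <= \sum_(i < m) \sum_(j < m) c i * c j * G 0 (enorm (x i - x j) ^+ 2).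
Proof.
have iC y k : P.-integrable S (EFin \o (fun w => k * cos (X y w))).
  apply: integrable_EFinZl => //.
  by apply: (@bounded_integrable _ _ _ P S mS _ 1).
have -> : \sum_(i < m) \sum_(j < m) c i * c j * G 0 (enorm (x i - x j) ^+ 2) =
    \int[P]_(w in S) \sum_(i < m) \sum_(j < m) c i * c j * cos (X (x i - x j) w).
  rewrite Rintegral_finsum //; last by move=> i; apply: integrable_finsum.
  apply: eq_bigr => i _; rewrite Rintegral_finsum //; apply: eq_bigr => j _.
  rewrite RintegralZl // ?sphere_cos //.
  by apply: (@bounded_integrable _ _ _ P S mS _ 1).
apply: Rintegral_ge0 => w _.
have -> : \sum_(i < m) \sum_(j < m) c i * c j * cos (X (x i - x j) w) =
   (\sum_(i < m) c i * cos (X (x i) w)) ^+ 2 + (\sum_(i < m) c i * sin (X (x i) w)) ^+ 2.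
  rewrite !expr2 !mulr_suml -big_split /=; apply: eq_bigr => i _.
  rewrite !mulr_sumr -big_split /=; apply: eq_bigr => j _.
  by rewrite {1}/proj dotBl cosB; rewrite /proj; ring.
by rewrite addr_ge0 ?sqr_ge0.
Qed.

End SphereCosine.

(** [is_Omega] hides a probability space, a random vector and a unit vector behind an existential;
    any choice of them leads to this function. *)
Lemma is_OmegaE (R : realType) (n : nat) (Om : R -> R[i]) : (2 <= n)%N ->
  is_Omega n Om -> forall t, Om t = (besselG (lambda_fin R n) 0 (t ^+ 2))%:C%C.
Proof.
move=> n2 [dT [T [P [U [v [hU v1 hOm]]]]]] t; rewrite hOm.
have vv : dot v v = 1 by rewrite -enorm_sqr v1 expr1n.
have e (h : R -> R) (mh : measurable_fun setT h) : (forall x, `|h x| <= 1) ->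
   fine (expectation P (fun w : T => h (t * dot v (U w : euclid R (Fin n))))) = \int[P]_(w in on_sphere U) h (proj U (t *: v) w).
  move=> h1; rewrite unlock.
  rewrite -[LHS]/(\int[P]_w h (t * dot v (U w : euclid R (Fin n)))).
  under eq_Rintegral do rewrite -dotZl.
  apply: (@Rintegral_on_sphere _ _ _ _ _ _ hU (fun w => h (proj U (t *: v) w)) 1) => //.
  exact: (measurableT_comp mh (measurable_proj U (t *: v))).
rewrite (e _ (continuous_measurable_fun (@continuous_cos R))); last first.
  by move=> x; rewrite ler_norml cos_geN1 cos_le1.
rewrite (e _ (continuous_measurable_fun (@continuous_sin R))); last first.
  by move=> x; rewrite ler_norml sin_geN1 sin_le1.
rewrite sphere_sin // sphere_cos // enormZ v1 mulr1.
by rewrite real_normK ?num_real.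
Qed.

(** * The Gamma integral for arguments at least 1 *)

Section GammaFunction.
Variable R : realType.
Implicit Types (z p t : R).

Local Notation mu := (@lebesgue_measure R).

Let powR_cvg0r p : 0 <= p -> t `^ p @[t --> 0^'+] --> (0 : R) `^ p.
Proof.
rewrite le_eqVlt => /orP[/eqP <-|p0].
  by rewrite powRr0; under eq_fun do rewrite powRr0; exact: cvg_cst.
by rewrite powR0 ?gt_eqF //; exact: powR_cvg0.
Qed.

Let powR_continuous_at p t : 0 < t -> {for t, continuous (@powR R ^~ p)}.
Proof.
move=> t0; apply/differentiable_continuous/derivable1_diffP.
by have [] := @is_derive1_powR R p t t0.
Qed.

Let powR_expR_cvg0 z : t `^ z * expR (- t) @[t --> +oo] --> (0 : R).
Proof.
pose n := (Num.truncn `|z|).+1.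
have zn : z <= n%:R.
  apply: le_trans (ler_norm _) _; rewrite /n.
  by have /andP[_ /ltW] := truncn_itv (normr_ge0 z).
(* From e^t >= t^(n+1) / (n+1)! and z <= n one gets t^z e^(-t) <= C / t for t >= 1. *)
pose C : R := n.+1`!%:R.
have inv0 : C * t^-1 @[t --> +oo] --> (0 : R).
  rewrite (_ : 0 = C * 0); last by rewrite mulr0.
  apply: cvgMr; apply/gtr0_cvgV0; last exact: cvg_id.
  by apply: nbhs_pinfty_gt; exact: num_real.
apply: (@squeeze_cvgr _ _ _ _ (cst 0) (fun t => C * t^-1)) => //; last exact: cvg_cst.
near=> t.
have t1 : 1 <= t by near: t; apply: nbhs_pinfty_ge; exact: num_real.
have t0 : 0 < t by apply: lt_le_trans t1.
rewrite mulr_ge0 ?powR_ge0 ?expR_ge0 //= expRN ler_pdivrMr ?expR_gt0 //.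
apply: (@le_trans _ _ (t ^+ n)); first by rewrite -powR_mulrn ?(ltW t0) // ler_powR.
rewrite -mulrA -ler_pdivrMl ?ltr0n ?fact_gt0 // -ler_pdivrMl ?invr_gt0 // invrK.
rewrite mulrCA -exprS mulrC; apply: le_trans (expR_ge1Dxn n (ltW t0)).
by rewrite lerDr.
Unshelve. all: by end_near. Qed.

Let gamma_integrand z t : R := t `^ (z - 1) * expR (- t).

(** Extended-real valued, so that the recursion can be proved for nonnegative integrands before
    finiteness is known; finiteness is then deduced from the recursion at integers. *)
Definition gamma_integral z : \bar R := (\int[mu]_(t in `]0%R, +oo[) (gamma_integrand z t)%:E)%E.

Let measurable_gamma z (D : set R) : measurable_fun D (gamma_integrand z).
Proof.
apply: measurable_funTS; apply: measurable_funM; first exact: measurable_powR.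
apply: continuous_measurable_fun => x; apply: continuous_comp; [exact: opp_continuous|exact: continuous_expR].
Qed.

Let integral_expRN (a : R) :
  (\int[mu]_(t in `[a, +oo[) (expR (- t))%:E = (expR (- a))%:E)%E.
Proof.
have d (x : R) : is_derive x 1 (fun t : R => - expR (- t)) (expR (- x)).
  by apply: is_derive_eq; rewrite /GRing.scale /=; ring.
have c (x : R) : {for x, continuous (fun t : R => - expR (- t))}.
  by apply/differentiable_continuous/derivable1_diffP; case: (d x).
rewrite (@ge0_continuous_FTC2y _ _ (fun t => - expR (- t)) _ 0).
- by rewrite -EFinB sub0r opprK.
- by move=> x _; rewrite expR_ge0.
- apply: continuous_subspaceT => x; apply: continuous_comp; [exact: opp_continuous|exact: continuous_expR].
- by rewrite -oppr0; apply: cvgN; exact: cvgr_expR.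
- by move=> x _; case: (d x).
- by apply: cvg_at_right_filter; exact: c.
- by move=> x _; rewrite derive1E; apply: derive_val; exact: d.
Qed.

Lemma gamma_integral1 : gamma_integral 1 = 1%E.
Proof.
rewrite /gamma_integral (_ : (fun t => _) = fun t => (expR (- t))%:E); last first.
  by apply/funext => t; rewrite /gamma_integrand subrr powRr0 mul1r.
rewrite integral_itv_obnd_cbnd; first by rewrite integral_expRN oppr0 expR0.
apply/measurable_EFinP; have := @measurable_gamma 1 `]0, +oo[.
by congr measurable_fun; apply/funext => t; rewrite /gamma_integrand subrr powRr0 mul1r.
Qed.

(* The constant [C] makes the derivative of [- (t ^ z + C) e ^ - t] nonnegative. *)
Lemma gamma_integralS z : 1 <= z ->
  gamma_integral (z + 1) = (z%:E * gamma_integral z)%E.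
Proof.
move=> z1; have z0 : 0 < z by apply: lt_le_trans z1.
have zm1 : 0 <= z - 1 by rewrite subr_ge0.
pose C := z * z `^ (z - 1); have C0 : 0 <= C by rewrite mulr_ge0 ?powR_ge0 // ltW.
pose h t := (t `^ z - z * t `^ (z - 1) + C) * expR (- t).
have h0 t : 0 <= t -> 0 <= h t.
  move=> t0; rewrite mulr_ge0 ?expR_ge0 //.
  (* For t <= z the term z t^(z-1) is at most [C]; for t > z it is at most t t^(z-1) = t^z. *)
  have [tz|zt] := leP t z.
    rewrite addrAC -addrA addr_ge0 ?powR_ge0 // subr_ge0 /C ler_pM2l //.
    by rewrite ge0_ler_powR // nnegrE ltW.
  rewrite addr_ge0 // subr_ge0 -(mulr_powRB1 t0 z0).
  by rewrite ler_wpM2r ?powR_ge0 // ltW.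
pose F t := - ((t `^ z + C) * expR (- t)).
have dF t : 0 < t -> is_derive t 1 F (h t).
  move=> t0; have dp := @is_derive1_powR R z t t0.
  have de : is_derive t 1 (fun t : R => expR (- t)) (- expR (- t)).
    by apply: is_derive_eq; rewrite /GRing.scale /=; ring.
  have dC : is_derive t 1 (fun t : R => t `^ z + C) (z * t `^ (z - 1)).
    exact: (is_derive_eq (is_deriveD dp (is_derive_cst C t 1)) (addr0 _)).
  apply: (is_derive_eq (is_deriveN (is_deriveM dC de))).
  by rewrite /h /GRing.scale /=; ring.
have cN (x : R) : {for x, continuous (fun t : R => expR (- t))}.
  by apply: continuous_comp; [exact: opp_continuous|exact: continuous_expR].
have mh : measurable_fun (`]0%R, +oo[ : set R) (EFin \o h).
  apply/measurable_EFinP/measurable_funTS; apply: measurable_funM; last exact: continuous_measurable_fun.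
  apply: measurable_funD => //; apply: measurable_funB; first exact: measurable_powR.
  by apply: measurable_funM => //; exact: measurable_powR.
have hI : (\int[mu]_(t in `]0%R, +oo[) (h t)%:E = C%:E)%E.
  rewrite integral_itv_obnd_cbnd; last exact: mh.
  rewrite (@ge0_continuous_FTC2y _ _ F _ 0).
  - have -> : F 0 = - C by rewrite /F powR0 ?gt_eqF // add0r oppr0 expR0 mulr1.
    by rewrite -EFinB sub0r opprK.
  - exact: h0.
  - apply/continuous_within_itvcyP; split.
      move=> t; rewrite in_itv /= andbT => t0.
      apply: cvgM; last exact: cN.
      apply: cvgD; last exact: cvg_cst.
      apply: cvgB; first exact: powR_continuous_at.
      by apply: cvgMr; exact: powR_continuous_at.
    apply: cvgM; last by apply: cvg_at_right_filter; exact: cN.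
    apply: cvgD; last exact: cvg_cst.
    apply: cvgB; first by apply: powR_cvg0r; exact: ltW.
    by apply: cvgMr; exact: powR_cvg0r.
  - rewrite -oppr0; apply: cvgN; rewrite (_ : 0 = 0 + C * 0); last by rewrite mulr0 addr0.
    under eq_fun do rewrite mulrDl.
    by apply: cvgD; [exact: powR_expR_cvg0|apply: cvgMr; exact: cvgr_expR].
  - by move=> t t0; case: (dF t t0).
  - apply: cvgN; apply: cvgM; last by apply: cvg_at_right_filter; exact: cN.
    apply: cvgD; last exact: cvg_cst.
    by apply: powR_cvg0r; exact: ltW.
  - move=> t; rewrite in_itv /= andbT => t0.
    by rewrite derive1E; apply: derive_val; exact: dF.
have CI : (\int[mu]_(t in `]0%R, +oo[) (C * expR (- t))%:E = C%:E)%E.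
  rewrite (_ : (fun t => _) = fun t => (C%:E * (gamma_integrand 1 t)%:E)%E); last first.
    by apply/funext => t; rewrite /gamma_integrand subrr powRr0 mul1r EFinM.
  rewrite ge0_integralZl //; first by rewrite -/(gamma_integral 1) gamma_integral1 mule1.
  - by apply/measurable_EFinP; exact: measurable_gamma.
  - by move=> t _; rewrite lee_fin mulr_ge0 ?powR_ge0 ?expR_ge0.
have mD : measurable (`]0%R, +oo[ : set R) by [].
have g0 y x : (0 <= (gamma_integrand y x)%:E)%E.
  by rewrite lee_fin mulr_ge0 ?powR_ge0 ?expR_ge0.
have mg y : measurable_fun (`]0%R, +oo[ : set R) (EFin \o gamma_integrand y).
  by apply/measurable_EFinP; exact: measurable_gamma.
have e0 x : (0 <= (C * expR (- x))%:E)%E by rewrite lee_fin mulr_ge0 ?expR_ge0.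
have me : measurable_fun (`]0%R, +oo[ : set R) (EFin \o (fun t => C * expR (- t))).
  apply/measurable_EFinP/measurable_funM => //.
  by apply: measurable_funTS; exact: continuous_measurable_fun.
have z0g x : (0 <= z%:E * (gamma_integrand z x)%:E)%E by rewrite mule_ge0 // lee_fin ltW.
have mzg : measurable_fun (`]0%R, +oo[ : set R) (fun t => z%:E * (gamma_integrand z t)%:E)%E.
  by apply/measurable_EFinP; apply: measurable_funM => //; exact: measurable_gamma.
have E1 := ge0_integralD mu mD (fun x _ => g0 (z + 1) x) (mg (z + 1)) (fun x _ => e0 x) me.
have E2 : (\int[mu]_(t in `]0%R, +oo[) ((h t)%:E + z%:E * (gamma_integrand z t)%:E) =
   C%:E + z%:E * gamma_integral z)%E.
  rewrite ge0_integralD //; last by move=> t; rewrite /= in_itv /= andbT lee_fin => t0; apply: h0; exact: ltW.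
  rewrite hI ge0_integralZl //; [exact: mg|rewrite lee_fin; exact: ltW].
(* Pointwise, t^z e^(-t) + C e^(-t) = h(t) + z t^(z-1) e^(-t) with nonnegative terms. After
   integration only the finite [C] is cancelled. *)
have : (gamma_integral (z + 1) + C%:E = C%:E + z%:E * gamma_integral z)%E.
  rewrite -E2 -{1}CI -E1; apply: eq_integral => t; rewrite inE /= in_itv /= andbT => t0.
  rewrite -EFinM -!EFinD /gamma_integrand /h addrK; congr (_%:E); ring.
by rewrite [X in _ = X]addeC => /(congr1 (fun x => x - C%:E)%E); rewrite !addeK.
Qed.

Lemma gamma_integral_nat n : gamma_integral n.+1%:R = (n`!%:R)%:E.
Proof.
elim: n => [|n IHn]; first exact: gamma_integral1.
by rewrite -natr1 gamma_integralS ?ler1n // IHn -EFinM -natrM -factS.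
Qed.

(** For an integer n >= z - 1 the power t^(z-1) is at most 1 + t^n, so two Gamma integrals at
    integers dominate. *)
Lemma gamma_integral_fin z : 1 <= z -> gamma_integral z \is a fin_num.
Proof.
move=> z1; pose n := (Num.truncn `|z|).+1.
have zn : z - 1 <= n%:R.
  rewrite lerBlDr; apply: le_trans (ler_norm _) _; rewrite /n natr1.
  have /andP[_ /ltW/le_trans] := truncn_itv (normr_ge0 z); apply.
  by rewrite ler_nat.
have mD : measurable (`]0%R, +oo[ : set R) by [].
have g0 y x : (0 <= (gamma_integrand y x)%:E)%E.
  by rewrite lee_fin mulr_ge0 ?powR_ge0 ?expR_ge0.
have mg y : measurable_fun (`]0%R, +oo[ : set R) (EFin \o gamma_integrand y).
  by apply/measurable_EFinP; exact: measurable_gamma.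
rewrite ge0_fin_numE; last by apply: integral_ge0 => t _; exact: g0.
apply: (@le_lt_trans _ _ (gamma_integral 1 + gamma_integral n.+1%:R)%E); last first.
  by rewrite gamma_integral1 gamma_integral_nat -EFinD ltry.
rewrite /gamma_integral -ge0_integralD //; [|exact: mg|exact: mg].
apply: ge0_le_integral => //; [exact: mg|by apply: emeasurable_funD; exact: mg|].
move=> t; rewrite /= in_itv /= andbT => t0.
rewrite -EFinD lee_fin /gamma_integrand subrr powRr0 -mulrDl.
rewrite ler_wpM2r ?expR_ge0 // -natr1 addrK.
have [t1|t1] := leP t 1.
  rewrite -[leLHS]addr0 lerD ?powR_ge0 //.
  apply: (@le_trans _ _ (1 `^ (z - 1))); last by rewrite powR1.
  by apply: ge0_ler_powR; rewrite ?nnegrE ?subr_ge0 // ltW.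
by rewrite -[leLHS]add0r lerD // ler_powR // ltW.
Qed.

Lemma gamma_integral_gt0 z : 1 <= z -> (0 < gamma_integral z)%E.
Proof.
move=> z1; apply: (@lt_le_trans _ _ (\int[mu]_(t in `[1%R, +oo[) (expR (- t))%:E)%E).
  by rewrite integral_expRN lte_fin expR_gt0.
have m1 : measurable_fun (`[1%R, +oo[ : set R) (EFin \o (fun t => expR (- t))).
  apply/measurable_EFinP; apply: measurable_funTS; apply: continuous_measurable_fun => x.
  by apply: continuous_comp; [exact: opp_continuous|exact: continuous_expR].
have mg (D : set R) : measurable_fun D (EFin \o gamma_integrand z).
  by apply/measurable_EFinP; exact: measurable_gamma.
have g0 x : (0 <= (gamma_integrand z x)%:E)%E.
  by rewrite lee_fin mulr_ge0 ?powR_ge0 ?expR_ge0.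
apply: (@le_trans _ _ (\int[mu]_(t in `[1%R, +oo[) (gamma_integrand z t)%:E)%E).
  apply: ge0_le_integral => //; first exact: mg.
  move=> t; rewrite /= in_itv /= andbT => t1; rewrite lee_fin ler_peMl ?expR_ge0 //.
  by rewrite -[X in X <= _](powRr0 t) ler_powR // subr_ge0.
apply: ge0_subset_integral => //; first exact: mg.
by move=> t; rewrite /= !in_itv /= !andbT; apply: lt_le_trans.
Qed.

Lemma GammaE z : Gamma z = fine (gamma_integral z).
Proof. by []. Qed.

Lemma Gamma_gt0 z : 1 <= z -> 0 < Gamma z.
Proof.
move=> z1; rewrite GammaE; apply: fine_gt0; rewrite gamma_integral_gt0 //=.
by rewrite -ge0_fin_numE ?gamma_integral_fin // ltW // gamma_integral_gt0.
Qed.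

Lemma GammaS z : 1 <= z -> Gamma (z + 1) = z * Gamma z.
Proof.
by move=> z1; rewrite !GammaE gamma_integralS // fineM // gamma_integral_fin.
Qed.

Lemma Gamma_rising (lam : R) n : 0 <= lam ->
  Gamma (n%:R + lam + 1) = rising lam n * Gamma (lam + 1).
Proof.
move=> l0; elim: n => [|n IHn]; first by rewrite add0r rising0 mul1r.
have n0 := ler0n R n.
rewrite risingS -natr1 (_ : n%:R + 1 + lam + 1 = (n%:R + lam + 1) + 1); last by ring.
rewrite (@GammaS (n%:R + lam + 1)); last by lra.
by rewrite IHn; ring.
Qed.

End GammaFunction.

(** * Bessel functions of the statement in terms of the entire series *)

Section BesselQuotient.
Variables (R : realType) (lam : R).
Hypothesis lam0 : 0 <= lam.

Lemma besselg_continuous n : continuous (besselg lam n).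
Proof.
move=> t; apply/differentiable_continuous/derivable1_diffP.
case: n => [|n]; first by case: (is_derive_besselg0 lam0 t).
by case: (is_derive_besselgS lam0 n t).
Qed.

Let norm_cst : R := (2 `^ lam * Gamma (lam + 1))^-1.

Let Gamma1_gt0 : 0 < Gamma (lam + 1).
Proof. by rewrite Gamma_gt0 // lerDr. Qed.

(** All the denominators share Gamma(lam + 1), which [Gamma_rising] extracts; the powers of t / 2
    split into t^lam, t^n and a power of t^2. *)
Lemma besselJE n (t : R) : 0 < t ->
  besselJ (n%:R + lam) t = t `^ lam * (norm_cst * besselg lam n t).
Proof.
move=> t0; rewrite /besselJ.
have t2 : 0 < t / 2 by rewrite divr_gt0.
rewrite (_ : (fun m => _) = (t `^ lam * norm_cst * t ^+ n) *:
    (fun m => bessel_coef lam n m * (t ^+ 2) ^+ m)).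
  rewrite lim_seriesZ; last exact: is_cvg_besselG.
  by rewrite /besselg /GRing.scale /= /besselG /pseries; ring.
apply/funext => m; rewrite -[RHS]/(_ * (_ * _)).
rewrite addrA -natrD Gamma_rising //.
rewrite (addrA (2 * m)%:R) -natrD powRD; last by rewrite (gt_eqF t2) implybT.
rewrite powR_mulrn ?ltW // exprD exprM.
have -> : t `^ lam = (t / 2) `^ lam * 2 `^ lam.
  by rewrite -powRM ?(ltW t2) // divfK.
rewrite /bessel_coef /norm_cst !exprMn !exprVn.
have p2 : 0 < (2 : R) `^ lam by rewrite powR_gt0.
have r0 := rising_gt0 lam0 (m + n).
have f0 : m`!%:R != 0 :> R by rewrite pnatr_eq0 -lt0n fact_gt0.
have -> : 4 ^+ m = 2 ^+ m * 2 ^+ m :> R by rewrite -exprMn -natrM.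
have u0 : 2 ^+ m != 0 :> R by rewrite expf_neq0.
have v0 : 2 ^+ n != 0 :> R by rewrite expf_neq0.
move: (2 ^+ m) u0 (2 ^+ n) v0 => u u0 v v0.
move: (rising lam _) r0 (Gamma _) Gamma1_gt0 => r r0 G G0.
move: (t ^+ m) (t ^+ n) ((t / 2) `^ lam) => a b c.
by field; rewrite ?f0 ?u0 ?v0 !gt_eqF.
Qed.

Lemma bessel_quotientE n (t : R) : 0 <= t ->
  bessel_quotient (n%:R + lam) lam t = norm_cst * besselg lam n t.
Proof.
rewrite le_eqVlt => /orP[/eqP <-|t0]; rewrite /bessel_quotient ?eqxx; last first.
  by rewrite gt_eqF // besselJE // [LHS]mulrC mulKf // gt_eqF // powR_gt0.
apply: cvg_lim => //.
have : norm_cst * besselg lam n u @[u --> 0^'+] --> norm_cst * besselg lam n 0.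
  by apply: cvgMr; apply: cvg_at_right_filter; exact: besselg_continuous.
apply: cvg_trans; apply: near_eq_cvg; near=> u.
have u0 : 0 < u by [].
by rewrite besselJE // [RHS]mulrC mulKf // gt_eqF // powR_gt0.
Unshelve. all: by end_near. Qed.

End BesselQuotient.

(** * Dimensions of spherical harmonics and the functions phi_n *)

Section Phi.
Variable R : realType.

Lemma lambda_fin_ge0 k : (2 <= k)%N -> 0 <= lambda_fin R k.
Proof. by move=> k2; rewrite divr_ge0 // subr_ge0 ler_nat. Qed.

Let ladder_bin k m : (3 <= k)%N -> ladder (lambda_fin R k) m = 'C(m + (k - 2), m)%:R.
Proof.
move=> k3; elim: m => [|m IHm]; first by rewrite /ladder big_ord0 bin0.
rewrite ladderS IHm.
have m1 : m%:R + 1 != 0 :> R by rewrite natr1 pnatr_eq0.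
apply: (mulfI m1); rewrite [in RHS]natr1 -natrM -mul_bin_diag addSn /= natrM.
have -> : (m + (k - 2)).+1%:R = m%:R + 1 + 2 * lambda_fin R k.
  by rewrite -natr1 natrD natrB ?(ltnW k3) // /lambda_fin; field.
by field.
Qed.

(** [harm_dim] is uniform in lam, whereas [dim_harmonics] divides by lam and so treats k = 2 apart.
    For k >= 3 and n = m + 1, the identity (m + 1) C(m+k-2, m+1) = (k - 2) C(m+k-2, m) links the two
    binomials. *)
Lemma dim_harmonicsE k n : (2 <= k)%N -> dim_harmonics R k n = harm_dim (lambda_fin R k) n.
Proof.
move=> k2; rewrite /dim_harmonics; have [->|k2'] := eqVneq k 2%N.
  case: n => [//|n] /=; have n1 : n%:R + 1 != 0 :> R by rewrite natr1 pnatr_eq0.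
  rewrite /lambda_fin subrr mul0r addr0 /ladder big1 => [|i _].
    by rewrite mul1r mulfK.
  by rewrite mulr0 addr0 divff // natr1 pnatr_eq0.
have k3 : (3 <= k)%N by rewrite ltn_neqAle eq_sym k2'.
have l0 : 0 < lambda_fin R k by rewrite divr_gt0 // subr_gt0 ltr_nat.
case: n => [|m]; first by rewrite bin0 add0r divff ?mulr1 // gt_eqF.
rewrite /= ladder_bin //.
have -> : (m.+1 + k - 3 = m + (k - 2))%N.
  move: k3; case: (k) => [|[|[|j]]] // _.
  by rewrite !addnS !subSS !subn0 ?addnS ?addSn.
have m1 : m%:R + 1 != 0 :> R by rewrite natr1 pnatr_eq0.
apply: (mulfI m1).
have /(congr1 (fun i => i%:R : R)) := mul_bin_left (m + (k - 2)) m.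
rewrite addKn !natrM natrB ?(ltnW k3) // -[m.+1%:R]natr1.
move: ('C(m + (k - 2), m.+1)%:R) => u; move: ('C(m + (k - 2), m)%:R) => v H.
have {}H : (m%:R + 1) * u = 2 * lambda_fin R k * v by rewrite H /lambda_fin; field.
transitivity ((m%:R + 1 + lambda_fin R k) / lambda_fin R k * ((m%:R + 1) * u)); first by ring.
by rewrite H; field; rewrite m1 gt_eqF.
Qed.

Lemma phi_finE k n (t : R) : (2 <= k)%N -> 0 <= t ->
  phi (Fin k) n t = Num.sqrt (harm_dim (lambda_fin R k) n) * besselg (lambda_fin R k) n t.
Proof.
move=> k2 t0; have l0 := lambda_fin_ge0 k2.
rewrite /phi dim_harmonicsE // bessel_quotientE //.
have -> : k%:R / 2 = lambda_fin R k + 1 by rewrite /lambda_fin; field.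
have p : 2 `^ lambda_fin R k * Gamma (lambda_fin R k + 1) != 0 :> R.
  by rewrite mulf_neq0 // gt_eqF ?powR_gt0 // Gamma_gt0 // lerDr.
rewrite [_ * Num.sqrt _]mulrC -!mulrA; congr (_ * _).
by rewrite mulrA mulrA mulfV // mul1r.
Qed.

End Phi.

(** * Gegenbauer polynomials from their generating function *)

Section Gegenbauer.
Variable R : realType.

Section GeneratingFunction.
Variables (l t : R).
Hypothesis l0 : 0 < l.
Hypothesis t1 : `|t| <= 1.

Let f (z : R) : R := (1 - 2 * t * z + z ^+ 2) `^ (- l).
Let q (z : R) : R := 1 - 2 * t * z + z ^+ 2.
Let D (n : nat) : R -> R := derive1n n f.
Let I (z : R) := z \in `]-1, 1[.

Let q_gt0 z : I z -> 0 < q z.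
Proof.
rewrite /I in_itv /= => /andP[z1 z2]; move: t1; rewrite ler_norml => /andP[ta tb].
(* A convex combination of (1 - z)^2 and (1 + z)^2; the sign of [t] tells which weight is certainly
   positive. *)
have -> : q z = (1 - z) ^+ 2 * (1 + t) / 2 + (1 + z) ^+ 2 * (1 - t) / 2 by rewrite /q; field.
have [tn|tp] := leP t 0.
  apply: ltr_pwDr; last by rewrite !mulr_ge0 ?sqr_ge0 // ?invr_ge0 //; lra.
  by rewrite !mulr_gt0 ?exprn_gt0 ?invr_gt0 //; lra.
apply: ltr_pwDl; last by rewrite !mulr_ge0 ?sqr_ge0 // ?invr_ge0 //; lra.
by rewrite !mulr_gt0 ?exprn_gt0 ?invr_gt0 //; lra.
Qed.

Let is_derive_q (z : R) : is_derive z 1 q (2 * (z - t)).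
Proof. by rewrite /q; apply: is_derive_eq; rewrite /GRing.scale /= ?mulr1; ring. Qed.

Let is_derive_q' (z : R) : is_derive z 1 (fun z => 2 * (z - t)) 2.
Proof. by apply: is_derive_eq; rewrite /GRing.scale /= ?mulr1; ring. Qed.

Let near_I z : I z -> \near z, I z.
Proof. exact: near_in_itvoo. Qed.

Let is_derive_D n z : derivable (D n) z 1 -> is_derive z 1 (D n) (D n.+1 z).
Proof. by move=> dD; apply: DeriveDef => //; rewrite /D derive1nS derive1E. Qed.

(* [n]-fold differentiation of [q f' + l q' f = 0]. *)
Let gen_fun_rel n :
  (forall k z, (k <= n)%N -> I z -> derivable (D k) z 1) /\
  (forall z, I z -> q z * D n.+1 z + (n%:R + l) * (2 * (z - t) * D n z) +
    n%:R * (n%:R - 1 + 2 * l) * D n.-1 z = 0).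
Proof.
elim: n => [|n [dD rel]].
  have d z : I z -> is_derive z 1 f (- l * q z `^ (- l - 1) * (2 * (z - t))).
    move=> Iz; have dp := @is_derive1_powR R (- l) (q z) (q_gt0 Iz).
    apply: (is_derive_eq (@is_derive1_comp _ (@powR R ^~ (- l)) q _ _ _ dp (is_derive_q z))).
    by [].
  split=> [[|//] z _ Iz|z Iz]; first by case: (d z Iz).
  have -> : D 1 z = - l * q z `^ (- l - 1) * (2 * (z - t)).
    by rewrite /D derive1n1 derive1E; apply: derive_val; exact: d.
  have qz := q_gt0 Iz.
  have -> : D 0 z = q z * q z `^ (- l - 1).
    rewrite /D /= -[f z]/(q z `^ (- l)) -[X in X * _](powRr1 (ltW qz)) -powRD; last by rewrite (gt_eqF qz) /= implybT.
    by congr (_ `^ _); ring.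
  by ring.
have dS z : I z -> derivable (D n.+1) z 1.
  move=> Iz.
  (* The relation at n, solved for [D n.+1], shows this function near z as a quotient of functions
     already known to be derivable. This is why derivability is part of the induction. *)
  pose g z := - ((n%:R + l) * (2 * (z - t) * D n z) + n%:R * (n%:R - 1 + 2 * l) * D n.-1 z) * (q z)^-1.
  apply: (@near_eq_derivable _ _ _ g).
    have := near_I Iz; apply: filterS => y Iy; have qy := q_gt0 Iy.
    apply: (mulfI (lt0r_neq0 qy)); rewrite /g mulrCA divff ?gt_eqF // mulr1.
    by have /eqP := rel y Iy; rewrite -addrA addr_eq0 => /eqP ->.
  apply: derivableM.
    apply: derivableN; apply: derivableD.
      apply: derivableM; first exact: derivable_cst.
      apply: derivableM; first by case: (is_derive_q' z).
      exact: dD.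
    apply: derivableM; first exact: derivable_cst.
    by apply: dD => //; exact: leq_pred.
  apply: derivableV; first by rewrite gt_eqF // q_gt0.
  by case: (is_derive_q z).
have dD' k z : (k <= n.+1)%N -> I z -> derivable (D k) z 1.
  by rewrite leq_eqVlt => /orP[/eqP ->|]; [exact: dS|exact: dD].
split=> // z Iz.
have d0 := is_derive_D (dD' n.-1 z (leq_trans (leq_pred n) (leqnSn n)) Iz).
have d1 := is_derive_D (dD' n z (leqnSn n) Iz).
have d2 := is_derive_D (dD' n.+1 z (leqnn _) Iz).
have dq := is_derive_q z; have dq' := is_derive_q' z.
have {dq dq'} dE (u v w : R -> R) (u' v' w' k m : R) : is_derive z 1 u u' ->
    is_derive z 1 v v' -> is_derive z 1 w w' ->
    is_derive z 1 (fun y => q y * u y + k * (2 * (y - t) * v y) + m * w y)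
      (2 * (z - t) * u z + q z * u' + k * (2 * v z + 2 * (z - t) * v') + m * w').
  move=> du dv dw; have := is_deriveD (is_deriveD (is_deriveM dq du)
     (is_deriveM (is_derive_cst k z 1) (is_deriveM dq' dv)))
     (is_deriveM (is_derive_cst m z 1) dw).
  by move=> H; apply: (is_derive_eq H); rewrite /GRing.scale /=; ring.
have {}dE := dE _ _ _ _ _ _ (n%:R + l) (n%:R * (n%:R - 1 + 2 * l)) d2 d1 d0.
have dZ : is_derive z 1 (fun y => q y * D n.+1 y + (n%:R + l) * (2 * (y - t) * D n y) +
    n%:R * (n%:R - 1 + 2 * l) * D n.-1 y) 0.
  apply: near_eq_is_derive (is_derive_cst (0 : R) z 1).
  by have := near_I Iz; apply: filterS => y Iy; rewrite rel.
have := @derive_val _ _ _ _ _ _ _ dE.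
rewrite (@derive_val _ _ _ _ _ _ _ dZ) => E.
(* The truncated predecessor is wrong only at n = 0, where the factor n vanishes. *)
have Dn : n%:R * D n.-1.+1 z = n%:R * D n z by case: (n) => [|m] //; rewrite !mul0r.
rewrite -[n.+1%:R]natr1.
move: Dn E; move: (D n.-1.+1 z) (D n z) (D n.+1 z) (D n.+2 z) (q z) => a b c d e Dn E.
transitivity (2 * (z - t) * c + e * d + (n%:R + l) * (2 * b + 2 * (z - t) * c) +
  (n%:R * b) * (n%:R - 1 + 2 * l)); first by ring.
by rewrite -Dn [RHS]E; ring.
Qed.

(** At z = 0, where q = 1, the differentiated relation is the recursion of [zonal] up to the factor
    (2 l)_n; that factor over n! is the value at t = 1. *)
Lemma gegenbauerE n : gegenbauer l n t =
  (\prod_(i < n) (i%:R + 2 * l)) / n`!%:R * zonal l n t 1.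
Proof.
pose B n : R := \prod_(i < n) (i%:R + 2 * l).
have BS k : B k.+1 = B k * (k%:R + 2 * l) by rewrite /B big_ord_recr.
have I0 : I 0 by rewrite /I in_itv /=; apply/andP; split; lra.
have q0 : q 0 = 1 by rewrite /q mulr0 subr0 expr0n addr0.
have rel k : D k.+1 0 = 2 * (k%:R + l) * t * D k 0 - k%:R * (k%:R - 1 + 2 * l) * D k.-1 0.
  have [_ /(_ 0 I0)] := gen_fun_rel k; rewrite q0 mul1r sub0r.
  by move: (D k.+1 0) (D k 0) (D k.-1 0) => a b c H; apply/eqP; rewrite -subr_eq0 -H; apply/eqP; ring.
have D00 : D 0 0 = 1 by rewrite /D /= /f mulr0 subr0 expr0n addr0 powR1.
suff H : D n 0 = B n * zonal l n t 1 /\ D n.+1 0 = B n.+1 * zonal l n.+1 t 1.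
  by rewrite /gegenbauer -/f -/(D n 0) H.1 mulrAC.
elim: n => [|n [IHn IHS]].
  by rewrite rel D00 zonal0 zonal1 BS /B big_ord0; split; ring.
split=> //; rewrite rel IHS [n.+1.-1]/= IHn [B n.+2]BS -!mulrA.
have E := zonalSS (ltW l0) n t 1.
rewrite -[n.+1%:R]natr1 E !BS.
by move: (B n) (zonal l n.+1 t 1) (zonal l n t 1) => b x y; ring.
Qed.

End GeneratingFunction.

(** For lam = 0 the recursion is the addition formula of the cosine. For lam > 0 the factor (2
    lam)_n / n! is nonzero and cancels in the quotient. *)
Lemma gegenbauer_hatE (lam : R) n t : 0 <= lam -> `|t| <= 1 ->
  gegenbauer_hat lam%:E n t = zonal lam n t 1.
Proof.
move=> l0 t1; rewrite /gegenbauer_hat; have [->|ln] := eqVneq lam 0.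
  suff H : cos (n%:R * acos t) = zonal 0 n t 1 /\
    cos (n.+1%:R * acos t) = zonal 0 n.+1 t 1 by case: H.
  have ct : cos (acos t) = t by rewrite acosK // in_itv /= -ler_norml.
  elim: n => [|n [IHn IHS]].
    by rewrite mul0r cos0 mul1r ct zonal0 zonal1.
  split=> //; apply: (mulfI (lt0r_neq0 (zonal_den_gt0 (lexx 0) n))).
  rewrite zonalSS // -IHn -IHS.
  have -> : cos (n.+2%:R * acos t) = 2 * t * cos (n.+1%:R * acos t) - cos (n%:R * acos t).
    rewrite -[X in _ * X * _]ct; move: (acos t) => x.
    have -> : n.+2%:R * x = n.+1%:R * x + x by rewrite -[n.+2%:R]natr1; ring.
    have -> : n%:R * x = n.+1%:R * x - x by rewrite -[n.+1%:R]natr1; ring.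
    by rewrite cosB cosD; ring.
  by move: (cos _) (cos _) => x y; ring.
have lp : 0 < lam by rewrite lt_neqAle eq_sym ln.
rewrite (gegenbauerE lp t1) (gegenbauerE lp (_ : `|1| <= 1)) ?normr1 // zonal11 // mulr1.
rewrite mulrAC mulfV ?mul1r // mulf_neq0 ?invr_eq0 ?pnatr_eq0 -?lt0n ?fact_gt0 //.
by rewrite gt_eqF // prodr_gt0 // => i _; rewrite ltr_wpDl // mulr_gt0.
Qed.

End Gegenbauer.

(** * Limits of real and imaginary parts *)

Section ComplexLimits.
Variable R : realType.
Implicit Types z : R[i].

Lemma normc_ge_Im z : `|complex.Im z|%:C%C <= `|z|.
Proof.
by case: z => a b; rewrite normc_def /= lecR -sqrtr_sqr ler_wsqrtr // lerDr sqr_ge0.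
Qed.

Lemma norm_real_complex (x : R) : `|x%:C%C| = `|x|%:C%C.
Proof. by rewrite normc_def /= expr0n addr0 sqrtr_sqr. Qed.

Lemma real_complex_cvg (T : Type) (F : set_system T) {FF : Filter F} (f : T -> R) (l : R) :
  f @ F --> l -> (fun x => (f x)%:C%C : R[i]^o) @ F --> (l%:C%C : R[i]^o).
Proof.
move=> /cvgrPdist_lt fl; apply/cvgrPdist_lt => -[e1 e2]; rewrite ltcE /= => /andP[/eqP -> e0].
apply: filterS (fl _ e0) => x lx.
by rewrite -[X in `|X|]/(l%:C%C - (f x)%:C%C) -rmorphB norm_real_complex ltcR.
Qed.

Lemma Re_cvg (T : Type) (F : set_system T) {FF : Filter F} (f : T -> R[i]) (l : R[i]) :
  (f : T -> R[i]^o) @ F --> (l : R[i]^o) -> (fun x => complex.Re (f x)) @ F --> complex.Re l.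
Proof.
move=> /cvgrPdist_lt fl; apply/cvgrPdist_lt => e e0.
have e0' : 0 < (e%:C%C : R[i]) by rewrite ltcR.
apply: filterS (fl _ e0') => x /= H; rewrite -ltcR; apply: le_lt_trans H.
by move: (l) (f x) => [a b] [a' b']; exact: (normc_ge_Re ((a +i* b)%C - (a' +i* b')%C)).
Qed.

Lemma Im_cvg (T : Type) (F : set_system T) {FF : Filter F} (f : T -> R[i]) (l : R[i]) :
  (f : T -> R[i]^o) @ F --> (l : R[i]^o) -> (fun x => complex.Im (f x)) @ F --> complex.Im l.
Proof.
move=> /cvgrPdist_lt fl; apply/cvgrPdist_lt => e e0.
have e0' : 0 < (e%:C%C : R[i]) by rewrite ltcR.
apply: filterS (fl _ e0') => x /= H; rewrite -ltcR; apply: le_lt_trans H.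
by move: (l) (f x) => [a b] [a' b']; exact: (normc_ge_Im ((a +i* b)%C - (a' +i* b')%C)).
Qed.

End ComplexLimits.

Lemma conjcE (R : realType) (z : R[i]) : z^* = z^*%C. Proof. by []. Qed.

(** * Positive definite kernels, real and complex *)

Section PositiveDefinite.
Variables (R : realType) (X : Type) (D : set X).

(** For c = a + i b the real part of the form is the form at a plus the form at b, and symmetry of
    [k] cancels the cross terms in the imaginary part. *)
Lemma real_posdef (k : X -> X -> R) : (forall x y, k x y = k y x) ->
  (forall (m : nat) (x : 'I_m -> X) (c : 'I_m -> R), (forall i, D (x i)) ->
     0 <= \sum_(i < m) \sum_(j < m) c i * c j * k (x i) (x j)) ->
  posdef_on D (fun x y => (k x y)%:C%C).
Proof.
move=> kC kp m x c Dx.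
under eq_bigr do under eq_bigr do rewrite conjcE.
pose a i := complex.Re (c i); pose b i := complex.Im (c i).
pose S1 := \sum_(i < m) \sum_(j < m) a i * a j * k (x i) (x j).
pose S2 := \sum_(i < m) \sum_(j < m) b i * b j * k (x i) (x j).
pose S3 := \sum_(i < m) \sum_(j < m) b i * a j * k (x i) (x j).
pose S4 := \sum_(i < m) \sum_(j < m) a i * b j * k (x i) (x j).
have S34 : S4 = S3.
  by rewrite /S4 exchange_big; apply: eq_bigr => j _; apply: eq_bigr => i _; rewrite kC (mulrC (a i)).
suff -> : \sum_(i < m) \sum_(j < m) c i * (c j)^*%C * (k (x i) (x j))%:C%C =
    ((S1 + S2) +i* (S3 - S4))%C.
  by rewrite lecE /= S34 subrr eqxx addr_ge0 // kp.
have E (I : Type) (s : seq I) (f g : I -> R) :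
    \sum_(i <- s) (f i +i* g i)%C = ((\sum_(i <- s) f i) +i* (\sum_(i <- s) g i))%C.
  by elim: s => [|i s IHs]; rewrite ?big_nil // !big_cons IHs.
rewrite /S1 /S2 /S3 /S4 -!sumrN -!big_split -E; apply: eq_bigr => i _.
rewrite -!sumrN -!big_split -E; apply: eq_bigr => j _.
rewrite /a /b; case: (c i) (c j) => [a1 b1] [a2 b2] /=.
by apply/eqP; rewrite eq_complex /=; apply/andP; split; apply/eqP; ring.
Qed.

Lemma posdef_pair (K : X -> X -> R[i]) (x y : X) (w : R[i]) : posdef_on D K -> D x -> D y ->
  0 <= K x x + w^*%C * K x y + (w * K y x + w * w^*%C * K y y).
Proof.
move=> Kp Dx Dy.
have := Kp 2%N (fun i => if i == ord0 then x else y) (fun i => if i == ord0 then 1 else w).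
rewrite !big_ord_recl !big_ord0 /= !addr0 !conjcE conjc1 !mul1r !mulr1.
by apply => i; case: ifP.
Qed.

(* Weights [(1, w)] with [w ^ 4 = 1]. *)
Lemma posdef_bound (K : X -> X -> R[i]) (x y : X) : posdef_on D K -> D x -> D y ->
  `|complex.Re (K x y)| <= (complex.Re (K x x) + complex.Re (K y y)) / 2 /\
  `|complex.Im (K x y)| <= (complex.Re (K x x) + complex.Re (K y y)) / 2.
Proof.
move=> Kp Dx Dy; have H w := posdef_pair w Kp Dx Dy.
move: (H 1) (H (-1)) (H 'i%C) (H (- 'i)%C).
case: (K x x) (K x y) (K y x) (K y y) => [a a'] [b b'] [c c'] [e e'] /=.
rewrite !lecE /= => /andP[/eqP i1 r1] /andP[/eqP i2 r2] /andP[/eqP i3 r3] /andP[/eqP i4 r4].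
by rewrite !ler_norml; split; apply/andP; split; lra.
Qed.

End PositiveDefinite.

Section ParameterIntegral.
Variables (R : realType) (mu : {finite_measure set R -> \bar R}) (D : set R).
Hypothesis mD : measurable D.

(** Continuity is tested on sequences, to which dominated convergence applies. *)
Lemma Rintegral_param_continuous (F : R -> R -> R) (M : R) :
  (forall r, measurable_fun D (F ^~ r)) ->
  (forall u r, D u -> `|F u r| <= M) ->
  (forall u, D u -> continuous (F u)) ->
  continuous (fun r => \int[mu]_(u in D) F u r).
Proof.
move=> mF FM cF r; apply/(@cvg_nbhsP _ R^o) => w wr.
apply: (Rintegral_dct mD (M := M)) => [n|n u Du|u Du]; [exact: mF|exact: FM|].
exact: (cvg_comp _ _ wr (cF u Du r)).
Qed.

End ParameterIntegral.

(** * The kernels alpha_n satisfy all the conditions *)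

Section Association.
Variables (R : realType) (d : dimension) (mu : {finite_measure set R -> \bar R}).
Variables (kap : R -> R) (psi u : nat -> R -> R).

(* [kap] is [Omega_d] or the Gaussian, [psi n] extends [phi_n^d] to the whole
   line, and [u n] is the normalized Gegenbauer polynomial. *)
Hypothesis kap_continuous : continuous kap.
Hypothesis kapN : forall t, kap (- t) = kap t.
Hypothesis kap0 : kap 0 = 1.
Hypothesis kap_posdef : forall (m : nat) (x : 'I_m -> euclid R d) (c : 'I_m -> R),
  0 <= \sum_(i < m) \sum_(j < m) c i * c j * kap (enorm (x i - x j)).
Hypothesis psi_continuous : forall n, continuous (psi n).
Hypothesis psiS0 : forall n, psi n.+1 0 = 0.
Hypothesis psiE : forall n t, 0 <= t -> phi d n t = psi n t.
Hypothesis uE : forall n t, `|t| <= 1 -> gegenbauer_hat (lambda R d) n t = u n t.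
Hypothesis u_le1 : forall n t, `|t| <= 1 -> `|u n t| <= 1.
Hypothesis u1 : forall n, u n 1 = 1.
Hypothesis addition : forall r s t, 0 <= r -> 0 <= s -> `|t| <= 1 ->
  series (fun n => psi n r * psi n s * u n t) @ \oo
    --> kap (Num.sqrt (r ^+ 2 + s ^+ 2 - 2 * r * s * t)).

Let I : set R := `[0, +oo[%classic.
Let mI : measurable I. Proof. exact: measurable_itv. Qed.
Let I_ge0 v : I v -> 0 <= v. Proof. by rewrite /I /= in_itv /= andbT. Qed.

Let norm11 : `|1 : R| <= 1. Proof. by rewrite normr1. Qed.

Let addition_diag (r : R) : 0 <= r -> series (fun n => psi n r ^+ 2) @ \oo --> (1 : R).
Proof.
move=> r0; have := addition r0 r0 norm11.
rewrite (_ : _ - _ = 0); last by ring.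
rewrite sqrtr0 kap0; under eq_fun do rewrite u1 mulr1 -expr2.
by [].
Qed.

Let psi_sum_le1 (r : R) N : 0 <= r -> series (fun n => psi n r ^+ 2) N <= 1.
Proof.
move=> r0; have c := addition_diag r0.
rewrite -(cvg_lim (@Rhausdorff R) c); apply: nondecreasing_cvgn_le.
  by apply/nondecreasing_seqP => k; rewrite seriesSr lerDl sqr_ge0.
by apply/cvg_ex; exists 1.
Qed.

Let psi_le1 n (r : R) : 0 <= r -> `|psi n r| <= 1.
Proof.
move=> r0; rewrite -(@ler_pXn2r _ 2) ?nnegrE // expr1n real_normK ?num_real //.
apply: le_trans (psi_sum_le1 n.+1 r0); rewrite seriesSr lerDr.
by apply: sumr_ge0 => i _; rewrite sqr_ge0.
Qed.

(** At s = 0 the addition theorem has only its term n = 0, a product of two values of psi bounded by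
    1. *)
Let kap_le1 (t : R) : `|kap t| <= 1.
Proof.
have -> : kap t = kap `|t| by have [_|_] := ger0P t; rewrite ?kapN.
have := addition (normr_ge0 t) (lexx 0) norm11.
rewrite expr0n addr0 !mulr0 mul0r subr0 sqrtr_sqr normr_id => c.
have <- : psi 0 `|t| * psi 0 0 = kap `|t|.
  apply: (cvg_unique (@Rhausdorff R) _ c).
  apply: cvg_near_cst; exists 1%N => // -[//|N] _; rewrite /series /= big_nat_recl //.
  by rewrite u1 mulr1 big1 ?addr0 // => n _; rewrite psiS0 mulr0 mul0r.
by rewrite normrM -[leRHS]mulr1 ler_pM ?psi_le1.
Qed.

(** Each term is at most the mean of psi_n(r)^2 and psi_n(s)^2, and both sums of squares are at most
    1. *)
Let partial_le1 N (r s t : R) : 0 <= r -> 0 <= s -> `|t| <= 1 ->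
  `|\sum_(0 <= n < N) psi n r * psi n s * u n t| <= 1.
Proof.
move=> r0 s0 t1; apply: le_trans (ler_norm_sum _ _ _) _.
have H : \sum_(0 <= n < N) `|psi n r * psi n s * u n t| <=
    \sum_(0 <= n < N) (psi n r ^+ 2 + psi n s ^+ 2) / 2.
  apply: ler_sum => n _; rewrite normrM.
  apply: (@le_trans _ _ (`|psi n r * psi n s| * 1)).
    by rewrite ler_wpM2l ?u_le1.
  rewrite mulr1 ler_norml.
  have := sqr_ge0 (psi n r - psi n s); have := sqr_ge0 (psi n r + psi n s).
  by rewrite sqrrD sqrrB => *; apply/andP; split; lra.
apply: le_trans H _; rewrite -mulr_suml big_split /=.
have := psi_sum_le1 N r0; have := psi_sum_le1 N s0.
by rewrite /series /= => *; lra.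
Qed.

Let measurable_scaled (f : R -> R) (r : R) : continuous f -> measurable_fun I (fun v => f (v * r)).
Proof.
move=> cf; apply: measurable_funTS; apply: continuous_measurable_fun => v.
by apply: continuous_comp; [exact: mulrr_continuous|exact: cf].
Qed.

Let A n r s : R := \int[mu]_(v in I) (psi n (v * r) * psi n (v * s)).

Let alphaE n (r s : R) : 0 <= r -> 0 <= s -> alpha d mu n r s = (A n r s)%:C%C.
Proof.
move=> r0 s0; rewrite /alpha /A; congr (_%:C)%C; apply: eq_Rintegral => v.
by rewrite inE => /I_ge0 v0; rewrite !psiE // mulr_ge0.
Qed.

Let measurable_psi2 n (r s : R) : measurable_fun I (fun v => psi n (v * r) * psi n (v * s)).
Proof. by apply: measurable_funM; exact: measurable_scaled. Qed.

Let psi2_le1 n (r s v : R) : 0 <= r -> 0 <= s -> I v -> `|psi n (v * r) * psi n (v * s)| <= 1.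
Proof.
move=> r0 s0 /I_ge0 v0; rewrite normrM -[leRHS]mulr1.
by rewrite ler_pM ?psi_le1 ?mulr_ge0.
Qed.

Let integrable_psi2 n (r s : R) : 0 <= r -> 0 <= s ->
  mu.-integrable I (EFin \o (fun v => psi n (v * r) * psi n (v * s))).
Proof.
move=> r0 s0; apply: (@bounded_integrable _ _ _ mu I mI _ 1); first exact: measurable_psi2.
by move=> v; exact: psi2_le1.
Qed.

Let kk r : R := \int[mu]_(v in I) kap (v * r).

Let kk_continuous : continuous kk.
Proof.
apply: (@Rintegral_param_continuous _ mu I mI (fun v r => kap (v * r)) 1) => //.
  by move=> r; exact: measurable_scaled.
by move=> v _ r; apply: continuous_comp; [exact: mulrl_continuous|exact: kap_continuous].
Qed.

Let A_addition (r s t : R) : 0 <= r -> 0 <= s -> `|t| <= 1 ->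
  series (fun n => A n r s * u n t) @ \oo
    --> kk (Num.sqrt (r ^+ 2 + s ^+ 2 - 2 * r * s * t)).
Proof.
move=> r0 s0 t1.
pose f n v := u n t * (psi n (v * r) * psi n (v * s)).
have mf n : measurable_fun I (f n).
  by apply: measurable_funM; [exact: measurable_cst|exact: measurable_psi2].
have If n : mu.-integrable I (EFin \o f n).
  by apply: integrable_EFinZl => //; exact: integrable_psi2.
have -> : series (fun n => A n r s * u n t) =
    fun N => \int[mu]_(v in I) \sum_(0 <= n < N) f n v.
  apply/funext => N; rewrite (Rintegral_finsum mI) // /series /=.
  by apply: eq_bigr => n _; rewrite /f RintegralZl //; [rewrite mulrC|exact: integrable_psi2].
have fE N v : \sum_(0 <= n < N) f n v =
    \sum_(0 <= n < N) psi n (v * r) * psi n (v * s) * u n t.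
  by apply: eq_bigr => n _; rewrite /f mulrC.
apply: (@Rintegral_dct _ _ _ mu I mI _ _ 1) => [N|N v /I_ge0 v0|v /I_ge0 v0].
- exact: measurable_sum.
- by rewrite fE partial_le1 ?mulr_ge0.
have := addition (mulr_ge0 v0 r0) (mulr_ge0 v0 s0) t1.
have <- : (fun N => \sum_(0 <= n < N) f n v) =
  series (fun n => psi n (v * r) * psi n (v * s) * u n t) by apply/funext => N; rewrite fE.
rewrite (_ : _ - _ = v ^+ 2 * (r ^+ 2 + s ^+ 2 - 2 * r * s * t)); last by ring.
by rewrite sqrtrM ?sqr_ge0 // sqrtr_sqr ger0_norm.
Qed.

Let AS0 n (r : R) : A n.+1 r 0 = 0 /\ A n.+1 0 r = 0.
Proof.
by rewrite /A; split; under eq_Rintegral do rewrite mulr0 psiS0 ?mulr0 ?mul0r;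
  rewrite Rintegral_cst // mul0r.
Qed.

Let quadratic_ge0 (m : nat) (f : 'I_m -> 'I_m -> R -> R) (c : 'I_m -> R) :
  (forall i j, mu.-integrable I (EFin \o f i j)) ->
  (forall v, I v -> 0 <= \sum_(i < m) \sum_(j < m) c i * c j * f i j v) ->
  0 <= \sum_(i < m) \sum_(j < m) c i * c j * \int[mu]_(v in I) f i j v.
Proof.
move=> If f0.
have Ic i j : mu.-integrable I (EFin \o (fun v => c i * c j * f i j v)).
  exact: integrable_EFinZl.
rewrite (_ : \sum_i _ = \int[mu]_(v in I) \sum_(i < m) \sum_(j < m) c i * c j * f i j v).
  exact: Rintegral_ge0.
rewrite (Rintegral_finsum mI); last by move=> i; exact: integrable_finsum.
apply: eq_bigr => i _; rewrite (Rintegral_finsum mI) //.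
by apply: eq_bigr => j _; rewrite RintegralZl.
Qed.

Let alpha_posdef n : posdef_on [set r : R | 0 <= r] (alpha d mu n).
Proof.
have AC r s : A n r s = A n s r by apply: eq_Rintegral => v _; rewrite mulrC.
have H : posdef_on [set r : R | 0 <= r] (fun r s => (A n r s)%:C%C).
  apply: real_posdef => // m x c x0.
 
  apply: quadratic_ge0 => [i j|v v0]; first by apply: integrable_psi2; exact: x0.
  rewrite (_ : \sum_i _ = (\sum_(i < m) c i * psi n (v * x i)) ^+ 2) ?sqr_ge0 //.
  rewrite expr2 big_distrlr; apply: eq_bigr => i _; apply: eq_bigr => j _ /=.
  by ring.
move=> m x c x0; rewrite (eq_bigr (fun i => \sum_(j < m) c i * (c j)^* * (A n (x i) (x j))%:C%C)).
  exact: H.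
by move=> i _; apply: eq_bigr => j _; rewrite alphaE //; exact: x0.
Qed.

(** Absolute values extend the kernel from the quadrant to the plane. Joint continuity follows from
    one-parameter continuity because [w] bounds the effect of moving each argument separately. *)
Let alpha_continuous n : {within [set p : R * R | 0 <= p.1 /\ 0 <= p.2],
  continuous (fun p => alpha d mu n p.1 p.2 : R[i]^o)}.
Proof.
pose w (c r : R) : R := \int[mu]_(v in I) `|psi n (v * `|r|) - psi n (v * `|c|)|.
have norm_cont (v : R) : continuous (fun r : R => psi n (v * `|r|)).
  move=> r; apply: continuous_comp; last exact: psi_continuous.
  by apply: continuous_comp; [exact: norm_continuous|exact: mulrl_continuous].
have mw (c r : R) : measurable_fun I (fun v => psi n (v * `|r|) - psi n (v * `|c|)).
  by apply: measurable_funB; exact: measurable_scaled.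
have w_le (c r v : R) : I v -> `|psi n (v * `|r|) - psi n (v * `|c|)| <= 2.
  move=> /I_ge0 v0; apply: le_trans (ler_normB _ _) _.
  by rewrite -[leRHS]/(1 + 1 : R) lerD // psi_le1 ?mulr_ge0.
have w_int (c r : R) : mu.-integrable I
    (EFin \o (fun v => `|psi n (v * `|r|) - psi n (v * `|c|)|)).
  apply: (@bounded_integrable _ _ _ mu I mI _ 2).
    by apply: measurableT_comp => //; exact: mw.
  move=> v v0; rewrite /= normr_id; exact: w_le.
have w_cvg (c : R) : w c r @[r --> c] --> (0 : R).
  have <- : w c c = 0.
    by rewrite /w; under eq_Rintegral do rewrite subrr normr0; rewrite Rintegral_cst // mul0r.
  apply: (@Rintegral_param_continuous _ mu I mI
    (fun v r => `|psi n (v * `|r|) - psi n (v * `|c|)|) 2).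
  - by move=> r; apply: measurableT_comp => //; exact: mw.
  - by move=> v r v0; rewrite /= normr_id; exact: w_le.
  - move=> v _ r; apply: cvg_norm.
    by apply: continuousB; [exact: norm_cont|exact: cst_continuous].
have A_dist (p q : R * R) :
    `|A n `|p.1| `|p.2| - A n `|q.1| `|q.2| | <= w p.1 q.1 + w p.2 q.2.
  have i1 := integrable_psi2 n (normr_ge0 p.1) (normr_ge0 p.2).
  have i2 := integrable_psi2 n (normr_ge0 q.1) (normr_ge0 q.2).
  rewrite /A -RintegralB // /w -RintegralD //.
  apply: le_trans (le_normr_Rintegral mI _) _; first exact: (integrableB mI i1 i2).
  apply: le_Rintegral => //.
  - by have := integrable_abse (integrableB mI i1 i2).
  - exact: integrable_EFinD.
  move=> v /I_ge0 v0.
  have -> (a b a' b' : R) : a * b - a' * b' = - ((a' - a) * b + (b' - b) * a') by ring.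
  rewrite normrN; apply: le_trans (ler_normD _ _) _; rewrite !normrM.
  by rewrite lerD // -[leRHS]mulr1 ler_wpM2l // psi_le1 ?mulr_ge0.
have cA : continuous (fun p : R * R => A n `|p.1| `|p.2|).
  move=> p; apply/cvgrPdist_lt => e e0.
  have e2 : 0 < e / 2 by rewrite divr_gt0.
  have /cvgrPdist_lt/(_ _ e2) w1 := w_cvg p.1.
  have /cvgrPdist_lt/(_ _ e2) w2 := w_cvg p.2.
  have n1 : \forall q \near p, `|0 - w p.1 q.1| < e / 2 by exact: (cvg_fst w1).
  have n2 : \forall q \near p, `|0 - w p.2 q.2| < e / 2 by exact: (cvg_snd w2).
  apply: filterS2 n1 n2 => q; rewrite !sub0r !normrN => q1 q2.
  apply: le_lt_trans (A_dist p q) _.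
  by have := ler_norm (w p.1 q.1); have := ler_norm (w p.2 q.2); lra.
apply: (@subspace_eq_continuous _ _ _ (fun p => (A n `|p.1| `|p.2|)%:C%C : R[i]^o)).
  move=> p; rewrite inE /= => -[p1 p2].
  by rewrite -[RHS]/(alpha d mu n p.1 p.2) alphaE // !ger0_norm.
apply: continuous_subspaceT => p.
exact: (real_complex_cvg (cA p)).
Qed.

(* Dini's theorem on [0, r]. *)
Let tail_uniform (r e : R) : 0 < e -> \forall N \near \oo,
  forall s, `[0, r]%classic s -> kk 0 - series (fun n => A n s s) N < e.
Proof.
move=> e0.
pose T N (s : R) : R := kk 0 - series (fun n => A n `|s| `|s|) N.
have cT N : continuous (T N).
  have cA n : continuous (fun s : R => A n `|s| `|s|).
    apply: (@Rintegral_param_continuous _ mu I mI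
      (fun v s => psi n (v * `|s|) * psi n (v * `|s|)) 1) => [x|v x v0|v _ x].
    - exact: measurable_psi2.
    - exact: psi2_le1.
    - have c : {for x, continuous (fun s : R => psi n (v * `|s|))}.
        apply: continuous_comp; last exact: psi_continuous.
        by apply: continuous_comp; [exact: norm_continuous|exact: mulrl_continuous].
      exact: continuousM.
  move=> s; rewrite /T; apply: cvgB; first exact: cvg_cst.
  by rewrite /series /=; apply: cvg_big => [|n _]; [exact: add_continuous|exact: cA].
have T_decr (s : R) N M : (N <= M)%N -> T M s <= T N s.
  move=> NM; rewrite /T lerD2l lerN2.
  have /nondecreasing_seqP -> // : forall n, series (fun n => A n `|s| `|s|) n <= series (fun n => A n `|s| `|s|) n.+1.
  move=> n; rewrite seriesSr lerDl; apply: Rintegral_ge0 => v _.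
  by rewrite -expr2 sqr_ge0.
have T0 (s : R) : T ^~ s @ \oo --> (0 : R).
  have := A_addition (normr_ge0 s) (normr_ge0 s) norm11.
  rewrite (_ : _ - _ = 0); last by ring.
  rewrite sqrtr0; under eq_fun do rewrite u1 mulr1.
  by move=> c; rewrite -(subrr (kk 0)); apply: cvgB; [exact: cvg_cst|exact: c].
(* Near each s one index N0 works by continuity of [T N0], and every larger N by monotonicity;
   compactness makes the index uniform. *)
have /compact_near_coveringP/(_ nat \oo (fun N s => T N s < e)) := @segment_compact R 0 r.
case=> [|N0 _ H].
  move=> s _; have /cvgrPdist_lt/(_ _ e0)[N0 _ HN] := T0 s.
  have TN0 : T N0 s < e.
    by have := HN N0 (leqnn N0); rewrite /= sub0r normrN => /(le_lt_trans (ler_norm _)).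
  exists ([set x | T N0 x < e], [set N | (N0 <= N)%N]) => /=.
    split; last by exists N0.
    by apply: (cvgr_lt _ (cT N0 s)).
  by move=> [x N] /= [Tx N0N]; apply: le_lt_trans (T_decr x _ _ N0N) Tx.
exists N0 => // N NN s rs; have := H N NN s rs.
by rewrite /T ger0_norm //; move: rs; rewrite /= in_itv /= => /andP[].
Qed.

(** By the addition theorem at equal radii and t = 1 the whole series sums to [kk 0], so a tail is
    [kk 0] minus a partial sum, and these are uniformly small on the compact set [V]. *)
Let alpha_tail (r : R) : 0 <= r -> exists V : set R,
  [/\ within `[0, +oo[ (nbhs r) V, V `<=` `[0, +oo[ &
    (fun N : nat => ereal_sup
      [set (\sum_(N <= n <oo) (complex.Re (alpha d mu n s s))%:E)%E | s in V]) @ \oo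
    --> 0%E].
Proof.
move=> r0; pose V : set R := `[0, r + 1]%classic; exists V; split.
- have r1 : \forall x \near r, x < r + 1 by apply: (cvgr_lt _ (@cvg_id _ _)); rewrite ltrDl.
  rewrite /within; apply: filterS r1 => x xr.
  by rewrite /V /= !in_itv /= andbT => ->; rewrite ltW.
- by move=> x; rewrite /V /= !in_itv /= andbT => /andP[].
have tailE N (s : R) : 0 <= s -> (\sum_(N <= n <oo) (complex.Re (alpha d mu n s s))%:E)%E =
    (kk 0 - series (fun n => A n s s) N)%:E.
  move=> s0; apply/cvg_lim => //.
  have c : (fun M => series (fun n => A n s s) M - series (fun n => A n s s) N) @ \oo -->
      kk 0 - series (fun n => A n s s) N.
    apply: cvgB; last exact: cvg_cst.
    have := A_addition s0 s0 norm11.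
    rewrite (_ : _ - _ = 0); last by ring.
    by rewrite sqrtr0; under eq_fun do rewrite u1 mulr1.
  have cE : (fun M => (series (fun n => A n s s) M - series (fun n => A n s s) N)%:E) @ \oo -->
      (kk 0 - series (fun n => A n s s) N)%:E.
    by apply: cvg_EFin => //; apply: nearW.
  apply: cvg_trans cE; apply: near_eq_cvg; exists N => // M NM.
  by rewrite (sub_series_geq _ NM) -sumEFin; apply: eq_bigr => n _; rewrite alphaE.
(* Convergence to 0 in the extended reals also requires the suprema to be eventually finite; they
   lie between 0 and any given positive bound. *)
apply/fine_cvgP.
have sup_ge0 N : (0 <= ereal_sup [set (\sum_(N <= n <oo) (complex.Re (alpha d mu n s s))%:E)%E
    | s in V])%E.
  apply: le_trans (ereal_sup_ubound _); last first.
    by exists r => //; rewrite /V /= in_itv /= r0 lerDl ler01.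
  apply: nneseries_ge0 => n _ _; rewrite alphaE //= lee_fin; apply: Rintegral_ge0 => v _.
  by rewrite -expr2 sqr_ge0.
have sup_le (e : R) : 0 < e -> \forall N \near \oo,
    (ereal_sup [set (\sum_(N <= n <oo) (complex.Re (alpha d mu n s s))%:E)%E
      | s in V] <= e%:E)%E.
  move=> e0; apply: filterS (tail_uniform (r + 1) e0) => N H.
  apply: ge_ereal_sup => _ [s rs <-]; rewrite tailE; last first.
    by move: rs; rewrite /V /= in_itv /= => /andP[].
  by rewrite lee_fin; apply/ltW/H.
split.
  apply: filterS (sup_le 1 ltr01) => N; move: (sup_ge0 N); case: (ereal_sup _) => //.
apply/cvgrPdist_le => e e0; apply: filterS (sup_le e e0) => N; move: (sup_ge0 N) => /=.
case: (ereal_sup _) => [x||] //=; rewrite !lee_fin => x0 xe.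
by rewrite sub0r normrN ger0_norm.
Qed.

Variable K : euclid R d -> euclid R d -> R[i].
Hypothesis KE : forall x y, K x y = (\int[mu]_(v in I) kap (v * enorm (x - y)))%:C%C.

Let kernel_continuous : continuous_kernel K.
Proof.
move=> x0 y0 e e0.
have /cvgrPdist_lt/(_ _ e0)/nbhs_ballP[D /= D0 HD] := @kk_continuous (enorm (x0 - y0)).
exists (D / 2); first by rewrite divr_gt0.
move=> x y xD yD; rewrite !KE -rmorphB norm_real_complex ltcR distrC.
apply: HD; rewrite /ball /= distrC; apply: le_lt_trans (ler_enormB_dist _ _) _.
have -> : x - y - (x0 - y0) = (x - x0) + - (y - y0) by rewrite !opprD !opprK addrACA.
by apply: le_lt_trans (ler_enormD _ _) _; rewrite enormN [D]splitr ltrD.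
Qed.

(** As v |x - y| = |v x - v y|, for each v the integrand is the form of [kap] at the scaled
    points. *)
Let kernel_posdef : posdef_on setT K.
Proof.
have H : posdef_on setT (fun x y : euclid R d => (kk (enorm (x - y)))%:C%C).
  apply: real_posdef => [x y|m x c _]; first by rewrite -enormN opprB.
  apply: (@quadratic_ge0 m (fun i j v => kap (v * enorm (x i - x j)))) => [i j|v /I_ge0 v0].
    apply: (@bounded_integrable _ _ _ mu I mI _ 1); first exact: measurable_scaled.
    by move=> v _; exact: kap_le1.
  rewrite (eq_bigr (fun i => \sum_(j < m) c i * c j * kap (enorm (v *: x i - v *: x j)))).
    exact: kap_posdef.
  move=> i _; apply: eq_bigr => j _.
  by rewrite -scalerBr enormZ ger0_norm.
move=> m x c Dx; rewrite (eq_bigr (fun i => \sum_(j < m) c i * (c j)^* * (kk (enorm (x i - x j)))%:C%C)).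
  exact: H.
by move=> i _; apply: eq_bigr => j _; rewrite KE.
Qed.

(** The cosine [t] is a parameter so that a zero vector is covered too: any [t] then satisfies the
    condition on [dot x y], and t = 1 is used. *)
Let kernel_expansion (x y : euclid R d) (t : R) : `|t| <= 1 ->
  dot x y = enorm x * enorm y * t ->
  series (fun n => A n (enorm x) (enorm y) * u n t) @ \oo --> kk (enorm (x - y)).
Proof.
move=> t1 xy; have := A_addition (enorm_ge0 x) (enorm_ge0 y) t1.
have -> : enorm x ^+ 2 + enorm y ^+ 2 - 2 * enorm x * enorm y * t = enorm (x - y) ^+ 2.
  by rewrite enormB_sqr xy; ring.
by rewrite sqrtr_sqr ger0_norm ?enorm_ge0.
Qed.

Lemma associated_alpha : associated K (alpha d mu).
Proof.
split.
- exact: kernel_continuous.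
- by move=> f Of x y; rewrite !KE orthogonal_groupB.
- exact: kernel_posdef.
- exact: alpha_continuous.
- exact: alpha_posdef.
- move=> x y x0 y0; have t1 := normalized_dot_le1 x y.
  move: t1; set t := dot _ _ => t1.
  have xy : dot x y = enorm x * enorm y * t.
    rewrite /t normalized_dot mulrCA divff ?mulr1 //.
    by rewrite mulf_neq0 // enorm_eq0.
  rewrite KE.
  apply: cvg_trans (real_complex_cvg (kernel_expansion t1 xy)); apply: near_eq_cvg; apply: nearW => N; rewrite /series /= rmorph_sum; apply: eq_bigr => n _.
  by rewrite alphaE ?enorm_ge0 // uE // rmorphM.
- move=> x y xy0; have xy : dot x y = enorm x * enorm y * 1.
    by case: xy0 => ->; rewrite ?dot0l 1?dotC ?dot0l enorm0 ?mulr0 !mul0r.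
  rewrite KE alphaE ?enorm_ge0 //; congr (_%:C)%C.
  apply: (cvg_unique (@Rhausdorff R) (kernel_expansion norm11 xy)).
  apply: cvg_near_cst; exists 1%N => // -[//|N] _; rewrite /series /= big_nat_recl //.
  rewrite u1 mulr1 big1 ?addr0 // => n _.
  by case: xy0 => ->; rewrite enorm0; case: (AS0 n (enorm x)) (AS0 n (enorm y)) => [a b] [a' b'];
    rewrite ?a ?b' mul0r.
- exact: alpha_tail.
- by move=> [//|n] r _ r0; rewrite !alphaE //; case: (AS0 n r) => -> ->.
Qed.

End Association.

(** * Uniqueness of the associated kernels *)

Section Uniqueness.
Variables (R : realType) (d : dimension) (u : nat -> R -> R).
Hypothesis d2 : dim_ge2 d.
Hypothesis uE : forall n t, `|t| <= 1 -> gegenbauer_hat (lambda R d) n t = u n t.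
Hypothesis u1 : forall n, u n 1 = 1.
Hypothesis u_unique : forall b : nat -> R, cvgn (series (fun n => `|b n|)) ->
  (forall t, `|t| <= 1 -> series (fun n => b n * u n t) @ \oo --> (0 : R)) ->
  forall n, b n = 0.
Variable K : euclid R d -> euclid R d -> R[i].

(** The limit is the value of [K] at two vectors with these radii and this angle. It is chosen
    before [a], so that two associated families share it. *)
Let expansion (r s t : R) : 0 < r -> 0 < s -> `|t| <= 1 -> exists z : R[i],
  forall a, associated K a ->
    series (fun n => complex.Re (a n r s) * u n t) @ \oo --> complex.Re z /\
    series (fun n => complex.Im (a n r s) * u n t) @ \oo --> complex.Im z.
Proof.
move=> r0 s0 t1; have [x [y [xr ys xy]]] := vectors_with_angle d2 (ltW r0) (ltW s0) t1.
exists (K x y) => a Ka.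
have x0 : x != 0 by rewrite -enorm_eq0 xr gt_eqF.
have y0 : y != 0 by rewrite -enorm_eq0 ys gt_eqF.
have := assoc_expansion Ka x0 y0; rewrite normalized_dot xr ys xy mulrC mulKf; last first.
  by rewrite mulf_neq0 // gt_eqF.
move=> c.
have sum_split N : series (fun n => a n r s * (gegenbauer_hat (lambda R d) n t)%:C%C) N =
   ((series (fun n => complex.Re (a n r s) * u n t) N) +i*
    (series (fun n => complex.Im (a n r s) * u n t) N))%C.
  rewrite /series /=; elim: N => [|N IHN]; first by rewrite !big_geq.
  rewrite !big_nat_recr //= IHN uE //; case: (a N r s) => p q.
  by apply/eqP; rewrite eq_complex /=; apply/andP; split; apply/eqP; ring.
split.
- apply: cvg_trans (Re_cvg c); apply: near_eq_cvg; apply: nearW => N.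
  by rewrite sum_split.
- apply: cvg_trans (Im_cvg c); apply: near_eq_cvg; apply: nearW => N.
  by rewrite sum_split.
Qed.

Let summable a (r s : R) : associated K a -> 0 < r -> 0 < s ->
  cvgn (series (fun n => `|complex.Re (a n r s)|)) /\
  cvgn (series (fun n => `|complex.Im (a n r s)|)).
Proof.
move=> Ka r0 s0; have n1 : `|1 : R| <= 1 by rewrite normr1.
have diag (x : R) : 0 < x -> cvgn (series (fun n => complex.Re (a n x x))).
  move=> x0; have [z /(_ _ Ka)[c _]] := expansion x0 x0 n1.
  apply/cvg_ex; exists (complex.Re z); apply: cvg_trans c.
  by apply: near_eq_cvg; apply: nearW => N; apply: eq_bigr => n _; rewrite u1 mulr1.
have c := is_cvg_seriesZ (k := 2^-1) (is_cvg_seriesD (diag r r0) (diag s s0)).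
have bd n := posdef_bound (assoc_posdef Ka n) (ltW r0 : [set r : R | 0 <= r] r)
  (ltW s0 : [set r : R | 0 <= r] s).
pose g n := 2^-1 * (complex.Re (a n r r) + complex.Re (a n s s)).
have g_ge n : `|complex.Re (a n r s)| <= g n /\ `|complex.Im (a n r s)| <= g n.
  by rewrite /g mulrC; exact: bd.
have g0 n : 0 <= g n by exact: le_trans (normr_ge0 _) (g_ge n).1.
by split; apply: (series_le_cvg _ g0 _ c) => n //; case: (g_ge n).
Qed.

Let coefficients_eq (b b' : nat -> R) :
  cvgn (series (fun n => `|b n|)) -> cvgn (series (fun n => `|b' n|)) ->
  (forall t : R, `|t| <= 1 -> exists l : R,
     series (fun n => b n * u n t) @ \oo --> l /\ series (fun n => b' n * u n t) @ \oo --> l) ->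
  forall n, b n = b' n.
Proof.
move=> cb cb' H n; apply/eqP; rewrite -subr_eq0; apply/eqP.
apply: (@u_unique (fun n => b n - b' n)).
  apply: (series_le_cvg _ _ _ (is_cvg_seriesD cb cb')) => k.
  - exact: normr_ge0.
  - by rewrite addr_ge0.
  - exact: ler_normB.
move=> t /H[l [c c']]; rewrite -(subrr l).
apply: cvg_trans (cvgB c c'); apply: near_eq_cvg; apply: nearW => N.
rewrite -[LHS]/(series (fun k => b k * u k t) N - series (fun k => b' k * u k t) N).
by rewrite /series /= -sumrB; apply: eq_bigr => k _; rewrite mulrBl.
Qed.

Lemma associated_unique a a' : associated K a -> associated K a' ->
  forall n (r s : R), 0 <= r -> 0 <= s -> a n r s = a' n r s.
Proof.
move=> Ka Ka' n r s; rewrite le_eqVlt => r0; rewrite le_eqVlt => s0.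
have norm11 : `|1 : R| <= 1 by rewrite normr1.
(* When a radius is 0, degree 0 is read off from [K] itself and the higher degrees vanish by the
   axis condition. *)
have axis (x y : R) : 0 <= x -> 0 <= y -> x = 0 \/ y = 0 -> a n x y = a' n x y.
  move=> x0 y0 xy0; have [X [Y [Xx Yy _]]] := vectors_with_angle d2 x0 y0 norm11.
  case: n => [|m].
    have XY : X = 0 \/ Y = 0.
      by case: xy0 => [zx|zy]; [left|right]; apply/eqP; rewrite -enorm_eq0 ?Xx ?Yy ?zx ?zy.
    by rewrite -{1 2}Xx -{1 2}Yy -(assoc_expansion0 Ka XY) -(assoc_expansion0 Ka' XY).
  case: xy0 => ->.
    by rewrite (assoc_axes Ka _ y0).2 // (assoc_axes Ka' _ y0).2.
  by rewrite (assoc_axes Ka _ x0).1 // (assoc_axes Ka' _ x0).1.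
case/orP: r0 => [/eqP r0|r0].
  case/orP: s0 => [/eqP s0|s0]; rewrite -r0; apply: axis; rewrite -?s0 //; by [left|exact: ltW].
case/orP: s0 => [/eqP s0|s0].
  by rewrite -s0; apply: axis => //; [exact: ltW|right].
have [sR sI] := summable Ka r0 s0; have [sR' sI'] := summable Ka' r0 s0.
have R_eq := coefficients_eq sR sR' _ n; have I_eq := coefficients_eq sI sI' _ n.
apply/eqP; rewrite eq_complex; apply/andP; split; apply/eqP; [apply: R_eq|apply: I_eq] => t t1.
  have [z H] := expansion r0 s0 t1; exists (complex.Re z).
  by split; [exact: (H _ Ka).1|exact: (H _ Ka').1].
have [z H] := expansion r0 s0 t1; exists (complex.Im z).
by split; [exact: (H _ Ka).2|exact: (H _ Ka').2].
Qed.

End Uniqueness.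

(** * Finite dimension: the addition theorem for phi_n *)

Section FiniteDimension.
Variables (R : realType) (k : nat).
Hypothesis k2 : (2 <= k)%N.

Local Notation lam := (lambda_fin R k).

Definition bessel_kappa (t : R) : R := besselG lam 0 (t ^+ 2).

Definition bessel_psi (n : nat) (t : R) : R := Num.sqrt (harm_dim lam n) * besselg lam n t.

Let lam0 : 0 <= lam. Proof. exact: lambda_fin_ge0. Qed.

Let sqrt_harm n : Num.sqrt (harm_dim lam n) * Num.sqrt (harm_dim lam n) = harm_dim lam n.
Proof. by rewrite -expr2 sqr_sqrtr // ltW // harm_dim_gt0. Qed.

Lemma bessel_psi_addition (r s t : R) : 0 <= r -> 0 <= s -> `|t| <= 1 ->
  series (fun n => bessel_psi n r * bessel_psi n s * zonal lam n t 1) @ \oo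
    --> bessel_kappa (Num.sqrt (r ^+ 2 + s ^+ 2 - 2 * r * s * t)).
Proof.
move=> r0 s0 t1; rewrite /bessel_kappa sqr_sqrtr.
  apply: cvg_trans (bessel_addition lam0 r0 s0 t1); apply: near_eq_cvg; apply: nearW => N.
  apply: eq_bigr => n _; rewrite /bessel_psi -[in LHS](sqrt_harm n).
  by move: (Num.sqrt _) => h; ring.
have -> : r ^+ 2 + s ^+ 2 - 2 * r * s * t = (r - s) ^+ 2 + 2 * r * s * (1 - t) by ring.
rewrite addr_ge0 ?sqr_ge0 // !mulr_ge0 // subr_ge0.
exact: le_trans (ler_norm t) t1.
Qed.

End FiniteDimension.

(** * Infinite dimension: Gaussians and power series *)

Section InfiniteDimension.
Variable R : realType.

Definition gauss (t : R) : R := expR (- (t ^+ 2 / 2)).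

(** A Schur product argument: one more factor <x_i, x_j> is a limit of sums over coordinates l, and
    for each l the numbers x_i(l) and x_j(l) are absorbed into the weights of the induction
    hypothesis. *)
Lemma dot_expn_posdef n (m : nat) (x : 'I_m -> ell2 R) (c : 'I_m -> R) :
  0 <= \sum_(i < m) \sum_(j < m) c i * c j * @dot R Infty (x i) (x j) ^+ n.
Proof.
elim: n c => [|n IHn] c.
  rewrite (_ : \sum_i _ = (\sum_(i < m) c i) ^+ 2) ?sqr_ge0 // expr2 big_distrlr /=.
  by apply: eq_bigr => i _; apply: eq_bigr => j _; rewrite expr0 mulr1.
pose q N := \sum_(i < m) \sum_(j < m) c i * c j * @dot R Infty (x i) (x j) ^+ n *
  series (fun l => x i l * x j l) N.
have qc : q @ \oo --> \sum_(i < m) \sum_(j < m) c i * c j * @dot R Infty (x i) (x j) ^+ n.+1.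
  apply: cvg_big => [|i _]; first exact: add_continuous.
  apply: cvg_big => [|j _]; first exact: add_continuous.
  rewrite exprSr mulrA; apply: cvgMr; exact: is_cvg_ell2_dot.
rewrite -(cvg_lim (@Rhausdorff R) qc); apply: limr_ge; first by apply/cvg_ex; eexists; exact: qc.
apply: nearW => N; rewrite /q.
have -> : \sum_(i < m) \sum_(j < m) c i * c j * @dot R Infty (x i) (x j) ^+ n *
    series (fun l => x i l * x j l) N =
  \sum_(0 <= l < N) \sum_(i < m) \sum_(j < m) (c i * x i l) * (c j * x j l) *
    @dot R Infty (x i) (x j) ^+ n.
  rewrite [RHS]exchange_big; apply: eq_bigr => i _; rewrite [RHS]exchange_big.
  apply: eq_bigr => j _; rewrite /series /= mulr_sumr; apply: eq_bigr => l _.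
  by move: (limn _) => z; rewrite -!mulrA; congr (_ * _); rewrite mulrCA !mulrA mulrAC [RHS]mulrAC; ring.
by apply: sumr_ge0 => l _; exact: IHn.
Qed.

(** The Gaussian of |x - y| factors into those of |x| and |y|, which go into the weights, and exp
    <x, y>, a limit of nonnegative combinations of powers of <x, y>. *)
Lemma gauss_posdef (m : nat) (x : 'I_m -> euclid R Infty) (c : 'I_m -> R) :
  0 <= \sum_(i < m) \sum_(j < m) c i * c j * gauss (enorm (x i - x j)).
Proof.
pose b i := c i * gauss (enorm (x i)).
pose q N := \sum_(i < m) \sum_(j < m) b i * b j * series (exp_coeff (dot (x i) (x j))) N.
have qc : q @ \oo --> \sum_(i < m) \sum_(j < m) c i * c j * gauss (enorm (x i - x j)).
  apply: cvg_big => [|i _]; first exact: add_continuous.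
  apply: cvg_big => [|j _]; first exact: add_continuous.
  have -> : c i * c j * gauss (enorm (x i - x j)) = b i * b j * expR (dot (x i) (x j)).
    rewrite /b /gauss enormB_sqr.
    rewrite (_ : - (_ / 2) = - (enorm (x i) ^+ 2 / 2) + - (enorm (x j) ^+ 2 / 2) + dot (x i) (x j)).
      by rewrite !expRD; ring.
    by field.
  by apply: cvgMr; exact: is_cvg_series_exp_coeff.
rewrite -(cvg_lim (@Rhausdorff R) qc); apply: limr_ge; first by apply/cvg_ex; eexists; exact: qc.
apply: nearW => N; rewrite /q.
have -> : \sum_(i < m) \sum_(j < m) b i * b j * series (exp_coeff (dot (x i) (x j))) N =
  \sum_(0 <= l < N) (l`!%:R)^-1 * \sum_(i < m) \sum_(j < m) b i * b j * dot (x i) (x j) ^+ l.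
  under [RHS]eq_bigr do rewrite mulr_sumr.
  rewrite [RHS]exchange_big; apply: eq_bigr => i _.
  under [RHS]eq_bigr do rewrite mulr_sumr.
  rewrite [RHS]exchange_big; apply: eq_bigr => j _; rewrite /series /= mulr_sumr.
  by apply: eq_bigr => l _; rewrite /exp_coeff /= mulrA mulrC.
by apply: sumr_ge0 => l _; rewrite mulr_ge0 ?invr_ge0 //; exact: dot_expn_posdef.
Qed.

Lemma gauss_addition (r s t : R) : 0 <= r -> 0 <= s -> `|t| <= 1 ->
  series (fun n => phi Infty n r * phi Infty n s * t ^+ n) @ \oo
    --> gauss (Num.sqrt (r ^+ 2 + s ^+ 2 - 2 * r * s * t)).
Proof.
move=> r0 s0 t1.
have X0 : 0 <= r ^+ 2 + s ^+ 2 - 2 * r * s * t.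
  have -> : r ^+ 2 + s ^+ 2 - 2 * r * s * t = (r - s) ^+ 2 + 2 * r * s * (1 - t) by ring.
  rewrite addr_ge0 ?sqr_ge0 // !mulr_ge0 // subr_ge0.
  exact: le_trans (ler_norm t) t1.
have -> : gauss (Num.sqrt (r ^+ 2 + s ^+ 2 - 2 * r * s * t)) =
    expR (- (r ^+ 2 / 2)) * expR (- (s ^+ 2 / 2)) * expR (r * s * t).
  by rewrite /gauss sqr_sqrtr // -!expRD; congr expR; field.
set g := expR _ * expR _.
have c : (fun N => g * series (exp_coeff (r * s * t)) N) @ \oo --> g * expR (r * s * t).
  by apply: cvgMr; exact: is_cvg_series_exp_coeff.
apply: cvg_trans c; apply: near_eq_cvg; apply: nearW => N.
rewrite /series /= mulr_sumr; apply: eq_bigr => n _; rewrite /exp_coeff /= !exprMn.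
have f0 : 0 < Num.sqrt (n`!%:R : R) by rewrite sqrtr_gt0 ltr0n fact_gt0.
rewrite -[in LHS](@sqr_sqrtr R n`!%:R) //.
rewrite /g; move: f0 (expR _) (expR _) (r ^+ n) (s ^+ n) (t ^+ n); move: (Num.sqrt _) => f f0 a b x y z.
by field; rewrite gt_eqF.
Qed.

(** If all earlier coefficients vanish, dividing by t^m gives |b_m| <= t B for every t in (0, 1],
    where B is the sum of all |b_n|; then t tends to 0. *)
Lemma power_series_unique (b : nat -> R) : cvgn (series (fun n => `|b n|)) ->
  (forall t : R, `|t| <= 1 -> series (fun n => b n * t ^+ n) @ \oo --> (0 : R)) ->
  forall n, b n = 0.
Proof.
move=> cb b0 n; elim/ltn_ind: n => m IHm.
pose B := limn (series (fun n => `|b n|)).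
have nd : nondecreasing_seq (series (fun n => `|b n|)).
  by apply/nondecreasing_seqP => k; rewrite seriesSr lerDl.
have B0 : 0 <= B.
  by have := nondecreasing_cvgn_le nd cb 0%N; rewrite /series /= big_geq.
have key (t : R) : 0 < t -> t <= 1 -> `|b m| <= t * B.
  move=> t0 t1; have nt : `|t| <= 1 by rewrite gtr0_norm.
  have c : (fun N => `|b m * t ^+ m - series (fun n => b n * t ^+ n) N|) @ \oo --> `|b m * t ^+ m|.
    have -> : `|b m * t ^+ m| = `|b m * t ^+ m - 0| by rewrite subr0.
    apply: cvg_norm; apply: cvgB; [exact: cvg_cst|exact: b0].
  have le : `|b m * t ^+ m| <= t ^+ m.+1 * B.
    rewrite -(cvg_lim (@Rhausdorff R) c); apply: limr_le; first by apply/cvg_ex; eexists; exact: c.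
    exists m.+1 => // N /= mN.
    rewrite /series /= (big_cat_nat (n := m.+1)) //= big_nat_recr //= big_nat_cond big1 ?add0r; last first.
      by move=> i /andP[/andP[_ im] _]; rewrite IHm ?mul0r.
    rewrite opprD addNKr normrN.
    apply: le_trans (ler_norm_sum _ _ _) _.
    apply: (@le_trans _ _ (\sum_(m.+1 <= i < N) t ^+ m.+1 * `|b i|)).
      rewrite big_nat_cond [leRHS]big_nat_cond; apply: ler_sum => i /andP[/andP[mi _] _].
      rewrite normrM normrX (gtr0_norm t0) mulrC ler_wpM2r //.
      by rewrite -(subnK mi) exprD ler_piMl ?exprn_ge0 ?exprn_ile1 // ltW.
    rewrite -mulr_sumr ler_wpM2l ?exprn_ge0 ?(ltW t0) //.
    apply: le_trans (nondecreasing_cvgn_le nd cb N).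
    rewrite /series /= [leRHS](big_cat_nat (n := m.+1)) //= lerDr.
    by apply: sumr_ge0.
  move: le; rewrite normrM normrX (gtr0_norm t0) mulrC exprSr -mulrA ler_pM2l ?exprn_gt0 //.
apply/eqP; rewrite -normr_eq0 eq_le normr_ge0 andbT.
apply/ler_addgt0Pl => e e0; rewrite addr0.
(* With B + 1 in place of B the division is safe even when B = 0, and t B <= e follows. *)
pose t := Num.min 1 (e / (B + 1)).
have B1 : 0 < B + 1 by rewrite ltr_wpDl.
have t0 : 0 < t by rewrite lt_min ltr01 divr_gt0.
apply: le_trans (key t t0 _) _; first by rewrite ge_min lexx.
apply: (@le_trans _ _ (e / (B + 1) * (B + 1))); last by rewrite divfK ?gt_eqF.
by rewrite ler_pM ?(ltW t0) // ?lerDl // ge_min lexx orbT.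
Qed.

End InfiniteDimension.

Theorem theorem4p1 (R : realType) (d : dimension) (hd : dim_ge2 d)
    (mu : {finite_measure set R -> \bar R})
    (K : euclid R d -> euclid R d -> R[i]) (hK : stationary_kernel mu K) :
  associated K (alpha d mu) /\
  (forall a : nat -> R -> R -> R[i], associated K a ->
    forall (n : nat) (r s : R), 0 <= r -> 0 <= s ->
      a n r s = alpha d mu n r s).
Proof.
have norm11 : `|1 : R| <= 1 by rewrite normr1.
case: d hd K hK => [k|] hd K hK.
  have lam0 : 0 <= lambda_fin R k by exact: lambda_fin_ge0.
  have [Om hOm KE] := hK; have OmE := is_OmegaE hd hOm.
  (* The random vector behind Omega_d is recovered, since positive definiteness and orthogonality
     are both obtained by integrating over it. *)
  have [dT [T [P [U [v [hU v1 _]]]]]] := hOm.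
  have vv1 : dot v v = 1 by rewrite -enorm_sqr v1 expr1n.
  have uE n t : `|t| <= 1 -> gegenbauer_hat (lambda R (Fin k)) n t = zonal (lambda_fin R k) n t 1.
    exact: gegenbauer_hatE.
  have Ka : associated K (alpha (Fin k) mu).
    apply: (@associated_alpha R (Fin k) mu (@bessel_kappa R k) (@bessel_psi R k)
      (fun n t => zonal (lambda_fin R k) n t 1)) => //.
    - move=> t; rewrite (_ : @bessel_kappa R k = besselg (lambda_fin R k) 0); last first.
        by apply/funext => x; rewrite /besselg mul1r.
      exact: besselg_continuous.
    - by move=> t; rewrite /bessel_kappa sqrrN.
    - by rewrite /bessel_kappa expr0n besselG00.
    - exact: besselG_posdef hd hU.
    - move=> n t; apply: cvgMr; exact: besselg_continuous.
    - by move=> n; rewrite /bessel_psi besselg0 // mulr0.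
    - by move=> n t t0; exact: phi_finE.
    - by move=> n t; exact: zonal_le1.
    - by move=> n; exact: zonal11.
    - exact: bessel_psi_addition.
    - move=> x y; rewrite KE; apply/eqP; rewrite eq_complex /=; apply/andP; split; apply/eqP.
        by apply: eq_Rintegral => s _; rewrite OmE.
      by under eq_Rintegral do rewrite OmE /=; rewrite Rintegral_cst // mul0r.
  split=> // a Ka' n r s r0 s0.
  apply: (associated_unique hd uE _ _ Ka' Ka) => // [m|b cb b0]; first exact: zonal11.
  exact: (zonal_expansion_unique hd hU vv1 cb b0).
have uE n t : `|t| <= 1 -> gegenbauer_hat (lambda R Infty) n t = t ^+ n by [].
have gcont : continuous (@gauss R).
  move=> t; apply: continuous_comp; last exact: continuous_expR.
  by apply: cvgN; apply: cvgMl; exact: exprn_continuous.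
have Ka : associated K (alpha Infty mu).
  apply: (@associated_alpha R Infty mu (@gauss R) (@phi R Infty) (fun n t => t ^+ n)) => //.
  - by move=> t; rewrite /gauss sqrrN.
  - by rewrite /gauss expr0n mul0r oppr0 expR0.
  - exact: gauss_posdef.
  - by move=> n t; apply: cvgM; [exact: gcont|apply: cvgMl; exact: exprn_continuous].
  - by move=> n; rewrite /phi [0 ^+ n.+1]expr0n mul0r mulr0.
  - by move=> n t t1; rewrite normrX exprn_ile1.
  - by move=> n; rewrite expr1n.
  - exact: gauss_addition.
  - move=> x y; rewrite hK; congr (_%:C)%C; apply: eq_Rintegral => s _.
    by rewrite /gauss exprMn mulrA.
split=> // a Ka' n r s r0 s0.
apply: (associated_unique hd uE _ _ Ka' Ka) => // [m|]; first by rewrite expr1n.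
exact: power_series_unique.
Qed.
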